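(* Let $k\in\mathbb R$ and let $K$ be an integer. Every modular linear differential operator $L$ of type $(k,k+K)$ on $\Gamma_1=SL_2(\mathbb Z)$ has order at most $K/2$, and $L$ is a linear combination of operators of the form $f\mapsto[f,g]_r^{(k,K-2r)}$ with $g\in M_{K-2r}(\Gamma_1)$ and $K-2r>0$, together with (a multiple of) the Kaneko–Koike operator $\mathcal K_k^{K/2}$ if the order of $L$ is equal to $K/2$.
   Context: $\mathfrak H$ is the upper half-plane; for $\gamma=\begin{pmatrix}a&b\\c&d\end{pmatrix}\in SL_2(\mathbb R)$ and $k\in\mathbb R$, $(f|_k\gamma)(\tau)=(c\tau+d)^{-k}f\bigl(\frac{a\tau+b}{c\tau+d}\bigr)$. $D=\frac1{2\pi i}\frac d{d\tau}=q\frac d{dq}$, $q=e^{2\pi i\tau}$. $M_k(\Gamma_1)$ is the space of holomorphic modular forms of weight $k$ on $\Gamma_1$ (zero for $k<0$; constants for $k=0$). A modular linear differential operator (MLDO) of type $(k,k+K)$ (weight $K$) on a lattice $\Gamma\subset SL_2(\mathbb R)$ is a linear differential operator $L=\sum_{r=0}^n a_r(\tau)D^r$ of finite order with coefficients holomorphic on $\mathfrak H$ (and at the cusps in the usual sense) such that $L(f|_k\gamma)=L(f)|_{k+K}\gamma$ for every holomorphic $f$ on $\mathfrak H$ and every $\gamma\in\Gamma$. $E_2=1-24\sum_{n\ge1}\frac{nq^n}{1-q^n}$. Rankin–Cohen bracket: $[f,g]_n^{(k,\ell)}=\sum_{i=0}^n(-1)^i\binom{n+k-1}{n-i}\binom{n+\ell-1}{i}D^i(f)D^{n-i}(g)$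 (binomial coefficients as polynomials in $k,\ell$). Kaneko–Koike operator: $\mathcal K_k^n(f)=D^n(f)-\frac{k+n-1}{12}[f,E_2]_{n-1}^{(k,2)}$ for $n\ge1$, $\mathcal K_k^0(f)=f$.
   Formalization: In the Kaneko–Koike operator the bracket [f,E_2]_{n-1}^{(k,2)} is replaced by [E_2,f]_{n-1}^{(2,k)}; the two agree for odd n, but for even n the printed sign gives a non-modular operator and the claim fails (e.g. n=2, K=4, k≠-1). *)

(* Defs.v *)
From HB Require Import structures.
From mathcomp Require Import all_boot all_order all_algebra.
From mathcomp Require Import all_classical all_reals all_analysis.
From mathcomp Require Import complex.

Set Implicit Arguments.
Unset Strict Implicit.
Unset Printing Implicit Defensive.

Import Order.TTheory GRing.Theory Num.Theory.
Import numFieldNormedType.Exports.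

Local Open Scope classical_set_scope.
Local Open Scope ring_scope.
Local Open Scope complex_scope.

(** [R[i]] bundled as a [numClosedFieldType], so that
    [numFieldNormedType.Exports] provides its topology and normed structure;
    [derivable f z 1] and [derive1 f z] at this type are complex
    differentiability and the complex derivative. *)
Definition cplx (R : realType) : numClosedFieldType := R[i].

Definition mkC (R : realType) (x y : R) : cplx R := x +i* y.
Definition realC (R : realType) (x : R) : cplx R := mkC x 0.

Definition cexp (R : realType) (z : cplx R) : cplx R :=
  realC (expR (complex.Re z)) * mkC (cos (complex.Im z)) (sin (complex.Im z)).

(** Principal argument, in ]-pi, pi], for [z != 0]. *)
Definition carg (R : realType) (z : cplx R) : R :=
  let t := acos (complex.Re z / Normc.normc z) in
  if 0 <= complex.Im z then t else - t.

Definition clog (R : realType) (z : cplx R) : cplx R :=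
  mkC (ln (Normc.normc z)) (carg z).

(** Principal branch of z^s, s real, for [z != 0]; for integral s it is the
    usual integer power.  Only the values at c tau + d (never 0) matter. *)
Definition cpow (R : realType) (z : cplx R) (s : R) : cplx R :=
  cexp (realC s * clog z).

Definition upper_half (R : realType) : set (cplx R) :=
  [set tau : cplx R | 0 < complex.Im tau].

Definition holomorphicH (R : realType) (f : cplx R -> cplx R) : Prop :=
  forall tau : cplx R, upper_half tau -> derivable f tau 1.

Definition twopii (R : realType) : cplx R := mkC 0 (2 * pi).

Definition qexp (R : realType) (tau : cplx R) : cplx R := cexp (twopii R * tau).

Definition D (R : realType) (f : cplx R -> cplx R) : cplx R -> cplx R :=
  fun tau => (twopii R)^-1 * derive1 f tau.

Definition denomSL2 (R : realType) (g : 'M[R]_2) (tau : cplx R) : cplx R :=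
  realC (g 1 0) * tau + realC (g 1 1).

Definition moebius (R : realType) (g : 'M[R]_2) (tau : cplx R) : cplx R :=
  (realC (g 0 0) * tau + realC (g 0 1)) / denomSL2 g tau.

Definition slash (R : realType) (k : R) (f : cplx R -> cplx R) (g : 'M[R]_2) :
    cplx R -> cplx R :=
  fun tau => cpow (denomSL2 g tau) (- k) * f (moebius g tau).

Definition Gamma1 (R : realType) : set 'M[R]_2 :=
  [set map_mx intr g | g in [set g : 'M[int]_2 | \det g = 1]].

(** Holomorphy at the unique cusp of SL_2(Z): a q-expansion without negative
    powers, converging on the whole upper half-plane. *)
Definition holomorphic_at_cusp (R : realType) (f : cplx R -> cplx R) : Prop :=
  exists a : nat -> cplx R, forall tau, upper_half tau ->
    series (fun n => a n * qexp tau ^+ n) @ \oo --> f tau.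

Definition modular_form (R : realType) (l : int) (f : cplx R -> cplx R) : Prop :=
  [/\ holomorphicH f,
      (forall g tau, Gamma1 g -> upper_half tau -> slash l%:~R f g tau = f tau)
    & holomorphic_at_cusp f].

(** The differential operator sum_r a_r D^r is encoded by the list
    [:: a_0; a_1; ...] of its coefficients. *)
Definition diffop (R : realType) := seq (cplx R -> cplx R).

Definition dcoef (R : realType) (L : diffop R) (r : nat) : cplx R -> cplx R :=
  nth (fun=> 0) L r.

Definition dapply (R : realType) (L : diffop R) (f : cplx R -> cplx R) :
    cplx R -> cplx R :=
  fun tau => \sum_(r < size L) dcoef L r tau * iter r (@D R) f tau.

(** Trailing coefficients of the list may vanish on the half-plane, so the order
    is not [(size L).-1]; the zero operator has no order. *)
Definition has_order (R : realType) (L : diffop R) (n : nat) : Prop :=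
  (exists tau, upper_half tau /\ dcoef L n tau <> 0) /\
  (forall r tau, (n < r)%N -> upper_half tau -> dcoef L r tau = 0).

(** Modular linear differential operators of type (k, k + K) on SL_2(Z). *)
Definition is_MLDO (R : realType) (k : R) (K : int) (L : diffop R) : Prop :=
  (forall r, (r < size L)%N ->
     holomorphicH (dcoef L r) /\ holomorphic_at_cusp (dcoef L r)) /\
  (forall f g tau, holomorphicH f -> Gamma1 g -> upper_half tau ->
     dapply L (slash k f g) tau = slash (k + K%:~R) (dapply L f) g tau).

Definition E2 (R : realType) (tau : cplx R) : cplx R :=
  1 - 24%:R * limn (series (fun m : nat =>
        (m.+1)%:R * qexp tau ^+ m.+1 / (1 - qexp tau ^+ m.+1))).

(** Binomial coefficient "x choose m" as a polynomial in x. *)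
Definition gbinom (R : realType) (x : R) (m : nat) : R :=
  (\prod_(j < m) (x - j%:R)) / (m`!)%:R.

Definition RC (R : realType) (k l : R) (n : nat) (f g : cplx R -> cplx R) :
    cplx R -> cplx R :=
  fun tau => \sum_(i < n.+1) (-1) ^+ i *
    realC (gbinom (n%:R + k - 1) (n - i) * gbinom (n%:R + l - 1) i) *
    iter i (@D R) f tau * iter (n - i) (@D R) g tau.

(** The Kaneko-Koike operator, of type (k, k + 2n).  The bracket is taken with
    E2 in the first slot: [E2, f]_{n-1}^{(2, k)} = (-1)^(n-1) [f, E2]_{n-1}^{(k, 2)},
    and with this sign the coefficient of D^(n-1) f is -n (k + n - 1) / 12 * E2
    for every n, as modularity requires.  For odd n both orders of the arguments
    agree; for even n the order [f, E2] would give the opposite sign, and the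
    resulting operator is not modular (unless k = 1 - n).  For n = 2 this is
    f'' - (k + 1) / 6 * E2 f' + k (k + 1) / 12 * E2' f. *)
Definition kaneko_koike (R : realType) (k : R) (n : nat) (f : cplx R -> cplx R) :
    cplx R -> cplx R :=
  if n is m.+1 then
    fun tau => iter m.+1 (@D R) f tau -
      realC ((k + m.+1%:R - 1) / 12%:R) * RC 2 k m (@E2 R) f tau
  else f.

(** The operator T is a linear combination of operators
    f |-> [f, g]_r^{(k, K - 2r)} with g in M_{K - 2r} and K - 2r > 0. *)
Definition RC_combination (R : realType) (k : R) (K : int)
    (T : (cplx R -> cplx R) -> cplx R -> cplx R) : Prop :=
  exists (N : nat) (c : 'I_N -> cplx R) (r : 'I_N -> nat)
         (g : 'I_N -> cplx R -> cplx R),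
    (forall i, 0 < K - 2 * (r i)%:Z /\ modular_form (K - 2 * (r i)%:Z) (g i)) /\
    (forall f tau, holomorphicH f -> upper_half tau ->
       T f tau =
         \sum_(i < N) c i * RC k (K - 2 * (r i)%:Z)%:~R (r i) f (g i) tau).

(* Main.v *)
Require Import Defs.
From mathcomp Require Import all_boot all_order all_algebra.
From mathcomp Require Import all_classical all_reals all_analysis.
From mathcomp Require Import complex.
From mathcomp Require Import ring lra zify.

(** Put X = -c / (2 pi i (c tau + d)).  Expanding D^r (f|_k g) and testing
    L = sum_r a_r D^r on powers of z - g tau, modularity of L becomes

      a_j (g tau) = (c tau + d)^(K - 2j) sum_r C(r,j) (k+j)...(k+r-1) X^(r-j) a_r (tau).

    Hence the leading coefficient a_n is a modular form of weight K - 2n: it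
    vanishes if K < 2n, and is constant if K = 2n.  The coefficients of the
    Rankin-Cohen bracket with a modular form and those of the Kaneko-Koike
    operator obey the same law, so subtracting the bracket with leading
    coefficient a_n (or a multiple of the Kaneko-Koike operator if K = 2n)
    lowers the order.

    The Kaneko-Koike operator needs E2(-1/tau) = tau^2 E2(tau) + 12 tau / (2 pi i).
    The function zet(tau, z) below has zet(z+1) = zet(z), zet(z+tau) = zet(z) + 1 and
    a simple pole at 0.  Comparing it with its rescaling by -1/tau gives a doubly
    periodic odd function with a duplication formula and second differences
    O(a^2); duplication improves this bound by a factor 2 at each use, so the
    second differences vanish and the function is 0 at 1/(2N).  The first-order
    term as N -> oo is the law of E2. *)

Set Implicit Arguments.
Unset Strict Implicit.
Unset Printing Implicit Defensive.

Import Order.TTheory GRing.Theory Num.Theory.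
Import numFieldNormedType.Exports.

Local Open Scope classical_set_scope.
Local Open Scope ring_scope.

(** * Complex numbers and complex differentiability *)

(** Leading coefficients of weight at most 0 are handled by growth estimates. In weight -p the
    quantity |f|^2 / Im^p is invariant, hence bounded by its values at height at least 1/2, where
    the q-expansion is uniformly bounded; letting the height tend to 0 in Cauchy's estimate kills
    every coefficient. In weight 0 the function minus its constant term is bounded, and resumming
    its q-expansion shrinks any bound by the factor 2/3.

    As k is an arbitrary real number, the automorphy factors are principal powers of c tau + d.
    Every law concerns one matrix at a time, so the choice of branch is harmless; matrices are
    composed only for E2, whose exponent is the integer 2.

    For n > 0 the top coefficient of the bracket with a form of weight l = K - 2n contains the
    factor l. It is nonzero for l > 0 and vanishes for l = 0, which is why K = 2n requires an
    operator of another kind. E2 supplies it: the inhomogeneous term of its law, carried through the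
    bracket, is exactly what the leading term D^n contributes to the law of the coefficients. *)

Definition nm (R : realType) (z : cplx R) : R := Normc.normc z.

Section ComplexBasics.
Variable R : realType.
Local Notation C := (cplx R).
Implicit Types z w h : C.

Lemma normCE z : `|z| = realC (nm z). Proof. by []. Qed.
Lemma nm_ge0 z : 0 <= nm z.
Proof. by rewrite -lecR; exact: (normr_ge0 z). Qed.
Lemma nm0 : nm (0 : C) = 0. Proof. exact: Normc.normc0. Qed.
Lemma nm1 : nm (1 : C) = 1. Proof. exact: Normc.normc1. Qed.
Lemma nm0_eq0 z : nm z = 0 -> z = 0. Proof. exact: Normc.eq0_normc. Qed.
Lemma nm_gt0 z : (0 < nm z) = (z != 0).
Proof.
rewrite lt_def nm_ge0 andbT; apply/idP/idP; apply: contra.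
  by move/eqP->; rewrite nm0.
by move/eqP/nm0_eq0->.
Qed.
Lemma nmM z w : nm (z * w) = nm z * nm w. Proof. exact: Normc.normcM. Qed.
Lemma nmV z : nm z^-1 = (nm z)^-1. Proof. exact: Normc.normcV. Qed.
Lemma nmf_div z w : nm (z / w) = nm z / nm w. Proof. by rewrite nmM nmV. Qed.
Lemma nmN z : nm (- z) = nm z. Proof. exact: normcN. Qed.
Lemma nmD z w : nm (z + w) <= nm z + nm w. Proof. exact: le_normcD. Qed.
Lemma nmBC z w : nm (z - w) = nm (w - z). Proof. by rewrite -nmN opprB. Qed.
Lemma nmB z w : nm (z - w) <= nm z + nm w. Proof. by rewrite -(nmN w) nmD. Qed.
Lemma nmX z n : nm (z ^+ n) = nm z ^+ n.
Proof. by elim: n => [|n ih]; rewrite ?expr0 ?nm1 // !exprS nmM ih. Qed.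
Lemma nm_realC (x : R) : nm (realC x) = `|x|.
Proof. by rewrite /nm /= expr0n /= addr0 sqrtr_sqr. Qed.
Lemma nm_sub z w : nm z - nm w <= nm (z - w).
Proof. by rewrite lerBlDr -{1}(subrK w z) nmD. Qed.
Lemma nm_sum I (r : seq I) (P : pred I) (F : I -> C) :
  nm (\sum_(i <- r | P i) F i) <= \sum_(i <- r | P i) nm (F i).
Proof.
elim/big_rec2: _ => [|i y x _ ih]; first by rewrite nm0.
by rewrite (le_trans (nmD _ _))// lerD2l.
Qed.
Lemma nm_nat n : nm (n%:R : C) = n%:R.
Proof.
rewrite -[RHS]ger0_norm ?ler0n// -nm_realC; congr nm.
elim: n => [//|n ih]; rewrite -!natr1 ih.
by apply/eqP; rewrite eq_complex/= addr0 !eqxx.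
Qed.
Lemma nm_Re z : `|complex.Re z| <= nm z.
Proof.
case: z => a b; rewrite /nm /=.
by rewrite -sqrtr_sqr ler_wsqrtr// lerDl sqr_ge0.
Qed.
Lemma nm_Im z : `|complex.Im z| <= nm z.
Proof.
case: z => a b; rewrite /nm /=.
by rewrite -sqrtr_sqr ler_wsqrtr// lerDr sqr_ge0.
Qed.
Lemma nm_le_ReIm z : nm z <= `|complex.Re z| + `|complex.Im z|.
Proof.
have -> : z = realC (complex.Re z) + mkC 0 (complex.Im z).
  by case: z => a b; apply/eqP; rewrite eq_complex/= addr0 add0r !eqxx.
apply: le_trans (nmD _ _) _; rewrite nm_realC /= addr0 add0r lerD2l.
by rewrite /nm/= expr0n/= add0r sqrtr_sqr.
Qed.

Lemma realCD (x y : R) : realC (x + y) = realC x + realC y.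
Proof. by apply/eqP; rewrite eq_complex/= addr0 !eqxx. Qed.
Lemma realCN (x : R) : realC (- x) = - realC x.
Proof. by apply/eqP; rewrite eq_complex/= oppr0 !eqxx. Qed.
Lemma realCM (x y : R) : realC (x * y) = realC x * realC y.
Proof. by apply/eqP; rewrite eq_complex/= !mul0r !mulr0 subr0 addr0 !eqxx. Qed.
Lemma realC_nat n : realC (n%:R : R) = n%:R.
Proof. by elim: n => // n ih; rewrite -!natr1 realCD ih. Qed.
Lemma realC1 : realC (1 : R) = 1. Proof. by []. Qed.
Lemma realC0 : realC (0 : R) = 0. Proof. by []. Qed.
Lemma realCV (x : R) : realC x^-1 = (realC x)^-1.
Proof.
have [->|x0] := eqVneq x 0; first by rewrite realC0 !invr0.
have x0' : realC x != 0 by rewrite eq_complex/= (negbTE x0).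
by apply: (mulfI x0'); rewrite -realCM !mulfV.
Qed.

Lemma cReD z w : complex.Re (z + w) = complex.Re z + complex.Re w.
Proof. by case: z w => a b [c d]. Qed.
Lemma cImD z w : complex.Im (z + w) = complex.Im z + complex.Im w.
Proof. by case: z w => a b [c d]. Qed.
Lemma cReN z : complex.Re (- z) = - complex.Re z. Proof. by case: z. Qed.
Lemma cImN z : complex.Im (- z) = - complex.Im z. Proof. by case: z. Qed.
Lemma cReB z w : complex.Re (z - w) = complex.Re z - complex.Re w.
Proof. by rewrite cReD cReN. Qed.
Lemma cImB z w : complex.Im (z - w) = complex.Im z - complex.Im w.
Proof. by rewrite cImD cImN. Qed.
Lemma cReM z w :
  complex.Re (z * w) = complex.Re z * complex.Re w - complex.Im z * complex.Im w.
Proof. by case: z w => a b [c d]. Qed.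
Lemma cImM z w :
  complex.Im (z * w) = complex.Re z * complex.Im w + complex.Im z * complex.Re w.
Proof. by case: z w => a b [c d]. Qed.

(** Balls of [C] have radii in [C], where positivity forces a radius to be real; this restates
    limits with radii in [R]. *)
Lemma cvgCP T (F : set_system T) (FF : Filter F) (u : T -> C) (l : C) :
  u x @[x --> F] --> l <-> (forall e : R, 0 < e -> \forall x \near F, nm (u x - l) < e).
Proof.
split => [/cvgrPdist_lt ul e e0|ul].
  have := ul (realC e); rewrite ltcR => /(_ e0).
  by apply: filterS => x; rewrite normCE ltcR nmBC.
apply/cvgrPdist_lt => e; rewrite ltcE => /andP[/eqP/= Ie e0].
have := ul _ e0; apply: filterS => x.
have -> : e = realC (complex.Re e) by case: e Ie {e0} => a b /= ->.
by rewrite normCE ltcR nmBC.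
Qed.

Lemma seq_cvgCP (u : nat -> C) (l : C) :
  u @ \oo --> l <-> (forall e : R, 0 < e -> exists N, forall n, (N <= n)%N -> nm (u n - l) < e).
Proof.
rewrite cvgCP; split => ul e e0; have := ul e e0.
  by case=> N _ h; exists N => n Nn; exact: h.
by case=> N h; exists N => // n /= Nn; exact: h.
Qed.

Lemma near0CP (P : C -> Prop) :
  (\forall h \near (0 : C)^', P h) <->
  exists2 d : R, 0 < d & forall h, h != 0 -> nm h < d -> P h.
Proof.
split.
  rewrite nearE /dnbhs /within /= => /nbhs_ballP[e /= e0 h].
  move: e0 h; rewrite ltcE => /andP[/eqP/= Ie e0] h.
  exists (complex.Re e) => // z z0 zd; apply: (h) => //=.
  rewrite sub0r normrN normCE.
  by rewrite ltcE/= Ie eqxx.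
move=> [d d0 h]; rewrite nearE; apply/nbhs_ballP; exists (realC d) => /=.
  by rewrite ltcR.
by move=> z; rewrite -ball_normE /= sub0r normrN normCE ltcR => zd z0; apply: h.
Qed.

(** A first-order expansion without a quotient and with h = 0 allowed: the inner increment of a
    composition may vanish, so the chain rule is best estimated in this form. *)
Definition cdiff (f : C -> C) z (d : C) := forall e : R, 0 < e ->
  exists2 dl : R, 0 < dl & forall h, nm h < dl -> nm (f (z + h) - f z - d * h) <= e * nm h.

Lemma cdiffP (f : C -> C) z (d : C) : is_derive z 1 f d <-> cdiff f z d.
Proof.
have E h : h != 0 ->
    nm (h^-1 *: (f (h *: 1 + z) - f z) - d) = nm (f (z + h) - f z - d * h) / nm h.
  move=> h0; rewrite -nmf_div; congr nm.
  by rewrite scaler1 (addrC h) [RHS]mulrBl mulfK//; congr (_ - _); exact: mulrC.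
split.
  move=> [df dE] e e0.
  have /cvgCP/(_ _ e0)/near0CP[dl dl0 H] := df.
  exists dl => // h hd; have [->|h0] := eqVneq h 0.
    by rewrite addr0 subrr mulr0 subr0 nm0 mulr0.
  have := H h h0 hd; rewrite /= -/(derive f z 1) dE E// ltr_pdivrMr ?nm_gt0//.
  exact: ltW.
move=> H.
have cv : h^-1 *: (f (h *: 1 + z) - f z) @[h --> (0:C)^'] --> d.
  apply/cvgCP => e e0; apply/near0CP.
  have [dl dl0 h] := H (e / 2) (divr_gt0 e0 (ltr0Sn _ _)); exists dl => // x x0 xd.
  rewrite E//; apply: (@le_lt_trans _ _ (e / 2)).
    by rewrite ler_pdivrMr ?nm_gt0// h.
  by rewrite ltr_pdivrMr// ltr_pMr// ltr1n.
by split; [apply/cvg_ex; exists d | exact/cvg_lim].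
Qed.

Lemma is_derive_compC (f g : C -> C) z (a b : C) :
  is_derive (g z) 1 f a -> is_derive z 1 g b -> is_derive z 1 (f \o g) (a * b).
Proof.
move=> /cdiffP df /cdiffP dg; apply/cdiffP => e e0.
pose K := nm b + 1.
have K0 : 0 < K by rewrite ltr_wpDl ?nm_ge0.
have [d1 d10 H1] := df (e / 2 / K) (divr_gt0 (divr_gt0 e0 (ltr0Sn _ _)) K0).
pose e2 := Num.min 1 (e / 2 / (nm a + 1)).
have a1 : 0 < nm a + 1 by rewrite ltr_wpDl ?nm_ge0.
have e20 : 0 < e2 by rewrite lt_min ltr01 !divr_gt0.
have [d2 d20 H2] := dg e2 e20.
exists (Num.min d2 (d1 / K)); first by rewrite lt_min d20 divr_gt0.
move=> h; rewrite lt_min ltr_pdivlMr// => /andP[hd2 hd1].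
have := H2 h hd2; set r := g (z + h) - g z - b * h => rh.
pose k := b * h + r.
have gE : g (z + h) = g z + k by rewrite /k /r; ring.
have kh : nm k <= K * nm h.
  rewrite (le_trans (nmD _ _))// nmM mulrDl lerD2l.
  by rewrite (le_trans rh)// ler_wpM2r ?nm_ge0// ge_min lexx.
have kd : nm k < d1 by apply: le_lt_trans kh _; rewrite mulrC.
have := H1 k kd; rewrite -gE /= => rk.
have -> : f (g (z + h)) - f (g z) - a * b * h =
  (f (g (z + h)) - f (g z) - a * k) + a * r by rewrite /k; ring.
rewrite (le_trans (nmD _ _))// [X in _ <= X * _](splitr e) mulrDl lerD//.
  rewrite (le_trans rk)// -mulrA ler_wpM2l ?divr_ge0 ?(ltW e0)//.
  by rewrite mulrC ler_pdivrMr// [X in _ <= X]mulrC.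
rewrite nmM; apply: (@le_trans _ _ (nm a * (e / 2 / (nm a + 1) * nm h))).
  by rewrite ler_wpM2l ?nm_ge0// (le_trans rh)// ler_wpM2r ?nm_ge0// ge_min lexx orbT.
rewrite mulrA ler_wpM2r ?nm_ge0// mulrCA ler_piMr ?divr_ge0 ?(ltW e0)//.
by rewrite ler_pdivrMr// mul1r lerDl.
Qed.

Lemma abs_cvg_series (a : nat -> C) (b : nat -> R) (s : R) :
  (forall n, nm (a n) <= b n) -> (forall n, series b n <= s) ->
  exists2 l : C, series a @ \oo --> l & nm l <= s.
Proof.
move=> ab bs.
have part (p : C -> R) : (forall z, `|p z| <= nm z) -> (forall z w, p (z + w) = p z + p w) ->
    p 0 = 0 -> exists l : R, series (p \o a) @ \oo --> l.
  move=> pn pD p0; exists (lim (series (p \o a) @ \oo)); apply: normed_cvg.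
  apply: nondecreasing_is_cvgn.
    by apply: nondecreasing_series => n _ _; rewrite normr_ge0.
  exists s => _ [n _ <-]; apply: le_trans (bs n).
  by apply: ler_sum => i _; exact: le_trans (pn _) (ab _).
have serE (p : C -> R) : (forall z w, p (z + w) = p z + p w) -> p 0 = 0 ->
    forall n, series (p \o a) n = p (series a n).
  move=> pD p0 n; rewrite /series /=.
  by elim: n => [|n ih]; [rewrite !big_geq | rewrite !big_nat_recr//= pD ih].
have [x Hx] := part (@complex.Re R) nm_Re cReD erefl.
have [y Hy] := part (@complex.Im R) nm_Im cImD erefl.
have cv : series a @ \oo --> mkC x y.
  apply/cvgCP => e e0.
  have e2 : 0 < e / 2 by rewrite divr_gt0.
  move/cvgrPdist_lt/(_ _ e2) : Hx; move/cvgrPdist_lt/(_ _ e2) : Hy.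
  apply: filterS2 => n hy hx.
  rewrite distrC (serE (@complex.Re R) cReD erefl) in hx.
  rewrite distrC (serE (@complex.Im R) cImD erefl) in hy.
  apply: le_lt_trans (nm_le_ReIm _) _; rewrite (splitr e); apply: ltrD.
    by rewrite cReB.
  by rewrite cImB.
move: (mkC x y) cv => l cv; exists l; first exact: cv.
apply/ler_addgt0Pr => e e0.
move/cvgCP/(_ _ e0) : cv => [N _ /(_ N (leqnn _)) /= hN].
rewrite -[l](subrK (series a N)) (le_trans (nmD _ _))// addrC lerD//; last first.
  by rewrite nmBC ltW.
apply: le_trans (nm_sum _ _ _) _; apply: le_trans (bs N).
by apply: ler_sum => i _; exact: ab.
Qed.

Lemma cvgC_unique (u : nat -> C) (a b : C) : u @ \oo --> a -> u @ \oo --> b -> a = b.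
Proof. by move=> /cvg_lim <-// /cvg_lim <-. Qed.

End ComplexBasics.

(** * The complex exponential, logarithm and powers *)

Section ComplexExp.
Variable R : realType.
Local Notation C := (cplx R).
Implicit Types z w h : C.

Lemma cexpD z w : cexp (z + w) = cexp z * cexp w.
Proof.
case: z w => a b [c d]; rewrite /cexp /= expRD cosD sinD.
by apply/eqP; rewrite eq_complex/=; apply/andP; split; apply/eqP; ring.
Qed.
Lemma cexp0 : cexp (0 : C) = 1.
Proof.
rewrite /cexp /= expR0 cos0 sin0.
by apply/eqP; rewrite eq_complex/= !mul1r !mul0r subr0 addr0 !eqxx.
Qed.
Lemma cexp_neq0 z : cexp z != 0.
Proof.
apply/eqP => z0; have : cexp (z - z) = 0 by rewrite cexpD z0 mul0r.
by rewrite subrr cexp0; apply/eqP; exact: oner_neq0.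
Qed.
Lemma cexpN z : cexp (- z) = (cexp z)^-1.
Proof. by apply: (mulfI (cexp_neq0 z)); rewrite -cexpD subrr cexp0 mulfV// cexp_neq0. Qed.
Lemma cexpB z w : cexp (z - w) = cexp z / cexp w.
Proof. by rewrite cexpD cexpN. Qed.
Lemma cexpMn z n : cexp (n%:R * z) = cexp z ^+ n.
Proof.
elim: n => [|n ih]; first by rewrite mul0r cexp0.
by rewrite -natr1 mulrDl mul1r cexpD ih exprSr.
Qed.
Lemma nm_cexp z : nm (cexp z) = expR (complex.Re z).
Proof.
rewrite /cexp nmM nm_realC ger0_norm ?expR_ge0//.
by rewrite [X in _ * X]/nm/= cos2Dsin2 sqrtr1 mulr1.
Qed.

Lemma cexp_Re z : complex.Re (cexp z) = expR (complex.Re z) * cos (complex.Im z).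
Proof. by rewrite /cexp cReM /= mul0r subr0. Qed.
Lemma cexp_Im z : complex.Im (cexp z) = expR (complex.Re z) * sin (complex.Im z).
Proof. by rewrite /cexp cImM /= mul0r addr0. Qed.

Lemma real_deriv_eps (f : R -> R) (x d : R) : is_derive x 1 f d ->
  forall e : R, 0 < e -> exists2 dl : R, 0 < dl &
    forall t : R, `|t| < dl -> `|f (x + t) - f x - d * t| <= e * `|t|.
Proof.
move=> [df dE] e e0.
have /cvgrPdist_lt/(_ _ e0) := df.
rewrite nearE /dnbhs /within /= => /nbhs_ballP[dl /= dl0 H].
exists dl => // h hd; have [->|h0] := eqVneq h 0.
  by rewrite addr0 subrr mulr0 subr0 normr0 mulr0.
have hb : ball (0 : R) dl h by rewrite -ball_normE /= sub0r normrN.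
have := H h hb h0; rewrite -/(derive f x 1) dE /= => Hh.
have -> : f (x + h) - f x - d * h = - ((d - h^-1 *: (f (h%:A + x) - f x)) * h).
  by rewrite [_ *: (_ - _)]mulrC [h%:A]mulr1 (addrC h) mulrBl divfK// opprB.
by rewrite normrN normrM ler_pM2r ?normr_gt0// ltW.
Qed.

Lemma cexp_eps (e : R) : 0 < e -> exists2 dl : R, 0 < dl &
  forall h, nm h < dl -> nm (cexp h - 1 - h) <= e * nm h.
Proof.
(* The errors below add up to 3 [e1] + 4 [e1], which e / 10 keeps under e; the bound 1 gives |1 + x|
   <= 2. *)
move=> e0; pose e1 := Num.min (e / 10) 1.
have e10 : 0 < e1 by rewrite lt_min ltr01 divr_gt0.
have e1e : e1 <= e / 10 by rewrite ge_min lexx.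
have e11 : e1 <= 1 by rewrite ge_min lexx orbT.
move: e1 e10 e1e e11 => e1 e10 e1e e11.
have [d1 d10 H1] := real_deriv_eps (is_derive_expR 0) e10.
have [d2 d20 H2] := real_deriv_eps (is_derive_cos 0) e10.
have [d3 d30 H3] := real_deriv_eps (is_derive_sin 0) e10.
pose d := Num.min (Num.min d1 d2) (Num.min d3 e1).
exists d; first by rewrite !lt_min d10 d20 d30 e10.
case=> x y; set h := (X in nm X < _) => hd.
have dle (t : R) : `|t| <= nm h -> [/\ `|t| < d1, `|t| < d2, `|t| < d3 & `|t| < e1].
  by move=> /le_lt_trans/(_ hd); rewrite !lt_min => /andP[/andP[-> ->] /andP[-> ->]].
have xh : `|x| <= nm h := nm_Re h.
have yh : `|y| <= nm h := nm_Im h.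
have [xd1 _ _ xe] := dle x xh.
have [_ yd2 yd3 ye] := dle y yh.
have := H1 x xd1; have := H2 y yd2; have := H3 y yd3.
rewrite !add0r expR0 cos0 sin0 oppr0 mul0r !addr0 !subr0 !mul1r => A3 A2 A1.
have x1 : `|1 + x| <= 2.
  by rewrite (le_trans (ler_normD _ _))// normr1 lerD2l (le_trans (ltW xe)).
have cy : `|cos y| <= 1 by rewrite ler_norml cos_geN1 cos_le1.
have sy : `|sin y| <= 1 by rewrite ler_norml sin_geN1 sin_le1.
have nh := nm_ge0 h.
have M (p q r s : R) : `|p| <= r -> `|q| <= s -> `|p * q| <= r * s.
  by move=> *; rewrite normrM ler_pM.
have B1 : `|expR x * cos y - 1 - x| <= 3 * e1 * nm h.
  have -> : expR x * cos y - 1 - x = (expR x - 1 - x) * cos y + (1 + x) * (cos y - 1) by ring.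
  apply: le_trans (ler_normD _ _) _.
  have := M _ _ _ _ A1 cy; have := M _ _ _ _ x1 A2.
  have := ler_wpM2l (ltW e10) xh; have := ler_wpM2l (ltW e10) yh; lra.
have B2 : `|expR x * sin y - y| <= 4 * e1 * nm h.
  have -> : expR x * sin y - y = (expR x - 1 - x) * sin y + (1 + x) * (sin y - y) + x * y by ring.
  apply: le_trans (ler_normD _ _) _; apply: le_trans (lerD (ler_normD _ _) (lexx _)) _.
  have := M _ _ _ _ A1 sy; have := M _ _ _ _ x1 A3; have := M _ _ _ _ (ltW xe) yh.
  have := ler_wpM2l (ltW e10) xh; have := ler_wpM2l (ltW e10) yh; lra.
apply: le_trans (nm_le_ReIm _) _.
rewrite -/h.
have -> : complex.Re (cexp h - 1 - h) = expR x * cos y - 1 - x.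
  by rewrite !cReB cexp_Re.
have -> : complex.Im (cexp h - 1 - h) = expR x * sin y - y.
  by rewrite !cImB cexp_Im subr0.
have E1 : e1 * nm h <= e / 10 * nm h by rewrite ler_wpM2r.
apply: le_trans (lerD B1 B2) _.
have -> : 3 * e1 * nm h + 4 * e1 * nm h = 7 * (e1 * nm h) by ring.
apply: le_trans (ler_wpM2l _ E1) _ => //.
rewrite mulrA ler_wpM2r//; lra.
Qed.

Lemma is_derive_cexp z : is_derive z 1 (@cexp R) (cexp z).
Proof.
apply/cdiffP => e e0.
have c0 : 0 < nm (cexp z) by rewrite nm_gt0 cexp_neq0.
have [dl dl0 H] := cexp_eps (divr_gt0 e0 c0).
exists dl => // h /H hd.
have -> : cexp (z + h) - cexp z - cexp z * h = cexp z * (cexp h - 1 - h).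
  by rewrite cexpD; ring.
rewrite nmM; have := ler_wpM2l (ltW c0) hd.
by rewrite mulrA mulrCA mulfV ?mulr1// gt_eqF.
Qed.

Lemma cargE z : z != 0 ->
  nm z * cos (carg z) = complex.Re z /\ nm z * sin (carg z) = complex.Im z.
Proof.
move=> z0; have n0 : 0 < nm z by rewrite nm_gt0.
have n0' : nm z != 0 by rewrite gt_eqF.
set t := complex.Re z / nm z.
have t1 : -1 <= t <= 1.
  by rewrite -ler_norml normrM normfV (ger0_norm (nm_ge0 _)) ler_pdivrMr// mul1r nm_Re.
have n2 : nm z ^+ 2 = complex.Re z ^+ 2 + complex.Im z ^+ 2.
  by case: z {z0 n0 n0' t t1} => a b; rewrite /nm /= sqr_sqrtr// addr_ge0 ?sqr_ge0.
have s2 : nm z * Num.sqrt (1 - t ^+ 2) = `|complex.Im z|.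
  have -> : 1 - t ^+ 2 = complex.Im z ^+ 2 / nm z ^+ 2.
    by rewrite /t; field : n2; rewrite n0'.
  rewrite sqrtrM ?sqr_ge0// sqrtr_sqr -exprVn sqrtr_sqr normfV (ger0_norm (nm_ge0 _)).
  by rewrite mulrCA mulfV// mulr1.
have tI : t \in `[-1, 1] by rewrite in_itv/=.
rewrite /carg -/(nm z) -/t; case: ifPn => Im0.
  by rewrite acosK// sin_acos// s2 ger0_norm// /t mulrCA mulfV// mulr1.
rewrite cosN sinN acosK// sin_acos// mulrN s2 ltr0_norm ?ltNge// opprK.
by rewrite /t mulrCA mulfV// mulr1.
Qed.

Lemma clogK z : z != 0 -> cexp (clog z) = z.
Proof.
move=> z0; have n0 : 0 < nm z by rewrite nm_gt0.
have [cE sE] := cargE z0.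
rewrite /cexp /= -/(nm z) lnK ?posrE//.
by apply/eqP; rewrite eq_complex/= !mul0r subr0 addr0 cE sE !eqxx.
Qed.

Lemma nm_cvg T (F : set_system T) {FF : Filter F} (f : T -> C) z :
  f x @[x --> F] --> z -> nm (f x) @[x --> F] --> nm z.
Proof.
move=> /cvgCP fz; apply/cvgrPdist_lt => e /fz.
apply: filterS => x; apply: le_lt_trans.
rewrite ler_norml; apply/andP; split; last by rewrite nmBC nm_sub.
by rewrite lerNl opprB nm_sub.
Qed.
Lemma cRe_cvg T (F : set_system T) {FF : Filter F} (f : T -> C) z :
  f x @[x --> F] --> z -> complex.Re (f x) @[x --> F] --> complex.Re z.
Proof.
move=> /cvgCP fz; apply/cvgrPdist_lt => e /fz.
by apply: filterS => x; apply: le_lt_trans; rewrite distrC -cReB nm_Re.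
Qed.
Lemma cIm_cvg T (F : set_system T) {FF : Filter F} (f : T -> C) z :
  f x @[x --> F] --> z -> complex.Im (f x) @[x --> F] --> complex.Im z.
Proof.
move=> /cvgCP fz; apply/cvgrPdist_lt => e /fz.
by apply: filterS => x; apply: le_lt_trans; rewrite distrC -cImB nm_Im.
Qed.

(** Off the real axis one branch of [carg] is valid near z, so continuity reduces to that of [acos].
    This domain suffices: Im (c tau + d) = c Im tau is nonzero as soon as c is. *)
Lemma clog_cont z : complex.Im z != 0 ->
  forall e : R, 0 < e -> exists2 dl : R, 0 < dl &
    forall h, h != 0 -> nm h < dl -> nm (clog (z + h) - clog z) < e.
Proof.
move=> I0 e e0; apply/near0CP.
have z0 : z != 0 by apply: contra_neq I0 => ->.
have n0 : 0 < nm z by rewrite nm_gt0.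
have cz : (z + h) @[h --> (0 : C)^'] --> z.
  apply/cvgCP => d d0; apply/near0CP; exists d => // h _.
  by rewrite (addrC z) addrK.
have cn : nm (z + h) @[h --> (0 : C)^'] --> nm z by exact: nm_cvg.
have cr : complex.Re (z + h) @[h --> (0 : C)^'] --> complex.Re z by exact: cRe_cvg.
have ci : complex.Im (z + h) @[h --> (0 : C)^'] --> complex.Im z by exact: cIm_cvg.
have ct : complex.Re (z + h) / nm (z + h) @[h --> (0 : C)^'] --> complex.Re z / nm z.
  by apply: cvgM => //; apply: cvgV => //; rewrite gt_eqF.
have t1 : -1 < complex.Re z / nm z < 1.
  rewrite -ltr_norml normrM normfV (ger0_norm (nm_ge0 _)) ltr_pdivrMr// mul1r.
  case: z I0 {z0 n0 cz cn cr ci ct} => a b /= b0.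
  rewrite /nm /= -sqrtr_sqr ltr_sqrt ?ltrDl ?exprn_even_gt0//.
  by rewrite ltr_wpDl ?sqr_ge0// exprn_even_gt0.
have ca : acos (complex.Re (z + h) / nm (z + h)) @[h --> (0 : C)^'] -->
    acos (complex.Re z / nm z).
  by apply: (continuous_cvg _ _ ct); exact: continuous_acos.
have cl : ln (nm (z + h)) @[h --> (0 : C)^'] --> ln (nm z).
  by apply: (continuous_cvg _ _ cn); exact: continuous_ln.
have cc : carg (z + h) @[h --> (0 : C)^'] --> carg z.
  rewrite /carg; case: ifPn => I1.
    have Ip : 0 < complex.Im z by rewrite lt_def I0.
    apply: (cvg_trans _ ca); apply: near_eq_cvg.
    have : \forall h \near (0 : C)^', 0 < complex.Im (z + h) by exact: (cvgr_gt _ ci).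
    by apply: filterS => h hI; rewrite (ltW hI).
  have Ip : complex.Im z < 0 by rewrite ltNge.
  apply: (cvg_trans _ (cvgN ca)); apply: near_eq_cvg.
  have : \forall h \near (0 : C)^', complex.Im (z + h) < 0 by exact: (cvgr_lt _ ci).
  by apply: filterS => h hI; rewrite leNgt hI.
have e2 : 0 < e / 2 by rewrite divr_gt0.
move/cvgrPdist_lt/(_ _ e2) : cl; move/cvgrPdist_lt/(_ _ e2) : cc.
apply: filterS2 => h h1 h2; apply: le_lt_trans (nm_le_ReIm _) _.
by rewrite (splitr e) cReB cImB ltrD// distrC.
Qed.

(** Inverse function argument: the increment k of the logarithm is small by continuity, exp k = 1 +
    h / z, and exp k - 1 - k is small compared with k. *)
Lemma is_derive_clog z : complex.Im z != 0 -> is_derive z 1 (@clog R) z^-1.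
Proof.
move=> I0; apply/cdiffP => e e0.
have z0 : z != 0 by apply: contra_neq I0 => ->.
have n0 : 0 < nm z by rewrite nm_gt0.
(* The bound 1/2 absorbs the error into k and gives |k| <= 2 |h / z|; the other bound then turns
   [e1] |k| into at most e |h|. *)
pose e1 := Num.min (1 / 2) (e * nm z / 2).
have e10 : 0 < e1 by rewrite lt_min !divr_gt0 ?mulr_gt0.
have [d1 d10 H1] := cexp_eps e10.
have [d2 d20 H2] := clog_cont I0 d10.
exists (Num.min d2 (nm z)); first by rewrite lt_min d20.
move=> h; rewrite lt_min => /andP[hd hz].
have [->|h0] := eqVneq h 0; first by rewrite addr0 subrr mulr0 subr0 nm0 mulr0.
have := H2 h h0 hd; set k := clog (z + h) - clog z => kd.
have zh0 : z + h != 0.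
  by apply: contraTneq hz => /eqP; rewrite addr_eq0 => /eqP ->; rewrite nmN ltxx.
have kE : cexp k = 1 + z^-1 * h.
  by rewrite /k cexpB !clogK// mulrDl mulfV// mulrC.
have := H1 k kd; rewrite kE => rk.
have rE : nm (k - z^-1 * h) <= e1 * nm k.
  by rewrite nmBC; have -> : z^-1 * h - k = 1 + z^-1 * h - 1 - k by ring.
have kk : nm k <= 2 * (nm h / nm z).
  have : nm k <= nm (k - z^-1 * h) + nm (z^-1 * h) by rewrite -[X in nm X <= _](subrK (z^-1 * h)) nmD.
  have -> : nm h / nm z = nm (z^-1 * h) by rewrite nmM nmV mulrC.
  have : e1 * nm k <= 1 / 2 * nm k by rewrite ler_wpM2r ?nm_ge0// ge_min lexx.
  have := nm_ge0 k; move: rE; lra.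
apply: (le_trans rE); apply: (le_trans (ler_wpM2l (ltW e10) kk)).
apply: (@le_trans _ _ (e * nm z / 2 * (2 * (nm h / nm z)))).
  by rewrite ler_wpM2r ?mulr_ge0 ?nm_ge0 ?invr_ge0 ?nm_ge0// ge_min lexx orbT.
by rewrite le_eqVlt; apply/orP; left; apply/eqP; field; rewrite gt_eqF.
Qed.

Lemma cpowD z (s t : R) : cpow z (s + t) = cpow z s * cpow z t.
Proof. by rewrite /cpow realCD mulrDl cexpD. Qed.
Lemma cpow0 z : cpow z 0 = 1.
Proof. by rewrite /cpow realC0 mul0r cexp0. Qed.
Lemma cpow_neq0 z s : cpow z s != 0. Proof. exact: cexp_neq0. Qed.
Lemma cpowN z s : cpow z (- s) = (cpow z s)^-1.
Proof. by rewrite /cpow realCN mulNr cexpN. Qed.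
Lemma cpow_nat z n : z != 0 -> cpow z n%:R = z ^+ n.
Proof. by move=> z0; rewrite /cpow realC_nat cexpMn clogK. Qed.

Lemma is_derive_cpow z s : complex.Im z != 0 ->
  is_derive z 1 (fun w => cpow w s) (realC s * cpow z s / z).
Proof.
move=> I0.
have D1 : is_derive z 1 (fun w => realC s * clog w) (realC s * z^-1).
  by have := is_deriveZ (realC s) (is_derive_clog I0).
have := is_derive_compC (is_derive_cexp _) D1.
rewrite -/(cpow z s) mulrCA mulrA; exact.
Qed.

End ComplexExp.

(** * Power series *)

Section CSum.
Variable R : realType.
Local Notation C := (cplx R).

(* An inductive wrapper: the filter inclusion behind [-->] is a function type,
   which would make trailing arguments of lemmas about a bare definition implicit. *)
Variant csum (u : nat -> C) (l : C) : Prop := CSum of series u @ \oo --> l.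
Lemma csumE u l : csum u l <-> series u @ \oo --> l.
Proof. by split=> [[]|]. Qed.

Lemma csum_unique u a b : csum u a -> csum u b -> a = b.
Proof. by move=> /csumE ua /csumE ub; exact: cvgC_unique ua ub. Qed.
Lemma csum_ext u v l : (forall n, u n = v n) -> csum u l -> csum v l.
Proof. by move=> /funext ->. Qed.
Lemma csumD u v a b : csum u a -> csum v b -> csum (fun n => u n + v n) (a + b).
Proof.
move=> /csumE ua /csumE vb; apply/csumE.
have -> : series (fun n => u n + v n) = (fun n => series u n + series v n).
  by apply/funext => n; rewrite /series /= big_split.
exact: (cvgD ua vb).
Qed.
Lemma csumZ (k : C) u a : csum u a -> csum (fun n => k * u n) (k * a).
Proof.
move=> /csumE ua; apply/csumE.
have -> : series (fun n => k * u n) = (fun n => k * series u n).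
  by apply/funext => n; rewrite /series /= big_distrr.
exact: (cvgM (cvg_cst k) ua).
Qed.
Lemma csumN u a : csum u a -> csum (fun n => - u n) (- a).
Proof.
move=> /(csumZ (-1)); rewrite mulN1r; apply: csum_ext => n.
by rewrite mulN1r.
Qed.
Lemma csumB u v a b : csum u a -> csum v b -> csum (fun n => u n - v n) (a - b).
Proof. by move=> ua /csumN; exact: csumD. Qed.
Lemma csum0 : csum (fun=> 0) 0.
Proof.
apply/csumE; have -> : series (fun=> 0 : C) = (fun=> 0).
  by apply/funext => n; rewrite /series /= big1.
exact: cvg_cst.
Qed.
Lemma csum_abs u (b : nat -> R) (s : R) : (forall n, nm (u n) <= b n) ->
  (forall n, series b n <= s) -> exists2 l, csum u l & nm l <= s.
Proof. by move=> ub bs; have [l /csumE ul ls] := abs_cvg_series ub bs; exists l. Qed.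
Lemma csum_nm u l (b : nat -> R) (s : R) : (forall n, nm (u n) <= b n) ->
  (forall n, series b n <= s) -> csum u l -> nm l <= s.
Proof.
move=> ub bs ul; have [l' ul' ls] := csum_abs ub bs.
by rewrite (csum_unique ul ul').
Qed.
Lemma csum_shift u l : csum (fun n => u n.+1) l <-> csum u (u 0%N + l).
Proof.
have E n : series u n.+1 - (u 0%N + l) = series (fun n => u n.+1) n - l.
  by rewrite /series /= big_nat_recl//=; ring.
split => /csumE/seq_cvgCP H; apply/csumE/seq_cvgCP => e /H [N HN].
  by exists N.+1 => -[//|n] Nn; rewrite E HN.
by exists N => n Nn; rewrite -E HN// (leq_trans Nn).
Qed.
Lemma series_tail (V : zmodType) (u : nat -> V) N k :
  series (fun k => u (k + N)%N) k = series u (k + N)%N - series u N.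
Proof.
rewrite /series /=; elim: k => [|k ih]; first by rewrite big_geq// add0n subrr.
by rewrite addSn !big_nat_recr//= ih addrAC.
Qed.
Lemma csum_tail u l N : csum u l -> csum (fun k => u (k + N)%N) (l - series u N).
Proof.
move=> /csumE/seq_cvgCP H; apply/csumE/seq_cvgCP => e /H [M HM].
exists M => n Mn; rewrite series_tail opprB addrA subrK HM//.
by rewrite (leq_trans Mn)// leq_addr.
Qed.
Lemma csum_alternate u a b l : csum (fun m => u m.*2) a -> csum (fun m => u m.*2.+1) b ->
  csum u l -> l = a + b.
Proof.
move=> /csumE ua /csumE ub /csumE ul; apply: (@cvgC_unique _ (fun n => series u n.*2)).
  move/seq_cvgCP : ul => ul; apply/seq_cvgCP => e /ul[N HN]; exists N => n Nn.
  by apply: HN; rewrite (leq_trans Nn)// -addnn leq_addr.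
have -> : (fun n => series u n.*2) = (fun n => series (fun m => u m.*2) n + series (fun m => u m.*2.+1) n).
  apply/funext => n; rewrite /series /=.
  elim: n => [|n ih]; first by rewrite !big_geq// addr0.
  rewrite doubleS !big_nat_recr//= ih; ring.
exact: (cvgD ua ub).
Qed.
Lemma csum_term0 u l : csum u l -> forall e : R, 0 < e -> exists N, forall n, (N <= n)%N -> nm (u n) < e.
Proof.
move=> /csumE/seq_cvgCP ul e e0; have [N HN] := ul _ (divr_gt0 e0 (ltr0Sn _ 1)).
exists N => n Nn; have -> : u n = (series u n.+1 - l) - (series u n - l).
  by rewrite /series /= big_nat_recr//=; ring.
apply: le_lt_trans (nmB _ _) _; rewrite (splitr e) ltrD// HN//.
exact: leq_trans Nn _.
Qed.

End CSum.

(** * Power series converging in the unit disc, and their termwise differentiation *)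

Section PowerSeries.
Variable R : realType.
Local Notation C := (cplx R).
Implicit Types (a b : nat -> C) (q h : C) (r : R).

Lemma geo_series (x : R) n : 0 <= x < 1 -> \sum_(0 <= k < n) x ^+ k <= (1 - x)^-1.
Proof.
move=> /andP[x0 x1]; have x1' : 0 < 1 - x by rewrite subr_gt0.
rewrite -(ler_pM2r x1') mulVf ?gt_eqF//.
have -> : (\sum_(0 <= k < n) x ^+ k) * (1 - x) = 1 - x ^+ n.
  elim: n => [|n ih]; first by rewrite big_geq// mul0r expr0 subrr.
  by rewrite big_nat_recr//= mulrDl ih exprS; ring.
by rewrite gerBl exprn_ge0.
Qed.
Lemma geo_series_le (c x : R) n : 0 <= c -> 0 <= x < 1 ->
  series (fun k => c * x ^+ k) n <= c / (1 - x).
Proof. by move=> c0 x01; rewrite /series /= -big_distrr /= ler_wpM2l// geo_series. Qed.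
Lemma natr_expr_le (x : R) n : 0 <= x < 1 -> n%:R * x ^+ n <= (1 - x)^-1.
Proof.
move=> x01; apply: le_trans (geo_series n x01).
rewrite big_mkord; case/andP : x01 => x0 x1.
rewrite mulr_natl -[n in _ *+ n]card_ord -sumr_const ler_sum// => i _.
by apply: ler_wiXn2l => //; rewrite ?(ltW x1)// ltnW.
Qed.

(** Radius of convergence at least 1, in a form stable under multiplication of the coefficients by
    n. *)
Definition tame a := forall r, 0 < r < 1 -> exists M, forall n, nm (a n) * r ^+ n <= M.

Lemma tame_sum a (rho : R) : tame a -> 0 <= rho < 1 ->
  exists2 S : R, 0 <= S & forall n, series (fun n => nm (a n) * rho ^+ n) n <= S.
Proof.
(* A radius strictly between [rho] and 1 leaves a convergent geometric series of ratio [rho / r]. *)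
move=> ga /andP[r0 r1]; pose r := (1 + rho) / 2.
have rr : rho < r by rewrite /r; lra.
have r01 : 0 < r < 1 by rewrite /r; lra.
have rp : 0 < r by case/andP : r01.
have [M HM] := ga r r01.
have M0 : 0 <= M by apply: le_trans (HM 0%N); rewrite mulr_ge0 ?nm_ge0// exprn_ge0// ltW.
have x01 : 0 <= rho / r < 1 by rewrite divr_ge0 ?(ltW rp)//= ltr_pdivrMr// mul1r.
exists (M / (1 - rho / r)).
  by rewrite divr_ge0// subr_ge0 ltW//; case/andP : x01.
move=> n; apply: le_trans (geo_series_le n M0 x01).
apply: ler_sum => k _; rewrite expr_div_n mulrA mulrAC ler_wpM2r ?exprn_ge0//.
by rewrite ler_pdivlMr ?exprn_gt0.
Qed.

Definition ps a q : C := limn (series (fun n => a n * q ^+ n)).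

Lemma nm_term a q n : nm (a n * q ^+ n) = nm (a n) * nm q ^+ n.
Proof. by rewrite nmM nmX. Qed.

Lemma nmq01 q : nm q < 1 -> 0 <= nm q < 1. Proof. by rewrite nm_ge0. Qed.

Lemma ps_csum a q : tame a -> nm q < 1 -> csum (fun n => a n * q ^+ n) (ps a q).
Proof.
move=> ga q1; have [S _ HS] := tame_sum ga (nmq01 q1).
have [n|l Hl _] := csum_abs (u := fun n => a n * q ^+ n) _ HS; first by rewrite nm_term.
by move/csumE : (Hl) => Hl'; rewrite /ps (cvg_lim _ Hl').
Qed.
Lemma ps_eq a q l : csum (fun n => a n * q ^+ n) l -> ps a q = l.
Proof. by move=> /csumE H; rewrite /ps (cvg_lim _ H). Qed.

Lemma ps_bound a (rho : R) : tame a -> rho < 1 ->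
  exists2 S : R, 0 <= S & forall q, nm q <= rho -> nm (ps a q) <= S.
Proof.
move=> ga r1; have [r0|r0] := leP 0 rho; last first.
  exists 0 => // q qr; have := nm_ge0 q; lra.
have [|S S0 HS] := tame_sum ga (rho := rho); first by rewrite r0.
exists S => // q qr; apply: csum_nm (ps_csum ga (le_lt_trans qr r1)) => //.
by move=> n; rewrite nm_term ler_wpM2l ?nm_ge0// lerXn2r// ?nnegrE ?nm_ge0.
Qed.

Lemma tameD a b : tame a -> tame b -> tame (fun n => a n + b n).
Proof.
move=> ga gb r r01; have [M HM] := ga r r01; have [N HN] := gb r r01.
exists (M + N) => n; apply: le_trans (lerD (HM n) (HN n)).
by rewrite -mulrDl ler_wpM2r ?nmD// exprn_ge0// ltW//; case/andP : r01.
Qed.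
Lemma tameZ (k : C) a : tame a -> tame (fun n => k * a n).
Proof.
move=> ga r r01; have [M HM] := ga r r01.
by exists (nm k * M) => n; rewrite nmM -mulrA ler_wpM2l ?nm_ge0.
Qed.
Lemma tameMn a : tame a -> tame (fun n => n%:R * a n).
Proof.
move=> ga r /andP[r0 r1]; pose s := (1 + r) / 2.
have s01 : 0 < s < 1 by rewrite /s; lra.
have rs : r < s by rewrite /s; lra.
have s0 : 0 < s by case/andP : s01.
have [M HM] := ga s s01.
have x01 : 0 <= r / s < 1 by rewrite divr_ge0 ?ltW//= ltr_pdivrMr// mul1r.
exists ((1 - r / s)^-1 * M) => n; rewrite nmM nm_nat.
have -> : n%:R * nm (a n) * r ^+ n = (n%:R * (r / s) ^+ n) * (nm (a n) * s ^+ n).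
  by rewrite expr_div_n; field; rewrite expf_neq0// gt_eqF.
apply: ler_pM; last exact: HM.
- by rewrite mulr_ge0// exprn_ge0//; case/andP : x01.
- by rewrite mulr_ge0 ?nm_ge0 ?exprn_ge0 ?(ltW s0).
- exact: natr_expr_le.
Qed.
Lemma tame_shift a : tame a -> tame (fun n => a n.+1).
Proof.
move=> ga r r01; have [M HM] := ga r r01; have r0 : 0 < r by case/andP : r01.
exists (M / r) => n; rewrite ler_pdivlMr//.
by apply: le_trans (HM n.+1); rewrite exprSr mulrA.
Qed.

(** The factor [rho ^+ 2] on the left avoids the exponent n - 2, which is negative for n < 2. *)
Lemma taylor_pow (rho : R) q h n : 0 < rho -> nm q <= rho -> nm (q + h) <= rho ->
  rho ^+ 2 * nm ((q + h) ^+ n - q ^+ n - n%:R * q ^+ n.-1 * h) <=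
  n%:R ^+ 2 * rho ^+ n * nm h ^+ 2.
Proof.
move=> r0 qr qhr; elim: n => [|n ih].
  by rewrite !expr0 subrr mul0r mul0r subr0 nm0 mulr0 expr0n !mul0r.
have E : (q + h) ^+ n.+1 - q ^+ n.+1 - n.+1%:R * q ^+ n.+1.-1 * h =
  (q + h) * ((q + h) ^+ n - q ^+ n - n%:R * q ^+ n.-1 * h) + n%:R * q ^+ n.-1 * h ^+ 2.
  rewrite /= -natr1; case: n {ih} => [|n] /=; first by rewrite !expr0 !expr1; ring.
  by rewrite -!natr1 !exprS; ring.
rewrite E; apply: (@le_trans _ _ (rho ^+ 2 * (rho * nm ((q + h) ^+ n - q ^+ n - n%:R * q ^+ n.-1 * h))
   + rho ^+ 2 * (n%:R * rho ^+ n.-1 * nm h ^+ 2))).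
  rewrite -mulrDr ler_wpM2l ?exprn_ge0 ?(ltW r0)// (le_trans (nmD _ _))// !nmM lerD//.
    by rewrite ler_wpM2r ?nm_ge0.
  rewrite nm_nat !nmX -expr2 ler_wpM2r ?exprn_ge0 ?nm_ge0// ler_wpM2l ?ler0n//.
  by rewrite lerXn2r// ?nnegrE ?nm_ge0// ltW.
rewrite mulrCA; apply: le_trans (lerD (ler_wpM2l (ltW r0) ih) (lexx _)) _.
have -> : rho ^+ 2 * (n%:R * rho ^+ n.-1 * nm h ^+ 2) = n%:R * rho ^+ n.+1 * nm h ^+ 2.
  by case: n {ih E} => [|n] /=; rewrite ?mul0r ?mulr0// !exprS; ring.
have -> : rho * (n%:R ^+ 2 * rho ^+ n * nm h ^+ 2) + n%:R * rho ^+ n.+1 * nm h ^+ 2 =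
   (n%:R ^+ 2 + n%:R) * (rho ^+ n.+1 * nm h ^+ 2) by rewrite !exprS; ring.
rewrite -mulrA ler_wpM2r ?mulr_ge0 ?exprn_ge0 ?nm_ge0 ?(ltW r0)//.
rewrite -natr1; have := ler0n R n; lra.
Qed.

(** By [taylor_pow] the second-order remainders are dominated by n^2 |a_n| rho^n |h|^2 / rho^2, and
    the coefficients n^2 a_n are still tame. *)
Lemma is_derive_ps a q : tame a -> nm q < 1 ->
  is_derive q 1 (ps a) (ps (fun n => n.+1%:R * a n.+1) q).
Proof.
move=> ga q1.
pose rho := (1 + nm q) / 2; have q0 := nm_ge0 q.
have r01 : 0 <= rho < 1 by rewrite /rho; lra.
have r0 : 0 < rho by rewrite /rho; lra.
have qr : nm q < rho by rewrite /rho; lra.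
have ga' : tame (fun n => n.+1%:R * a n.+1) by exact: (tame_shift (tameMn ga)).
have [S S0 HS] := tame_sum (tameMn (tameMn ga)) r01.
apply/cdiffP => e e0.
exists (Num.min (rho - nm q) (e * rho ^+ 2 / (S + 1))).
  rewrite lt_min subr_gt0 qr/=; apply: divr_gt0; last by rewrite ltr_wpDl.
  by rewrite mulr_gt0// exprn_gt0.
move=> h; rewrite lt_min => /andP[h1 h2].
have qh : nm (q + h) <= rho by apply: le_trans (nmD _ _) _; move: h1; lra.
have qh1 : nm (q + h) < 1 by apply: le_lt_trans qh _; case/andP : r01.
have D1 : csum (fun n => n%:R * a n * q ^+ n.-1) (ps (fun n => n.+1%:R * a n.+1) q).
  by have := proj1 (csum_shift (fun n => n%:R * a n * q ^+ n.-1) _) (ps_csum ga' q1); rewrite !mul0r add0r.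
have := csumB (csumB (ps_csum ga qh1) (ps_csum ga q1)) (csumZ h D1).
set d := _ - _ * ps _ q => sd.
rewrite [ps _ q * h]mulrC.
have : nm d <= S / rho ^+ 2 * nm h ^+ 2.
  apply: (@csum_nm _ _ _ (fun n => (rho ^- 2 * nm h ^+ 2) * (nm (n%:R * (n%:R * a n)) * rho ^+ n))) sd.
    move=> n; have := taylor_pow n r0 (ltW qr) qh.
    rewrite -[_ - h * _]/(a n * (q + h) ^+ n - a n * q ^+ n - h * (n%:R * a n * q ^+ n.-1)).
    have -> : a n * (q + h) ^+ n - a n * q ^+ n - h * (n%:R * a n * q ^+ n.-1) =
       a n * ((q + h) ^+ n - q ^+ n - n%:R * q ^+ n.-1 * h) by ring.
    rewrite !nmM nm_nat -ler_pdivlMl ?exprn_gt0// => H.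
    apply: le_trans (ler_wpM2l (nm_ge0 (a n)) H) _.
    by rewrite le_eqVlt; apply/orP; left; apply/eqP; ring.
  move=> n; rewrite /series /= -big_distrr /=.
  have -> : S / rho ^+ 2 * nm h ^+ 2 = rho ^- 2 * nm h ^+ 2 * S by ring.
  by rewrite ler_wpM2l ?HS// mulr_ge0 ?invr_ge0 ?exprn_ge0 ?nm_ge0 ?(ltW r0).
move=> Hd; apply: (le_trans Hd).
have -> : S / rho ^+ 2 * nm h ^+ 2 = (S * nm h) / rho ^+ 2 * nm h by ring.
rewrite ler_wpM2r ?nm_ge0// ler_pdivrMr ?exprn_gt0//.
move: h2; rewrite ltr_pdivlMr ?ltr_wpDl// => /ltW; apply: le_trans.
by rewrite mulrC ler_wpM2l ?nm_ge0// lerDl.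
Qed.

End PowerSeries.

(** * Expansions in q *)

Section QExp.
Variable R : realType.
Local Notation C := (cplx R).
Implicit Types (z w tau : C) (f g : C -> C) (a b : nat -> C).
Local Notation H := (@upper_half R).

Lemma qexpD z w : qexp (z + w) = qexp z * qexp w.
Proof. by rewrite /qexp mulrDr cexpD. Qed.
Lemma qexpN z : qexp (- z) = (qexp z)^-1.
Proof. by rewrite /qexp mulrN cexpN. Qed.
Lemma qexpB z w : qexp (z - w) = qexp z / qexp w.
Proof. by rewrite qexpD qexpN. Qed.
Lemma qexp0 : qexp (0 : C) = 1. Proof. by rewrite /qexp mulr0 cexp0. Qed.
Lemma qexp_neq0 z : qexp z != 0. Proof. exact: cexp_neq0. Qed.
Lemma qexpMn z n : qexp (n%:R * z) = qexp z ^+ n.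
Proof. by rewrite /qexp mulrCA cexpMn. Qed.
Lemma Re_twopii z : complex.Re (twopii R * z) = - (2 * pi * complex.Im z).
Proof. by rewrite cReM /= mul0r sub0r. Qed.
Lemma Im_twopii z : complex.Im (twopii R * z) = 2 * pi * complex.Re z.
Proof. by rewrite cImM /= mul0r add0r. Qed.
Lemma nm_qexp z : nm (qexp z) = expR (- (2 * pi * complex.Im z)).
Proof. by rewrite nm_cexp Re_twopii. Qed.
Lemma twopi_gt0 : 0 < 2 * pi :> R. Proof. by rewrite mulr_gt0 ?pi_gt0. Qed.
Lemma twopii_neq0 : twopii R != 0.
Proof. by rewrite eq_complex/= negb_and orbC gt_eqF// twopi_gt0. Qed.
Lemma nm_qexp_lt1 tau : H tau -> nm (qexp tau) < 1.
Proof.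
by move=> Ht; rewrite nm_qexp -[ltRHS]expR0 ltr_expR oppr_lt0 mulr_gt0 ?twopi_gt0//; exact: Ht.
Qed.
Lemma qexp1 : qexp (1 : C) = 1.
Proof.
apply/eqP; rewrite eq_complex cexp_Re cexp_Im Re_twopii Im_twopii /= !mulr0 oppr0 !mulr1.
by rewrite expR0 !mul1r mulr_natl cos2pi sin2pi !eqxx.
Qed.
Lemma qexp_nat n : qexp (n%:R : C) = 1.
Proof. by rewrite -[n%:R]mulr1 qexpMn qexp1 expr1n. Qed.
Lemma qexp_int (n : int) : qexp (n%:~R : C) = 1.
Proof.
case: n => n; first exact: qexp_nat.
by rewrite NegzE mulrNz qexpN qexp_nat invr1.
Qed.
Lemma realC_int (n : int) : realC (n%:~R : R) = n%:~R.
Proof.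
case: n => n; first exact: realC_nat.
by rewrite NegzE !mulrNz realCN realC_nat.
Qed.
Lemma qexp_half : qexp (2^-1 : C) = -1.
Proof.
have -> : (2^-1 : C) = realC (2^-1) by rewrite realCV (realC_nat _ 2).
apply/eqP; rewrite eq_complex cexp_Re cexp_Im Re_twopii Im_twopii /= !mulr0 oppr0.
have -> : 2 * pi * 2^-1 = pi :> R by field.
by rewrite expR0 !mul1r cospi sinpi !eqxx.
Qed.

(** The modulus forces Im w = 0. For the fractional part x of Re w, cos (2 pi x) = 1 gives sin (pi
    x) = 0, which is excluded on ]0, 1[. *)
Lemma qexp_eq1 w : qexp w = 1 -> exists n : int, w = n%:~R.
Proof.
move=> w1; have I0 : complex.Im w = 0.
  have : nm (qexp w) = 1 by rewrite w1 nm1.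
  rewrite nm_qexp -[RHS]expR0 => /expR_inj/eqP; rewrite oppr_eq0 mulf_eq0.
  by rewrite gt_eqF ?twopi_gt0//= => /eqP.
pose n := Num.floor (complex.Re w); exists n.
have /andP[n1 n2] := floor_itv (complex.Re w); rewrite -/n in n1 n2.
pose x := complex.Re w - n%:~R.
have wE : w = realC x + n%:~R.
  rewrite /x realCD realCN realC_int subrK.
  by case: w I0 {w1 n x n1 n2} => u v /= ->.
suff x0 : x = 0 by rewrite wE x0 add0r.
have x01 : 0 <= x < 1 by move: n2; rewrite intrD /x; lra.
have : complex.Re (qexp (realC x)) = 1.
  by move: w1; rewrite wE qexpD qexp_int mulr1 => ->.
rewrite cexp_Re Re_twopii Im_twopii /= mulr0 oppr0 expR0 mul1r.
have -> : 2 * pi * x = (pi * x) *+ 2 by rewrite mulr2n; ring.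
rewrite cos_mulr2n => c1.
have s0 : sin (pi * x) ^+ 2 = 0.
  by have := cos2Dsin2 (pi * x); move: c1; rewrite mulr2n; lra.
apply/eqP; apply/negPn/negP => xn0.
have : 0 < sin (pi * x).
  apply: sin_gt0_pi; rewrite mulr_gt0 ?pi_gt0//=; last by case/andP : x01 => ? ?; rewrite lt_def xn0.
  by rewrite -[ltRHS]mulr1 ltr_pM2l ?pi_gt0//; case/andP : x01.
by move/eqP : s0; rewrite expf_eq0/= => /eqP ->; rewrite ltxx.
Qed.

Lemma is_derive_qexp z : is_derive z 1 (@qexp R) (twopii R * qexp z).
Proof.
have D1 : is_derive z 1 (fun w : C => twopii R * w) (twopii R).
  have := is_deriveZ (twopii R) (is_derive_id z (1 : C)).
  by rewrite [_ *: 1]mulr1.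
by have := is_derive_compC (is_derive_cexp _) D1; rewrite mulrC.
Qed.

(** The working form of holomorphy at the cusp, with its coefficients exposed. It is stable under
    [D], so such an f may be differentiated indefinitely. *)
Definition isq f a := tame a /\ forall tau, H tau -> f tau = ps a (qexp tau).

Lemma isq_csum f a tau : isq f a -> H tau -> csum (fun n => a n * qexp tau ^+ n) (f tau).
Proof. by case=> ga fE Ht; rewrite fE//; apply: ps_csum => //; exact: nm_qexp_lt1. Qed.

Lemma qexp_surj (r : R) : 0 < r < 1 -> exists2 tau, H tau & qexp tau = realC r.
Proof.
move=> /[dup] r01 /andP[r0 r1]; pose y := - ln r / (2 * pi).
have y0 : 0 < y by rewrite divr_gt0 ?twopi_gt0// oppr_gt0 ln_lt0.
exists (mkC 0 y) => //; apply/eqP.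
have yE : 2 * pi * y = - ln r by rewrite /y mulrC divfK// gt_eqF// twopi_gt0.
rewrite eq_complex cexp_Re cexp_Im Re_twopii Im_twopii /= !mulr0 cos0 sin0 mulr0 mulr1 eqxx andbT.
by rewrite yE opprK lnK.
Qed.

(** Every r in ]0, 1[ is a value of [qexp] on the half-plane. Convergence there makes the terms a_n
    r^n tend to 0, hence bounded, and this is tameness. *)
Lemma cuspP f : holomorphic_at_cusp f <-> exists a, isq f a.
Proof.
split=> -[a]; last first.
  by move=> fa; exists a => tau Ht; apply/csumE; exact: isq_csum.
move=> Ha0; have Ha tau : H tau -> csum (fun n => a n * qexp tau ^+ n) (f tau).
  by move=> Ht; apply/csumE; exact: Ha0.
have ga : tame a.
  move=> r r01; have [tau Ht qE] := qexp_surj r01.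
  have [N HN] := csum_term0 (Ha tau Ht) ltr01.
  exists (1 + \sum_(k < N) nm (a k) * r ^+ k) => n.
  have r0 : 0 <= r by case/andP : r01 => /ltW.
  have P k : 0 <= nm (a k) * r ^+ k by rewrite mulr_ge0 ?nm_ge0 ?exprn_ge0.
  have [nN|Nn] := ltnP n N.
    rewrite (bigD1 (Ordinal nN))//= addrCA lerDl addr_ge0// sumr_ge0//.
  apply: le_trans (_ : 1 <= _); last by rewrite lerDl sumr_ge0.
  by have := HN n Nn; rewrite qE nmM nmX nm_realC ger0_norm// => /ltW.
exists a; split => // tau Ht; rewrite (ps_eq (Ha tau Ht))//.
Qed.

Lemma isqD f g a b : isq f a -> isq g b -> isq (fun t => f t + g t) (fun n => a n + b n).
Proof.
move=> fa gb; split; first by apply: tameD; [case: fa | case: gb].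
move=> tau Ht; apply/esym/ps_eq.
apply: csum_ext (csumD (isq_csum fa Ht) (isq_csum gb Ht)) => n.
by rewrite mulrDl.
Qed.
Lemma isqZ (k : C) f a : isq f a -> isq (fun t => k * f t) (fun n => k * a n).
Proof.
move=> fa; split; first by apply: tameZ; case: fa.
move=> tau Ht; apply/esym/ps_eq.
apply: csum_ext (csumZ k (isq_csum fa Ht)) => n.
by rewrite mulrA.
Qed.
Lemma isq_eq f g a : isq f a -> (forall tau, H tau -> f tau = g tau) -> isq g a.
Proof. by move=> [ga fE] fg; split => // tau Ht; rewrite -fg// fE. Qed.
Lemma isq_cst (k : C) : isq (fun=> k) (fun n => if n is 0%N then k else 0).
Proof.
split.
  move=> r /andP[r0 _]; exists (nm k) => -[|n]; first by rewrite expr0 mulr1.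
  by rewrite nm0 mul0r nm_ge0.
move=> tau Ht; apply/esym/ps_eq.
set u := fun n => _.
have -> : k = u 0%N + 0 by rewrite /u expr0 mulr1 addr0.
by apply/csum_shift; apply: csum_ext (csum0 R) => n; rewrite /u mul0r.
Qed.

Lemma near_H tau : H tau -> \forall w \near tau, H w.
Proof.
move=> Ht; apply/nbhs_ballP; exists (realC (complex.Im tau)) => /=.
  by rewrite ltcR.
move=> w; rewrite -ball_normE /= normCE ltcR => wt.
have := nm_Im (tau - w); rewrite cImB ler_norml => /andP[_ h].
by rewrite /upper_half /=; lra.
Qed.

Lemma is_derive_eqH f g tau (d : C) : H tau -> (forall w, H w -> f w = g w) ->
  is_derive tau 1 f d -> is_derive tau 1 g d.
Proof.
move=> Ht fg; apply: near_eq_is_derive.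
by have := near_H Ht; apply: filterS => w Hw; exact: fg.
Qed.

Lemma derive1_val f tau (d : C) : is_derive tau 1 f d -> derive1 f tau = d.
Proof. by case=> _ <-; rewrite derive1E. Qed.

Lemma D_val f tau (d : C) : is_derive tau 1 f (twopii R * d) -> D f tau = d.
Proof. by move=> /derive1_val; rewrite /D => ->; rewrite mulKf// twopii_neq0. Qed.

Lemma D_eqH f g : (forall w, H w -> f w = g w) -> forall w, H w -> D f w = D g w.
Proof.
move=> fg w Hw; rewrite /D !derive1E.
have nfg : \forall z \near w, f z = g z.
  by have := near_H Hw; apply: filterS => z Hz; exact: fg.
by rewrite (near_eq_derive (1 : C) nfg).
Qed.

Lemma isq_derive f a tau : isq f a -> H tau ->
  is_derive tau 1 f (twopii R * ps (fun n => n%:R * a n) (qexp tau)).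
Proof.
move=> fa Ht; have [ga fE] := fa; have q1 := nm_qexp_lt1 Ht.
apply: (is_derive_eqH Ht (fun w Hw => esym (fE w Hw))).
have := is_derive_compC (is_derive_ps ga q1) (is_derive_qexp tau).
suff -> : ps (fun n => n%:R * a n) (qexp tau) =
  qexp tau * ps (fun n => n.+1%:R * a n.+1) (qexp tau).
  by rewrite mulrCA [qexp _ * _]mulrC.
apply: ps_eq; set u := fun n => _.
have -> : qexp tau * ps (fun n => n.+1%:R * a n.+1) (qexp tau) =
    u 0%N + qexp tau * ps (fun n => n.+1%:R * a n.+1) (qexp tau) by rewrite /u !mul0r add0r.
apply/csum_shift; apply: csum_ext (csumZ (qexp tau) (ps_csum (tame_shift (tameMn ga)) q1)) => n.
by rewrite /u exprS; ring.
Qed.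

Lemma isq_D f a : isq f a -> isq (D f) (fun n => n%:R * a n).
Proof.
move=> fa; split; first by apply: tameMn; case: fa.
by move=> tau Ht; apply: D_val; exact: isq_derive.
Qed.
Lemma isq_iterD f a n : isq f a -> exists b, isq (iter n (@D R) f) b.
Proof.
move=> fa; elim: n => [|n [b ih]]; first by exists a.
by exists (fun m => m%:R * b m); exact: isq_D.
Qed.
Lemma isq_D_derive f a tau : isq f a -> H tau -> is_derive tau 1 f (twopii R * D f tau).
Proof.
by move=> fa Ht; have [_ DE] := isq_D fa; rewrite DE//; exact: isq_derive.
Qed.
Lemma isq_holo f a : isq f a -> holomorphicH f.
Proof. by move=> fa tau Ht; have [] := isq_D_derive fa Ht. Qed.

Lemma qexp_per (n : int) tau : qexp (tau + n%:~R) = qexp tau.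
Proof. by rewrite qexpD qexp_int mulr1. Qed.
Lemma ImDint (n : int) tau : complex.Im (tau + n%:~R) = complex.Im tau.
Proof. by rewrite cImD -realC_int /= addr0. Qed.
Lemma HDint (n : int) tau : H tau -> H (tau + n%:~R).
Proof. by rewrite /upper_half /= ImDint. Qed.
Lemma isq_per f a (n : int) tau : isq f a -> H tau -> f (tau + n%:~R) = f tau.
Proof. by case=> _ fE Ht; rewrite !fE ?qexp_per//; exact: HDint. Qed.

Lemma root_unity_sum N k : (0 < N)%N -> (0 < k)%N -> (k < N)%N ->
  \sum_(j < N) qexp (k%:R / N%:R : C) ^+ j = 0.
Proof.
move=> N0 k0 kN; set w := qexp _.
have Nn : (N%:R : C) != 0 by rewrite pnatr_eq0 -lt0n.
have wN : w ^+ N = 1 by rewrite /w -qexpMn mulrCA mulfV// mulr1 qexp_nat.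
have w1 : w != 1.
  apply/eqP => /qexp_eq1 [n /(congr1 (fun x => x * N%:R))]; rewrite divfK// => kE.
  have : (N %| k)%N.
    suff : (N%:Z %| k%:Z)%Z by rewrite dvdzE.
    apply/dvdzP; exists n; apply/eqP; rewrite -(eqr_int C) intrM; exact/eqP.
  by move=> /(dvdn_leq k0); rewrite leqNgt kN.
apply/eqP; have := subrX1 w N; rewrite wN subrr => /esym/eqP.
by rewrite mulf_eq0 subr_eq0 (negbTE w1).
Qed.

Lemma coef_bound f a n (y M : R) : isq f a -> 0 < y ->
  (forall x : R, nm (f (mkC x y)) <= M) -> nm (a n) * expR (- (2 * pi * y)) ^+ n <= M.
Proof.
move=> fa y0 HM; apply/ler_addgt0Pr => e e0.
set r := expR _.
(* Averaging a truncation of the q-expansion over the N-th roots of unity isolates [a n]. *)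
have r1 : r < 1 by rewrite /r -[ltRHS]expR0 ltr_expR oppr_lt0 mulr_gt0 ?twopi_gt0.
have r0 : 0 < r by exact: expR_gt0.
have [ga fE] := fa.
have [S S0 HS] := tame_sum ga (rho := r) (introT andP (conj (ltW r0) r1)).
(* The truncation error is uniform in x because the modulus of [qexp (mkC x y)] depends on y alone;
   n < N keeps the term of index n. *)
have tail : exists N, (n < N)%N /\ forall x : R, nm (\sum_(0 <= k < N) a k * qexp (mkC x y) ^+ k - f (mkC x y)) <= e.
  have nc : cvgn (series (fun k => nm (a k) * r ^+ k)).
    apply: nondecreasing_is_cvgn.
      by apply: nondecreasing_series => k _ _; rewrite mulr_ge0 ?nm_ge0 ?exprn_ge0 ?(ltW r0).
    by exists S => _ [k _ <-].
  have /cvgrPdist_lt/(_ _ e0)[N0 _ HN0] := nc.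
  exists (maxn N0 n.+1); split; first by rewrite leq_max leqnn orbT.
  move=> x; set N := maxn _ _.
  have NN : (N0 <= N)%N by rewrite leq_max leqnn.
  have Hx : H (mkC x y) by [].
  have qx : nm (qexp (mkC x y)) = r by rewrite nm_qexp.
  have sh := csum_tail N (isq_csum fa Hx).
  rewrite nmBC; apply: (csum_nm (b := fun k => nm (a (k + N)%N) * r ^+ (k + N)) _ _ sh).
    by move=> k; rewrite /= nmM nmX qx.
  move=> k; have := HN0 N NN; set l := lim _ => Hl.
  have sl m : series (fun k => nm (a k) * r ^+ k) m <= l.
    apply: nondecreasing_cvgn_le => //.
    by apply: nondecreasing_series => i _ _; rewrite mulr_ge0 ?nm_ge0 ?exprn_ge0 ?(ltW r0).
  rewrite (series_tail (fun k => nm (a k) * r ^+ k)).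
  have := sl (k + N)%N; have := ler_norm (l - series (fun k => nm (a k) * r ^+ k) N).
  move: Hl; lra.
have [N [nN HN]] := tail.
have N0 : (0 < N)%N by exact: leq_ltn_trans nN.
have Nn : (N%:R : C) != 0 by rewrite pnatr_eq0 -lt0n.
pose x (j : nat) : R := j%:R / N%:R.
pose q0 := qexp (mkC 0 y).
have qx j : qexp (mkC (x j) y) = qexp (j%:R / N%:R) * q0.
  rewrite /q0 -qexpD; congr qexp; rewrite -(realC_nat _ j) -(realC_nat _ N) -realCV -realCM.
  by apply/eqP; rewrite eq_complex/= addr0 add0r !eqxx.
have qm (k j : nat) : qexp (j%:R / N%:R : C) ^+ k = qexp (k%:R / N%:R) ^+ j.
  by rewrite -!qexpMn; congr qexp; ring.
have key : a n * q0 ^+ n * N%:R =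
    \sum_(j < N) (\sum_(0 <= k < N) a k * qexp (mkC (x j) y) ^+ k) / qexp (n%:R / N%:R) ^+ j.
  under eq_bigr => j _ do rewrite big_mkord mulr_suml.
  rewrite exchange_big (bigD1 (Ordinal nN))//= [X in _ + X]big1 ?addr0.
    rewrite (eq_bigr (fun=> a n * q0 ^+ n)); first by rewrite sumr_const card_ord mulr_natr.
    move=> j _; rewrite qx exprMn (qm n j); field.
    by rewrite expf_neq0// qexp_neq0.
  (* [m] represents k - n modulo N and is not 0, so the sum of the corresponding root of unity
     vanishes. *)
  move=> k kn; pose m := if (n < k)%N then (k - n)%N else (k + N - n)%N.
  have kn' : nat_of_ord k != n by apply: contra kn => /eqP kn; apply/eqP/val_inj.
  have kN := ltn_ord k.
  have [m0 mN] : (0 < m)%N /\ (m < N)%N.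
    by rewrite /m; case: (ltnP n k) => nk; split; lia.
  have wE : qexp (k%:R / N%:R) / qexp (n%:R / N%:R) = qexp (m%:R / N%:R : C).
    rewrite -qexpB -mulrBl /m; case: (ltnP n k) => nk.
      by rewrite natrB// ltnW.
    rewrite natrB; last by lia.
    by rewrite natrD addrAC [in RHS]mulrDl mulfV// qexpD qexp1 mulr1.
  rewrite (eq_bigr (fun j : 'I_N => a k * q0 ^+ k * qexp (m%:R / N%:R) ^+ j)).
    by rewrite -big_distrr /= root_unity_sum// mulr0.
  move=> j _; rewrite qx exprMn (qm k j) -wE expr_div_n; ring.
have le1 : nm (a n * q0 ^+ n * N%:R) <= N%:R * (M + e).
  rewrite key; apply: le_trans (nm_sum _ _ _) _.
  apply: (@le_trans _ _ (\sum_(j < N) (M + e))); last by rewrite sumr_const card_ord mulr_natl.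
  apply: ler_sum => j _.
  rewrite nmf_div nmX nm_qexp.
  have -> : complex.Im (n%:R / N%:R : C) = 0.
    by rewrite -(realC_nat _ n) -(realC_nat _ N) -realCV -realCM.
  rewrite mulr0 oppr0 expR0 expr1n divr1.
  have := HN (x j); have := HM (x j).
  have := nmD (\sum_(0 <= k < N) a k * qexp (mkC (x j) y) ^+ k - f (mkC (x j) y)) (f (mkC (x j) y)).
  rewrite subrK; lra.
move: le1; rewrite !nmM nmX nm_nat mulrC ler_pM2l ?ltr0n//.
by rewrite /q0 nm_qexp.
Qed.

End QExp.

(** * Modular forms of weight at most 0 *)

Section NonpositiveWeight.
Variable R : realType.
Local Notation C := (cplx R).
Implicit Types (z w tau : C) (f g : C -> C) (a b : nat -> C).
Local Notation H := (@upper_half R).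

Lemma nmE z : nm z ^+ 2 = complex.Re z ^+ 2 + complex.Im z ^+ 2.
Proof. by case: z => a b; rewrite /nm /= sqr_sqrtr// addr_ge0 ?sqr_ge0. Qed.

Lemma H_neq0 tau : H tau -> tau != 0.
Proof. by apply: contraPneq => ->; rewrite /upper_half /= ltxx. Qed.

Lemma Im_inv z : complex.Im (- z^-1) = complex.Im z / nm z ^+ 2.
Proof. by rewrite nmE; case: z => a b /=; rewrite opprK. Qed.

Lemma H_inv tau : H tau -> H (- tau^-1).
Proof.
move=> Ht; rewrite /upper_half /= Im_inv divr_gt0 ?exprn_gt0 ?nm_gt0 ?H_neq0//.
Qed.

Lemma round_Re z : exists n : int, `|complex.Re (z + n%:~R)| <= 1 / 2.
Proof.
exists (- Num.floor (complex.Re z + 1 / 2)).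
rewrite cReD -realC_int /= rmorphN /=.
have /andP[] := floor_itv (complex.Re z + 1 / 2).
by rewrite intrD ler_norml => ? ?; apply/andP; split; lra.
Qed.

(* [tau |-> -1/tau] at least doubles the imaginary part in the strip [|Re| <= 1/2] below height 1/2. *)
Lemma modular_reduction (I : C -> R) :
  (forall tau (n : int), H tau -> I (tau + n%:~R) = I tau) ->
  (forall tau, H tau -> I (- tau^-1) = I tau) ->
  forall tau, H tau -> exists tau', [/\ H tau', 1 / 2 <= complex.Im tau' & I tau' = I tau].
Proof.
move=> IT IS tau Ht.
have Iy : 0 < complex.Im tau by exact: Ht.
have [n hn0] : exists n : nat, (complex.Im tau)^-1 < n%:R.
  by exists (Num.Def.archi_bound (complex.Im tau)^-1); apply: archi_boundP; rewrite invr_ge0 ltW.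
(* The induction is on n, which bounds the number of doublings still missing before height 1/2 is
   reached. *)
have : 1 <= 2 ^+ n.+1 * complex.Im tau.
  have h2 : n%:R <= 2 ^+ n.+1 :> R.
    by rewrite -natrX ler_nat ltnW// (ltn_trans (ltnSn n))// ltn_expl.
  by rewrite -ler_pdivrMr// mul1r ltW// (lt_le_trans hn0).
elim: n tau Ht Iy {hn0} => [|n ih] tau Ht Iy hn.
  by exists tau; split => //; rewrite ler_pdivrMr// mulrC -[2]expr1.
have [h|h] := leP (1 / 2) (complex.Im tau); first by exists tau.
have [m hm] := round_Re tau.
set s := tau + m%:~R in hm.
have Hs : H s by exact: HDint.
have Is : complex.Im s = complex.Im tau by exact: ImDint.
have s2 : nm s ^+ 2 <= 1 / 2.
  have R2 : complex.Re s ^+ 2 <= (1 / 2) ^+ 2.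
    by rewrite -(real_normK (num_real _)) lerXn2r// ?nnegrE// divr_ge0.
  have I2 : complex.Im s ^+ 2 <= (1 / 2) ^+ 2.
    by rewrite Is lerXn2r ?nnegrE ?divr_ge0// ltW.
  by rewrite nmE; move: R2 I2; rewrite expr_div_n expr1n; lra.
have s0 : 0 < nm s ^+ 2 by rewrite exprn_gt0// nm_gt0 H_neq0.
have Is2 : 2 * complex.Im tau <= complex.Im (- s^-1).
  rewrite Im_inv Is ler_pdivlMr// mulrAC.
  by have := ler_wpM2r (ltW Iy) s2; lra.
have Hi := H_inv Hs.
have [||tau' [H1 H2 H3]] := ih (- s^-1) Hi.
- exact: Hi.
- rewrite (le_trans hn)// exprSr -mulrA ler_wpM2l// exprn_ge0//.
exists tau'; split => //; by rewrite H3 IS// IT.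
Qed.

Section Weight.
Variables (f : C -> C) (a : nat -> C) (p : nat).
Hypothesis fa : isq f a.
Hypothesis fS : forall tau, H tau -> tau ^+ p * f (- tau^-1) = f tau.

(** [fS] is the law of weight -p under tau to -1/tau, so [I] below is invariant. At height at least
    1/2 one has |q| <= exp (- pi), where f is bounded. Squaring f avoids half-integral powers of Im
    tau. *)
Lemma weight_growth : exists2 K : R, 0 <= K &
  forall tau, H tau -> nm (f tau) ^+ 2 <= K * complex.Im tau ^+ p.
Proof.
pose I tau := nm (f tau) ^+ 2 / complex.Im tau ^+ p.
have IT tau (n : int) : H tau -> I (tau + n%:~R) = I tau.
  by move=> Ht; rewrite /I (isq_per _ fa)// ImDint.
have IS tau : H tau -> I (- tau^-1) = I tau.
  move=> Ht; rewrite /I -(fS Ht) Im_inv nmM nmX.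
  have : nm tau != 0 by rewrite gt_eqF// nm_gt0 H_neq0.
  have : complex.Im tau != 0 by rewrite gt_eqF//; exact: Ht.
  move: (nm tau) (complex.Im tau) => u v v0 u0.
  rewrite !exprMn exprVn -!exprM mulnC; field.
  by rewrite !expf_neq0.
have rho1 : expR (- pi) < 1 :> R by rewrite -[ltRHS]expR0 ltr_expR oppr_lt0 pi_gt0.
have [B B0 HB] := ps_bound (proj1 fa) rho1.
exists (B ^+ 2 * 2 ^+ p) => [|tau Ht]; first by rewrite mulr_ge0 ?exprn_ge0.
have y0 : 0 < complex.Im tau by exact: Ht.
rewrite -ler_pdivrMr ?exprn_gt0// -/(I tau).
have [tau' [Ht' y' <-]] := modular_reduction IT IS Ht.
have y'0 : 0 < complex.Im tau' by exact: Ht'.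
rewrite /I ler_pdivrMr ?exprn_gt0// -mulrA -exprMn.
have fB : nm (f tau') <= B.
  rewrite (proj2 fa)//; apply: HB; rewrite nm_qexp ler_expR lerN2.
  by have := ler_wpM2l (ltW (pi_gt0 R)) y'; lra.
apply: (@le_trans _ _ (B ^+ 2)); first by rewrite lerXn2r// nnegrE ?nm_ge0.
by rewrite ler_peMr ?exprn_ge0// exprn_ege1//; lra.
Qed.

(** In [coef_bound] at height y the left side stays away from 0 as y tends to 0 unless a_n = 0,
    whereas the right side is at most the square root of K y. *)
Lemma negative_weight : (0 < p)%N -> forall tau, H tau -> f tau = 0.
Proof.
move=> p0; have [K K0 HK] := weight_growth.
suff a0 n : a n = 0.
  move=> tau Ht; rewrite (proj2 fa)//; apply: ps_eq.
  by apply: csum_ext (csum0 R) => n; rewrite a0 mul0r.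
apply: nm0_eq0; apply/eqP; rewrite -sqrf_eq0; apply/negPn/negP => an0.
have {}an0 : 0 < nm (a n) ^+ 2 by rewrite lt_def an0 sqr_ge0.
pose c : R := expR (- (2 * pi)) ^+ n.
have c0 : 0 < c by rewrite exprn_gt0 ?expR_gt0.
have key y : 0 < y <= 1 -> (nm (a n) * c) ^+ 2 <= K * y.
  move=> /andP[y0 y1].
  have Ky : 0 <= K * y by rewrite mulr_ge0 ?(ltW y0).
  have HM x : nm (f (mkC x y)) <= Num.sqrt (K * y).
    rewrite -(ler_sqr (nm_ge0 _) (sqrtr_ge0 _)) sqr_sqrtr//.
    apply: le_trans (HK (mkC x y) y0) _; rewrite ler_wpM2l//=.
    by rewrite -[leRHS]expr1; apply: ler_wiXn2l => //; exact: ltW.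
  have := coef_bound n fa y0 HM => H1.
  rewrite -[K * y]sqr_sqrtr// lerXn2r ?nnegrE ?sqrtr_ge0 ?mulr_ge0 ?nm_ge0 ?(ltW c0)//.
  apply: le_trans H1; rewrite ler_wpM2l ?nm_ge0// lerXn2r ?nnegrE ?expR_ge0//.
  by rewrite ler_expR lerN2 ler_piMr// ltW// twopi_gt0.
have ac : 0 < (nm (a n) * c) ^+ 2 by rewrite exprMn mulr_gt0// exprn_gt0.
(* With this height K y is at most K / (2 (K + 1)) times the left side, hence smaller; K + 1 guards
   against K = 0. *)
pose y := Num.min 1 ((nm (a n) * c) ^+ 2 / (2 * (K + 1))).
have K1 : 0 < 2 * (K + 1) by rewrite mulr_gt0// ltr_wpDl.
have y01 : 0 < y <= 1 by rewrite /y lt_min ltr01 divr_gt0//= ge_min lexx.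
have := key y y01; apply/negP; rewrite -ltNge.
apply: (@le_lt_trans _ _ (K * ((nm (a n) * c) ^+ 2 / (2 * (K + 1))))).
  by rewrite ler_wpM2l// /y ge_min lexx orbT.
by rewrite mulrA ltr_pdivrMr// mulrC ltr_pM2l//; lra.
Qed.
End Weight.

(** After removal of the constant term, a bound M on the whole half-plane improves to 2 M / 3;
    iterating from the bound of [weight_growth] leaves only 0. *)
Lemma weight0_cst f a : isq f a -> (forall tau, H tau -> f (- tau^-1) = f tau) ->
  forall tau, H tau -> f tau = a 0%N.
Proof.
move=> fa fS.
pose g tau := f tau + (-1) * a 0%N.
pose b n := a n + (if n is 0%N then (-1) * a 0%N else 0).
have gb : isq g b by apply: isqD fa _; exact: isq_cst.
have b0 : b 0%N = 0 by rewrite /b; ring.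
have gS tau : H tau -> tau ^+ 0 * g (- tau^-1) = g tau.
  by move=> Ht; rewrite mul1r /g fS.
have [K K0 HK] := weight_growth gb gS.
have red (M : R) : (forall tau, H tau -> 1 / 2 <= complex.Im tau -> nm (g tau) <= M) ->
    forall tau, H tau -> nm (g tau) <= M.
  move=> HM tau Ht.
  have [||tau' [H1 H2 <-]] := @modular_reduction (fun t => nm (g t)) _ _ tau Ht.
  - by move=> t n Ht'; rewrite (isq_per _ gb).
  - by move=> t Ht'; rewrite -(gS _ Ht') mul1r.
  exact: HM.
(* Coefficients are estimated at height 1/8 and resummed at height at least 1/2, where |q| <= exp (-
   pi) = exp (- 2 pi / 8) x. From exp t >= 1 + t and pi >= 2 one gets 1 / x >= 5/2. *)
pose x : R := expR (- (3 / 4 * pi)).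
have x0 : 0 < x by exact: expR_gt0.
have x25 : x <= 2 / 5.
  rewrite /x expRN -[2 / 5]invrK lef_pV2 ?posrE ?expR_gt0 ?invr_gt0 ?divr_gt0//.
  rewrite invf_div; apply: le_trans (expR_ge1Dx _).
  have := pi_ge2 R; lra.
have x01 : 0 <= x < 1 by apply/andP; split; [exact: ltW | lra].
(* The resummation starts at index 1 as [b] vanishes at 0, which gives M x / (1 - x) <= 2 M / 3 at
   height at least 1/2; [red] carries this bound to the whole half-plane. *)
have contr (M : R) : 0 <= M -> (forall tau, H tau -> nm (g tau) <= M) ->
    forall tau, H tau -> nm (g tau) <= 2 / 3 * M.
  move=> M0 HM; apply: red => tau Ht y2.
  have bn n : nm (b n) * expR (- (2 * pi * (1 / 8))) ^+ n <= M.
    by apply: (coef_bound n gb) => [|t]; [lra | apply: HM; rewrite /upper_half /=; lra].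
  have u0 := expR_gt0 (- (2 * pi * (1 / 8)) : R).
  have := isq_csum gb Ht => sg.
  have sg' : csum (fun n => b n.+1 * qexp tau ^+ n.+1) (g tau).
    by apply: (proj2 (csum_shift (fun n => b n * qexp tau ^+ n) _)); rewrite /= b0 mul0r add0r.
  apply: (csum_nm (b := fun n => M * x * x ^+ n) _ _ sg').
    move=> n; rewrite nmM nmX -mulrA -exprS.
    apply: (@le_trans _ _ (nm (b n.+1) * (expR (- (2 * pi * (1 / 8))) * x) ^+ n.+1)).
      rewrite ler_wpM2l ?nm_ge0// lerXn2r ?nnegrE ?nm_ge0 ?mulr_ge0 ?expR_ge0//.
      rewrite nm_qexp -expRD ler_expR.
      have := ler_wpM2l (ltW (pi_gt0 R)) y2; lra.
    by rewrite exprMn mulrA ler_wpM2r ?exprn_ge0 ?(ltW x0).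
  move=> n; apply: le_trans (geo_series_le n _ x01) _; first by rewrite mulr_ge0 ?(ltW x0).
  rewrite -mulrA mulrC ler_wpM2r// ler_pdivrMr; lra.
have HB : forall tau, H tau -> nm (g tau) <= Num.sqrt K.
  move=> tau Ht; rewrite -(ler_sqr (nm_ge0 _) (sqrtr_ge0 _)) sqr_sqrtr//.
  by have := HK tau Ht; rewrite expr0 mulr1.
have Bn n tau : H tau -> nm (g tau) <= (2 / 3) ^+ n * Num.sqrt K.
  elim: n tau => [|n ih] tau Ht; first by rewrite expr0 mul1r HB.
  by rewrite exprS -mulrA; apply: (contr _ _ ih) => //.
move=> tau Ht; suff : g tau = 0 by rewrite /g mulN1r => /eqP; rewrite subr_eq0 => /eqP.
apply: nm0_eq0; apply/eqP; rewrite eq_le nm_ge0 andbT.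
have cv : (2 / 3) ^+ n * Num.sqrt K @[n --> \oo] --> 0 * Num.sqrt K.
  have e1 : `|2 / 3 : R| < 1 by rewrite ger0_norm; lra.
  exact: (cvgM (cvg_expr e1) (cvg_cst (Num.sqrt K))).
rewrite mul0r in cv; rewrite leNgt; apply/negP => gp.
move/cvgrPdist_lt/(_ _ gp) : cv => [N _ /(_ N (leqnn _))].
rewrite sub0r normrN ger0_norm//.
by apply/negP; rewrite -leNgt Bn.
Qed.

End NonpositiveWeight.

(** * The quasimodular-periodic function zet and the modularity of E2 *)

Section Zeta.
Variable R : realType.
Local Notation C := (cplx R).
Implicit Types (z w tau v q : C).
Local Notation H := (@upper_half R).

Definition lam v : C := v / (1 - v).
Definition Lam q v : C := limn (series (fun m => lam (q ^+ m * v))).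

Lemma nm_lam_le v : nm v <= 1 / 2 -> nm (lam v) <= 2 * nm v.
Proof.
move=> v2; rewrite /lam nmf_div.
have d2 : 1 / 2 <= nm (1 - v) by have := nm_sub 1 v; rewrite nm1; lra.
have d0 : 0 < nm (1 - v) by lra.
rewrite ler_pdivrMr//; have := nm_ge0 v; nra.
Qed.

Lemma small_pow (x c : R) : 0 <= x < 1 -> 0 <= c -> exists N, forall m, (N <= m)%N -> x ^+ m * c <= 1 / 2.
Proof.
move=> /andP[x0 x1] c0.
have xc : 0 < 1 / 2 / (c + 1) by rewrite !divr_gt0// ltr_wpDl.
have xn : `|x| < 1 by rewrite ger0_norm.
have := cvg_expr xn => /cvgrPdist_lt/(_ _ xc)[N _ HN]; exists N => m Nm.
have := HN m Nm; rewrite sub0r normrN ger0_norm ?exprn_ge0// ltr_pdivlMr ?ltr_wpDl//.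
have : 0 <= x ^+ m by rewrite exprn_ge0.
by rewrite mulrDr mulr1; lra.
Qed.

(** From some index on |q^m v| <= 1/2 and the terms decay geometrically; the finitely many earlier
    ones are absorbed into the constant [c]. A term at the pole of [lam] has the value 0, since the
    inverse of 0 is 0. *)
Lemma Lam_csum q v : q != 0 -> nm q < 1 -> csum (fun m => lam (q ^+ m * v)) (Lam q v).
Proof.
move=> q0 q1; have q01 := nmq01 q1.
have qp : 0 < nm q by rewrite nm_gt0.
have [N HN] := small_pow q01 (nm_ge0 v).
pose c := 2 * nm v + \sum_(k < N) nm (lam (q ^+ k * v)) / nm q ^+ k.
have P k : 0 <= nm (lam (q ^+ k * v)) / nm q ^+ k by rewrite divr_ge0 ?nm_ge0 ?exprn_ge0 ?nm_ge0.
have c0 : 0 <= c by rewrite addr_ge0 ?mulr_ge0 ?nm_ge0// sumr_ge0.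
have B m : nm (lam (q ^+ m * v)) <= c * nm q ^+ m.
  rewrite -ler_pdivrMr ?exprn_gt0//; have [mN|Nm] := ltnP m N.
    by rewrite /c (bigD1 (Ordinal mN))//= addrCA lerDl addr_ge0 ?mulr_ge0 ?nm_ge0// sumr_ge0.
  apply: (@le_trans _ _ (2 * nm v)); last by rewrite lerDl sumr_ge0.
  rewrite ler_pdivrMr ?exprn_gt0//; apply: le_trans (nm_lam_le _) _.
    by rewrite nmM nmX HN.
  by rewrite nmM nmX mulrA mulrAC.
have [l ll _] := csum_abs B (fun n => geo_series_le n c0 q01).
by move/csumE : (ll) => ll'; rewrite /Lam (cvg_lim _ ll').
Qed.

Lemma Lam_eq q v l : csum (fun m => lam (q ^+ m * v)) l -> Lam q v = l.
Proof. by move=> /csumE ll; rewrite /Lam (cvg_lim _ ll). Qed.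

Lemma Lam_rec q v : q != 0 -> nm q < 1 -> Lam q v = lam v + Lam q (q * v).
Proof.
move=> q0 q1; apply: Lam_eq; have -> : lam v = lam (q ^+ 0 * v) by rewrite mul1r.
apply/(csum_shift (fun m => lam (q ^+ m * v))).
by apply: csum_ext (Lam_csum (q * v) q0 q1) => n; rewrite exprSr mulrA.
Qed.

Lemma lamD v : v ^+ 2 != 1 -> lam v + lam (- v) = 2 * lam (v ^+ 2).
Proof.
rewrite /lam => v2; have : (1 - v) * (1 + v) != 0.
  have -> : (1 - v) * (1 + v) = 1 - v ^+ 2 by ring.
  by rewrite subr_eq0 eq_sym.
rewrite mulf_eq0 negb_or => /andP[v1 v1'].
have v3 : 1 - v ^+ 2 != 0 by rewrite subr_eq0 eq_sym.
rewrite opprK; field; by rewrite v1 v1' v3.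
Qed.

Lemma lamV v : v != 0 -> v != 1 -> lam v + lam v^-1 = -1.
Proof.
move=> v0 v1; rewrite /lam.
have h1 : 1 - v != 0 by rewrite subr_eq0 eq_sym.
have h2 : v - 1 != 0 by rewrite subr_eq0.
by field; rewrite v0 h1 h2.
Qed.

(** Split the series of [Lam q (v ^+ 2)] by parity: its arguments are the squares of q^m v for even
    indices and of q^m r v for odd ones, and [lamD] decomposes each term. *)
Lemma Lam_dup q r v : r ^+ 2 = q -> q != 0 -> nm q < 1 -> (forall m, q ^+ m * v ^+ 2 != 1) ->
  Lam q v + Lam q (- v) + (Lam q (r * v) + Lam q (- (r * v))) = 2 * Lam q (v ^+ 2).
Proof.
move=> rq q0 q1 qv.
apply/esym/(csum_alternate (u := fun m => 2 * lam (q ^+ m * v ^+ 2))).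
- apply: csum_ext (csumD (Lam_csum v q0 q1) (Lam_csum (- v) q0 q1)) => m.
  have E : q ^+ m.*2 * v ^+ 2 = (q ^+ m * v) ^+ 2 by rewrite exprMn -exprM muln2.
  by rewrite mulrN lamD -E.
- apply: csum_ext (csumD (Lam_csum (r * v) q0 q1) (Lam_csum (- (r * v)) q0 q1)) => m.
  have E : q ^+ m.*2.+1 * v ^+ 2 = (q ^+ m * (r * v)) ^+ 2.
    by rewrite !exprMn rq -exprM muln2 exprSr mulrA.
  by rewrite mulrN lamD -E.
exact: csumZ (Lam_csum _ q0 q1).
Qed.

(** Up to the factor -1 / (2 pi i), this is the logarithmic derivative in z of the Jacobi theta
    function with simple zeros on the lattice, read off its product formula. *)
Definition zet tau z : C := 2^-1 + Lam (qexp tau) (qexp z) - Lam (qexp tau) (qexp tau * qexp (- z)).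

Definition off tau z := forall a b : int, z != a%:~R + b%:~R * tau.

Lemma off_shift tau z (a b : int) : off tau z -> off tau (z + (a%:~R + b%:~R * tau)).
Proof.
move=> o c d; apply: contra (o (c - a) (d - b)) => /eqP E; apply/eqP.
rewrite !intrB mulrBl -[z](addrK (a%:~R + b%:~R * tau)) E; ring.
Qed.
Lemma offN tau z : off tau z -> off tau (- z).
Proof.
move=> o a b; apply: contra (o (- a) (- b)) => /eqP E; apply/eqP.
by rewrite -[z]opprK E !mulrNz; ring.
Qed.
Lemma off_half tau z (a b : int) : off tau z -> off tau ((z + (a%:~R + b%:~R * tau)) / 2).
Proof.
move=> o c d; apply: contra (o (c * 2 - a) (d * 2 - b)) => /eqP E; apply/eqP.
have -> : z = (z + (a%:~R + b%:~R * tau)) / 2 * 2 - (a%:~R + b%:~R * tau) by field.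
by rewrite E !intrB !intrM; ring.
Qed.

Lemma off_qexp tau z m : off tau z -> qexp tau ^+ m * qexp z != 1.
Proof.
move=> o; rewrite -qexpMn -qexpD; apply/eqP => /qexp_eq1[n E].
have := o n (- m%:Z); rewrite -E mulrNz; apply/negP; rewrite negbK; apply/eqP.
by rewrite -[(m%:Z)%:~R]/(m%:R : C); ring.
Qed.

Section Tau.
Variable tau : C.
Hypothesis Ht : H tau.
Let q := qexp tau.
Let q0 : q != 0. Proof. exact: qexp_neq0. Qed.
Let q1 : nm q < 1. Proof. exact: nm_qexp_lt1. Qed.

Lemma zetD1 z : zet tau (z + 1) = zet tau z.
Proof. by rewrite /zet opprD !qexpD qexpN [qexp (- 1)]qexpN qexp1 invr1 !mulr1. Qed.

(** The shift moves one term from each series to the other; the increment 1 is the relation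
    [lamV]. *)
Lemma zetDtau z : off tau z -> zet tau (z + tau) = zet tau z + 1.
Proof.
move=> o; rewrite /zet -/q opprD !qexpD -/q [qexp (- tau)]qexpN -/q.
have z1 : qexp z != 1 by have := off_qexp 0 o; rewrite expr0 mul1r.
rewrite [qexp (- z) * _]mulrC mulVKf// [qexp z * q]mulrC.
rewrite [Lam q (qexp z)]Lam_rec// [Lam q (qexp (- z))]Lam_rec//.
have := lamV (qexp_neq0 z) z1; rewrite -qexpN.
move: (lam _) (lam _) => x y xy.
have -> : y = -1 - x by rewrite -xy addrK.
ring.
Qed.

Lemma zetN z : off tau z -> zet tau (- z) = - zet tau z.
Proof.
move=> o; rewrite /zet -/q opprK.
have z1 : qexp z != 1 by have := off_qexp 0 o; rewrite expr0 mul1r.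
rewrite [Lam q (qexp z)]Lam_rec// [Lam q (qexp (- z))]Lam_rec//.
have := lamV (qexp_neq0 z) z1; rewrite -qexpN.
move: (lam _) (lam _) => x y xy.
have -> : y = -1 - x by rewrite -xy addrK.
by field.
Qed.

Lemma zet_shift z (a b : int) : off tau z ->
  zet tau (z + (a%:~R + b%:~R * tau)) = zet tau z + b%:~R.
Proof.
move=> o; have A w (n : nat) : zet tau (w + n%:R) = zet tau w.
  by elim: n => [|n ih]; rewrite ?addr0// -natr1 addrA zetD1.
have B w (n : nat) : off tau w -> zet tau (w + n%:R * tau) = zet tau w + n%:R.
  move=> ow; elim: n => [|n ih]; first by rewrite mul0r !addr0.
  rewrite -natr1 mulrDl mul1r addrA zetDtau ?ih ?addrA//.
  by have := off_shift 0 n ow; rewrite add0r.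
have A' w : zet tau (w + a%:~R) = zet tau w.
  case: a => n; first exact: A.
  by rewrite NegzE mulrNz -{2}[w](subrK n.+1%:R) A.
have B' w : off tau w -> zet tau (w + b%:~R * tau) = zet tau w + b%:~R.
  move=> ow; case: b => n; first exact: B.
  rewrite NegzE mulrNz mulNr -{2}[w](subrK (n.+1%:R * tau)) B ?addrK//.
  by have := off_shift 0 (- n.+1%:Z) ow; rewrite add0r mulrNz mulNr.
rewrite addrA B' ?A'//.
by have := off_shift a 0 o; rewrite mul0r addr0.
Qed.

(** With square roots v of [qexp z] and r of q, the four points give v, -v, r v, -r v in the first
    series. In the second they give the same pattern for r / v, since q / v = r (r / v). So
    [Lam_dup] applies twice. *)
Lemma zet_dup z : off tau z ->
  zet tau (z / 2) + zet tau ((z + 1) / 2) + (zet tau ((z + tau) / 2) + zet tau ((z + 1 + tau) / 2))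
  = 2 * zet tau z + 1.
Proof.
move=> o; pose v := qexp (z / 2); pose r := qexp (tau / 2).
have v2 : v ^+ 2 = qexp z by rewrite -qexpMn mulrC divfK.
have r2 : r ^+ 2 = q by rewrite -qexpMn mulrC divfK.
have v0 : v != 0 := qexp_neq0 _.
have r0 : r != 0 := qexp_neq0 _.
have e1 : qexp ((z + 1) / 2) = - v.
  by rewrite mulrDl mul1r qexpD qexp_half mulrN1.
have e2 : qexp ((z + tau) / 2) = r * v by rewrite mulrDl qexpD mulrC.
have e3 : qexp ((z + 1 + tau) / 2) = - (r * v) by rewrite mulrDl qexpD e1 mulrC mulrN.
rewrite /zet -/q !qexpN e1 e2 e3 -/v -v2.
have d1 := Lam_dup r2 q0 q1 (v := v).
have d2 := Lam_dup r2 q0 q1 (v := r / v).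
have E1 : q / v = r * (r / v) by rewrite -r2; ring.
have E2 : q / (- v) = - (r * (r / v)) by rewrite -E1 invrN mulrN.
have E3 : q / (r * v) = r / v by rewrite -r2; field; rewrite v0 r0.
have E4 : q / (- (r * v)) = - (r / v) by rewrite -E3 invrN mulrN.
have E5 : (r / v) ^+ 2 = q / v ^+ 2 by rewrite expr_div_n r2.
rewrite E1 E2 E3 E4 -E5.
have c1 m : q ^+ m * v ^+ 2 != 1 by rewrite v2; exact: off_qexp.
have c2 m : q ^+ m * (r / v) ^+ 2 != 1.
  by rewrite E5 mulrA -exprSr v2 -qexpN; exact: off_qexp (offN o).
move: (d1 c1) (d2 c2).
move: (Lam q v) (Lam q (- v)) (Lam q (r * v)) (Lam q (- (r * v))) (Lam q (v ^+ 2)) => x1 x2 x3 x4 x5.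
move: (Lam q (r / v)) (Lam q (- (r / v))) (Lam q (r * (r / v))) (Lam q (- (r * (r / v)))) (Lam q ((r / v) ^+ 2)) => y1 y2 y3 y4 y5 h1 h2.
have -> : x1 = 2 * x5 - (x2 + (x3 + x4)) by rewrite -h1; ring.
have -> : y1 = 2 * y5 - (y2 + (y3 + y4)) by rewrite -h2; ring.
by field.
Qed.

End Tau.
End Zeta.

(** * Second differences of the building blocks of zet *)

Section SecondDifferences.
Variable R : realType.
Local Notation C := (cplx R).
Implicit Types (z w tau v q a b : C).
Local Notation H := (@upper_half R).

Definition sd (f : C -> C) z a : C := f (z + a) + f (z - a) - 2 * f z.

(** The factor (b - 1)^2 is the source of every bound of order a^2 below, with b = [qexp a]. *)
Lemma lam_sd v b : b != 0 -> 1 - v != 0 -> 1 - v * b != 0 -> 1 - v / b != 0 ->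
  lam (v * b) + lam (v / b) - 2 * lam v =
  (b - 1) ^+ 2 / b * (v * (1 + v)) / ((1 - v * b) * (1 - v / b) * (1 - v)).
Proof.
move=> b0 v1 vb vb'; rewrite /lam; field; rewrite vb b0 v1 /=.
have -> : b - v = b * (1 - v / b) by field.
by rewrite mulf_neq0.
Qed.

(** The factor [nm v] is kept in the bound: it makes the estimates summable along v, q v, q^2 v, and
    so on. *)
Lemma nm_lam_sd v b (dl V c : R) : 0 < dl -> b != 0 -> nm v <= V -> nm b^-1 <= 2 ->
  nm (b - 1) <= c ->
  dl <= nm (1 - v) -> dl <= nm (1 - v * b) -> dl <= nm (1 - v / b) ->
  nm (lam (v * b) + lam (v / b) - 2 * lam v) <= c ^+ 2 * 2 * (nm v * (1 + V)) / dl ^+ 3.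
Proof.
move=> d0 b0 vV b2 bc v1 v2 v3.
have nz x : dl <= nm x -> x != 0 by rewrite -nm_gt0; exact: lt_le_trans.
rewrite (lam_sd b0 (nz _ v1) (nz _ v2) (nz _ v3)).
have -> : nm ((b - 1) ^+ 2 / b * (v * (1 + v)) / ((1 - v * b) * (1 - v / b) * (1 - v))) =
    nm (b - 1) ^+ 2 * nm b^-1 * (nm v * nm (1 + v)) / (nm (1 - v * b) * nm (1 - v / b) * nm (1 - v)).
  by rewrite nmM nmV !nmM !expr2.
apply: ler_pM.
- by rewrite !mulr_ge0 ?nm_ge0 ?exprn_ge0 ?nm_ge0.
- by rewrite invr_ge0 !mulr_ge0 ?nm_ge0.
- apply: ler_pM; rewrite ?mulr_ge0 ?nm_ge0 ?exprn_ge0 ?nm_ge0//.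
    apply: ler_pM; rewrite ?exprn_ge0 ?nm_ge0//.
    by rewrite lerXn2r ?nnegrE ?nm_ge0// (le_trans (nm_ge0 _) bc).
  by rewrite ler_wpM2l ?nm_ge0// (le_trans (nmD _ _))// nm1 lerD2l.
rewrite lef_pV2 ?posrE ?exprn_gt0//; last by rewrite !mulr_gt0// (lt_le_trans d0).
rewrite !exprSr expr0 mul1r; apply: ler_pM; rewrite ?mulr_ge0 ?(ltW d0)//.
by apply: ler_pM; rewrite ?(ltW d0).
Qed.

Lemma qexp_lip : exists c : R, exists2 dl : R, 0 < dl & 0 < c /\
  forall a, nm a < dl -> nm (qexp a - 1) <= c * nm a.
Proof.
have [dl dl0 Hd] := cexp_eps (R := R) ltr01.
pose t := nm (twopii R).
have t0 : 0 < t by rewrite nm_gt0 twopii_neq0.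
exists (2 * t); exists (dl / t); first by rewrite divr_gt0.
split; first by rewrite mulr_gt0.
move=> a; rewrite ltr_pdivlMr// mulrC -nmM => /Hd.
rewrite -/(qexp a) mul1r.
have := nmD (qexp a - 1 - twopii R * a) (twopii R * a); rewrite subrK nmM -/t; lra.
Qed.

Lemma qexp_near1 (eta : R) : 0 < eta -> exists c : R, exists2 dl : R, 0 < dl & 0 < c /\
  forall a, nm a <= dl -> [/\ nm (qexp a - 1) <= c * nm a, nm (qexp a - 1) <= eta,
    nm ((qexp a)^-1 - 1) <= eta & nm (qexp a)^-1 <= 2].
Proof.
move=> eta0; have [c [dl dl0 [c0 Hc]]] := qexp_lip.
pose e := Num.min eta 1.
have e0 : 0 < e by rewrite lt_min eta0 ltr01.
have ee : e <= eta by rewrite ge_min lexx.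
have e1 : e <= 1 by rewrite ge_min lexx orbT.
exists c; exists (Num.min (dl / 2) (e / c)).
  by rewrite lt_min !divr_gt0.
split=> // a; rewrite le_min => /andP[a1]; rewrite ler_pdivlMr// => a2.
have ad : nm a < dl by lra.
have h1 := Hc a ad.
have h2 := Hc (- a); rewrite nmN in h2; have {}h2 := h2 ad.
rewrite -qexpN; split => //; [lra|lra|].
have := nmD (qexp (- a) - 1) 1; rewrite subrK nm1; lra.
Qed.

Lemma Lam_sd_bound q (rho : R) : q != 0 -> nm q < 1 -> 0 < rho < 1 ->
  exists A : R, exists2 dl : R, 0 < dl & 0 <= A /\ forall v a, nm v <= rho -> nm a <= dl ->
    nm (Lam q (v * qexp a) + Lam q (v / qexp a) - 2 * Lam q v) <= A * nm a ^+ 2.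
Proof.
(* Half of the gap 1 - rho absorbs a perturbation of size [eta] of the argument, so that all
   denominators stay at least [eta]. *)
move=> q0 q1 /andP[r0 r1]; pose eta := (1 - rho) / 2.
have eta0 : 0 < eta by rewrite /eta; lra.
have [c [dl dl0 [c0 Hc]]] := qexp_near1 eta0.
have q01 := nmq01 q1.
exists (c ^+ 2 * 4 / eta ^+ 3 / (1 - nm q)); exists dl => //.
have A0 : 0 <= c ^+ 2 * 4 / eta ^+ 3 by rewrite !mulr_ge0 ?invr_ge0 ?exprn_ge0 ?(ltW eta0) ?(ltW c0).
split; first by rewrite divr_ge0// subr_ge0 ltW.
move=> v a vr ad; have [h1 h2 h3 h4] := Hc a ad.
have S := csumB (csumD (Lam_csum (v * qexp a) q0 q1) (Lam_csum (v / qexp a) q0 q1)) (csumZ 2 (Lam_csum v q0 q1)).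
apply: (csum_nm (b := fun m => (c ^+ 2 * 4 / eta ^+ 3 * nm a ^+ 2) * nm q ^+ m)) S.
  move=> m; rewrite (mulrA _ v (qexp a)) (mulrA _ v (qexp a)^-1).
  have vm : nm (q ^+ m * v) <= rho.
    rewrite nmM nmX -[leRHS]mul1r ler_pM ?nm_ge0 ?exprn_ge0 ?nm_ge0// exprn_ile1 ?nm_ge0//.
    exact: ltW.
  have D w : nm (w - 1) <= eta -> eta <= nm (1 - q ^+ m * v * w).
    move=> we; have -> : 1 - q ^+ m * v * w = (1 - q ^+ m * v) - q ^+ m * v * (w - 1) by ring.
    apply: le_trans (nm_sub _ _); rewrite nmM.
    have := nm_sub 1 (q ^+ m * v); rewrite nm1.
    have : nm (q ^+ m * v) * nm (w - 1) <= 1 * eta.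
      by apply: ler_pM; rewrite ?nm_ge0//; lra.
    rewrite /eta in we *; lra.
  have D1 : eta <= nm (1 - q ^+ m * v).
    by have := D 1; rewrite subrr nm0 mulr1; apply; rewrite ltW.
  have Hm := nm_lam_sd eta0 (qexp_neq0 a) (le_trans vm (ltW r1)) h4 h1 D1 (D _ h2) (D _ h3).
  apply: (le_trans Hm).
  have -> : (c * nm a) ^+ 2 * 2 * (nm (q ^+ m * v) * (1 + 1)) / eta ^+ 3 =
    c ^+ 2 * 4 / eta ^+ 3 * nm a ^+ 2 * nm (q ^+ m * v) by rewrite exprMn; ring.
  rewrite ler_wpM2l//; first by rewrite mulr_ge0 ?exprn_ge0 ?nm_ge0.
  rewrite nmM nmX ler_piMr ?exprn_ge0 ?nm_ge0//; lra.
move=> n; apply: le_trans (geo_series_le n _ q01) _; first by rewrite mulr_ge0 ?exprn_ge0 ?nm_ge0.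
by rewrite mulrAC.
Qed.

(** [lam (qexp z)] without its polar part at 0: with u = 2 pi i z this is the Bernoulli-type
    expansion -1/2 - u/12 + ... *)
Definition kap z : C := lam (qexp z) + (twopii R * z)^-1.

Lemma qexp_sqrt z : qexp (z / 2) ^+ 2 = qexp z.
Proof. by rewrite -qexpMn mulrC divfK. Qed.

Lemma qexp_half_neq1 z : qexp z != 1 -> qexp (z / 2) != 1.
Proof. by apply: contra => /eqP E; rewrite -qexp_sqrt E expr1n. Qed.

Lemma qexp1_neq0 z : qexp z != 1 -> z != 0.
Proof. by apply: contra => /eqP ->; rewrite qexp0. Qed.

(** The pole term obeys the halving law exactly, so what remains is [lam (- qexp (z / 2))], regular
    at 0. Iterating this identity gives estimates of [kap] near 0 from estimates of a regular
    function. *)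
Lemma kap_half z : qexp z != 1 -> kap z = 2^-1 * kap (z / 2) + 2^-1 * lam (- qexp (z / 2)).
Proof.
move=> z1; have z0 := qexp1_neq0 z1.
have := @lamD R (qexp (z / 2)); rewrite qexp_sqrt => /(_ z1) E.
rewrite /kap.
have -> : lam (qexp z) = 2^-1 * (lam (qexp (z / 2)) + lam (- qexp (z / 2))).
  by rewrite E mulrA mulVf ?mul1r// pnatr_eq0.
by field; rewrite z0 twopii_neq0.
Qed.

Lemma qexp_quot : (qexp z - 1) / z @[z --> (0 : C)^'] --> twopii R.
Proof.
have [d0 dE] := is_derive_qexp (0 : C); rewrite qexp0 mulr1 in dE.
rewrite -dE; apply: cvg_trans d0; apply: near_eq_cvg; apply: nearW => h /=.
by rewrite addr0 qexp0 [h *: 1]mulr1 mulrC.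
Qed.

Lemma qexp_cvg1 : qexp z @[z --> (0 : C)^'] --> (1 : C).
Proof.
have [c [dl dl0 [c0 Hc]]] := qexp_lip.
apply/cvgCP => e e0; apply/near0CP; exists (Num.min dl (e / c)).
  by rewrite lt_min dl0 divr_gt0.
move=> h _; rewrite lt_min ltr_pdivlMr// => /andP[h1 h2].
by apply: le_lt_trans (Hc h h1) _; rewrite mulrC.
Qed.

(** This only says that the pole has cancelled, but it suffices: [kap (z / 2 ^+ n)] divided by 2^n
    tends to 0, so the iteration of [kap_half] leaves no remainder. *)
Lemma kap_small : z * kap z @[z --> (0 : C)^'] --> (0 : C).
Proof.
have t0 := twopii_neq0 R.
have E : - qexp z * ((qexp z - 1) / z)^-1 + (twopii R)^-1 @[z --> (0 : C)^'] -->
    - (1 : C) * (twopii R)^-1 + (twopii R)^-1.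
  apply: cvgD; last exact: cvg_cst.
  apply: cvgM; first by apply: cvgN; exact: qexp_cvg1.
  by apply: cvgV => //; exact: qexp_quot.
rewrite mulN1r addNr in E; apply: cvg_trans E; apply: near_eq_cvg.
apply/near0CP; exists 1 => // h h0 _.
rewrite /kap /lam invf_div invfM mulrDr; congr (_ + _).
  by rewrite -[1 - _]opprB invrN; ring.
by rewrite mulrCA mulfV// mulr1.
Qed.

(** Unrolling the recursion gives x_0 as x_n / 2^n plus a sum of the g_j with weights 1/2, 1/4, ...,
    of total less than 1. *)
Lemma halving_bound (x g : nat -> C) (G : R) :
  (forall n, x n = 2^-1 * x n.+1 + 2^-1 * g n) -> (forall n, nm (g n) <= G) ->
  (forall e : R, 0 < e -> exists n, nm (x n) / 2 ^+ n <= e) -> nm (x 0%N) <= G.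
Proof.
move=> xE gG x0; apply/ler_addgt0Pr => e /x0 [n Hn].
have G0 : 0 <= G by apply: le_trans (gG 0%N); exact: nm_ge0.
have n2 : nm (2^-1 : C) = 2^-1 by rewrite nmV (nm_nat _ 2).
have key : nm (x 0%N) <= nm (x n) / 2 ^+ n + G * (1 - 2 ^- n).
  elim: n {Hn} => [|n ih]; first by rewrite expr0 divr1 invr1 subrr mulr0 addr0.
  apply: (le_trans ih).
  have xn : nm (x n) <= nm (x n.+1) / 2 + G / 2.
    rewrite {1}xE; apply: le_trans (nmD _ _) _; rewrite !nmM n2.
    by have := gG n; lra.
  have p : 0 <= (2 ^- n : R) by rewrite invr_ge0 exprn_ge0.
  have := ler_wpM2r p xn; rewrite exprS invfM.
  by rewrite mulrDl -!mulrA; nra.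
apply: (le_trans key); rewrite addrC lerD// ler_piMr// gerBl invr_ge0 exprn_ge0//.
Qed.

Lemma kap_dyadic z (e : R) : z != 0 -> 0 < e -> exists N, forall n, (N <= n)%N -> nm (kap (z / 2 ^+ n)) / 2 ^+ n <= e.
Proof.
move=> z0 e0; have nz : 0 < nm z by rewrite nm_gt0.
have /cvgCP/(_ _ (mulr_gt0 e0 nz))/near0CP[dl dl0 Hd] := kap_small.
have h01 : 0 <= (2^-1 : R) < 1 by lra.
have [N HN] := small_pow h01 (divr_ge0 (ltW nz) (ltW dl0)).
exists N => n Nn.
have n2 : nm (2 ^+ n : C) = 2 ^+ n by rewrite nmX (nm_nat _ 2).
have p2 : 0 < 2 ^+ n :> R by rewrite exprn_gt0.
have zn0 : z / 2 ^+ n != 0 by rewrite mulf_neq0// invr_neq0// expf_neq0// pnatr_eq0.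
have zn : nm (z / 2 ^+ n) < dl.
  rewrite nmf_div n2; have := HN n Nn.
  rewrite exprVn mulrA ler_pdivrMr// mulrC => h; lra.
have := Hd _ zn0 zn; rewrite subr0 nmM nmf_div n2 => h.
rewrite -(ler_pM2r nz); apply: le_trans (ltW h).
by rewrite le_eqVlt; apply/orP; left; apply/eqP; ring.
Qed.

(** For |Re w| <= 1/4 the real part of [qexp w] is nonnegative, so |1 + qexp w| >= 1 and the pole of
    [lam] is avoided. The bound 1/4 is half the width of the strip |Re z| <= 1/2. *)
Lemma lamN_sd_bound (V : R) : 0 < V -> exists A : R, exists2 dl : R, 0 < dl & 0 <= A /\
  forall w a, `|complex.Re w| <= 1 / 4 -> nm (qexp w) <= V -> nm a <= dl ->
    nm (sd (fun x => lam (- qexp x)) w a) <= A * nm a ^+ 2.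
Proof.
move=> V0; have eta0 : 0 < (2 * V)^-1 by rewrite invr_gt0 mulr_gt0.
have [c [dl dl0 [c0 Hc]]] := qexp_near1 eta0.
exists (c ^+ 2 * 2 * (V * (1 + V)) / (1 / 2) ^+ 3); exists dl => //.
split.
  apply: mulr_ge0; last by rewrite invr_ge0 exprn_ge0// divr_ge0.
  by rewrite !mulr_ge0 ?exprn_ge0 ?(ltW c0) ?(ltW V0)// addr_ge0 ?(ltW V0).
move=> w a wr wV ad; have [h1 h2 h3 h4] := Hc a ad.
rewrite /sd qexpD qexpB -[- (qexp w * _)]mulNr -[- (qexp w / _)]mulNr.
have vV : nm (- qexp w) <= V by rewrite nmN.
have v1 : 1 <= nm (1 - - qexp w).
  apply: le_trans (nm_Re _); apply: le_trans (ler_norm _).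
  rewrite opprK cReD lerDl cexp_Re mulr_ge0 ?expR_ge0// Im_twopii cos_ge0_pihalf//.
  move: wr; rewrite ler_norml => /andP[w1 w2]; have := pi_ge0 R.
  by move=> p0; apply/andP; split; nra.
have D x : nm (x - 1) <= (2 * V)^-1 -> 1 / 2 <= nm (1 - - qexp w * x).
  move=> xe; have -> : 1 - - qexp w * x = (1 - - qexp w) - - qexp w * (x - 1) by ring.
  apply: le_trans (nm_sub _ _); rewrite [nm (- qexp w * _)]nmM.
  have : nm (- qexp w) * nm (x - 1) <= V * (2 * V)^-1 by apply: ler_pM; rewrite ?nm_ge0.
  rewrite invfM mulrCA mulfV ?gt_eqF// mulr1; lra.
have p2 : (0 : R) < 1 / 2 by lra.
have v1' : 1 / 2 <= nm (1 - - qexp w) by lra.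
have := nm_lam_sd p2 (qexp_neq0 a) vV h4 h1 v1' (D _ h2) (D _ h3).
move=> h; apply: (le_trans h).
have -> : c ^+ 2 * 2 * (V * (1 + V)) / (1 / 2) ^+ 3 * nm a ^+ 2 =
  (c * nm a) ^+ 2 * 2 * (V * (1 + V)) / (1 / 2) ^+ 3 by rewrite exprMn; ring.
rewrite ler_wpM2r ?invr_ge0 ?exprn_ge0//.
rewrite ler_wpM2l ?mulr_ge0 ?exprn_ge0 ?mulr_ge0 ?nm_ge0 ?(ltW c0)//.
by rewrite ler_wpM2r// addr_ge0// ltW.
Qed.

(** Second differences are linear, so they inherit the recursion of [kap_half]. Its inhomogeneous
    terms are second differences of step a / 2^(n+1), uniformly of order a^2, even when z is close
    to the pole. *)
Lemma kap_sd_bound (Y : R) : 0 < Y -> exists A : R, exists2 dl : R, 0 < dl & 0 <= A /\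
  forall z a, `|complex.Re z| <= 1 / 2 -> `|complex.Im z| <= Y -> nm a <= dl ->
    qexp z != 1 -> qexp (z + a) != 1 -> qexp (z - a) != 1 ->
    nm (sd kap z a) <= A * nm a ^+ 2.
Proof.
move=> Y0; have V0 : 0 < expR (2 * pi * Y) by exact: expR_gt0.
have [A [dl dl0 [A0 HA]]] := lamN_sd_bound V0.
exists A; exists dl => //; split=> // z a zr zi ad z1 z2 z3.
have p2 n : 0 < 2 ^+ n :> R by rewrite exprn_gt0.
have p2C n : (2 ^+ n : C) != 0 by rewrite expf_neq0// pnatr_eq0.
have n2 n : nm (2 ^+ n : C) = 2 ^+ n by rewrite nmX (nm_nat _ 2).
have dy w n : qexp w != 1 -> qexp (w / 2 ^+ n) != 1.
  move=> w1; elim: n => [|n ih]; first by rewrite divr1.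
  by have := qexp_half_neq1 ih; rewrite exprSr invfM mulrA.
pose k n w := kap (w / 2 ^+ n).
pose l n w := lam (- qexp (w / 2 ^+ n.+1)).
have kE n w : qexp w != 1 -> k n w = 2^-1 * k n.+1 w + 2^-1 * l n w.
  move=> w1; have E : w / 2 ^+ n / 2 = w / 2 ^+ n.+1 by rewrite exprSr invfM mulrA.
  by have := kap_half (dy w n w1); rewrite E.
pose x n := k n (z + a) + k n (z - a) - 2 * k n z.
pose g n := l n (z + a) + l n (z - a) - 2 * l n z.
have gE n : g n = sd (fun x => lam (- qexp x)) (z / 2 ^+ n.+1) (a / 2 ^+ n.+1).
  by rewrite /sd -mulrDl -mulrBl.
have -> : sd kap z a = x 0%N by rewrite /x /k expr0 !divr1.
apply: (halving_bound (g := g)).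
- move=> n; rewrite /x /g (kE n _ z1) (kE n _ z2) (kE n _ z3); ring.
- move=> n; rewrite gE; have q1 : 1 <= 2 ^+ n :> R by rewrite exprn_ege1//; lra.
  have q2 : 2 <= 2 ^+ n.+1 :> R by rewrite exprS; lra.
  have rE w : w / 2 ^+ n.+1 = realC (2 ^- n.+1) * w.
    by rewrite mulrC; congr (_ * _); rewrite realCV; congr (_^-1); elim: n.+1 => //= m ih; rewrite !exprS realCM (realC_nat _ 2) ih.
  have i2 : (2 ^- n.+1 : R) <= 1 / 2 by rewrite -[1 / 2]invrK lef_pV2 ?posrE ?invr_gt0// invf_div divr1.
  have i0 : 0 <= (2 ^- n.+1 : R) by rewrite invr_ge0 ltW.
  have an : nm (a / 2 ^+ n.+1) <= nm a.
    rewrite rE nmM nm_realC ger0_norm// ler_piMl ?nm_ge0//; lra.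
  apply: le_trans (HA _ _ _ _ _) _.
  + rewrite rE cReM /= mul0r subr0 normrM ger0_norm//.
    by apply: le_trans (ler_pM _ _ i2 zr) _ => //; lra.
  + rewrite nm_qexp ler_expR rE cImM /= mul0r addr0 -mulrN ler_wpM2l ?(ltW (twopi_gt0 R))//.
    rewrite -mulrN; apply: le_trans (ler_norm _) _; rewrite normrM normrN (ger0_norm i0).
    apply: le_trans (ler_pM _ _ i2 zi) _ => //; lra.
  + exact: le_trans an ad.
  by rewrite ler_wpM2l// lerXn2r ?nnegrE ?nm_ge0.
move=> e e0; have e4 : 0 < e / 4 by rewrite divr_gt0.
have [N1 H1] := kap_dyadic (qexp1_neq0 z1) e4.
have [N2 H2] := kap_dyadic (qexp1_neq0 z2) e4.
have [N3 H3] := kap_dyadic (qexp1_neq0 z3) e4.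
pose N := maxn N1 (maxn N2 N3); exists N.
have := H1 N (leq_maxl _ _).
have := H2 N (leq_trans (leq_maxl _ _) (leq_maxr _ _)).
have := H3 N (leq_trans (leq_maxr _ _) (leq_maxr _ _)).
rewrite !ler_pdivrMr// -/(k N z) -/(k N (z + a)) -/(k N (z - a)) /x => h1 h2 h3.
apply: le_trans (nmB _ _) _; rewrite nmM (nm_nat _ 2).
have := nmD (k N (z + a)) (k N (z - a)); lra.
Qed.

End SecondDifferences.

(** * The defect of zet under tau to -1/tau *)

Section ZetaDefect.
Variable R : realType.
Local Notation C := (cplx R).
Implicit Types (z w tau v q a b : C).
Local Notation H := (@upper_half R).

Definition pol z : C := (twopii R * z)^-1.
(** The part of [zet] that is regular for |Im z| < Im tau: there both arguments of [Lam] have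
    modulus less than 1. *)
Definition regzet tau z : C :=
  Lam (qexp tau) (qexp tau * qexp z) - Lam (qexp tau) (qexp tau * qexp (- z)).

Lemma zet_split tau z : H tau -> zet tau z = 2^-1 + kap z - pol z + regzet tau z.
Proof.
move=> Ht; rewrite /zet /regzet [Lam _ (qexp z)]Lam_rec ?qexp_neq0 ?nm_qexp_lt1//.
by rewrite /kap /pol; ring.
Qed.

Lemma off_qexp1 tau z : off tau z -> qexp z != 1.
Proof. by move=> o; have := off_qexp 0 o; rewrite expr0 mul1r. Qed.

(** Adding the second difference of [pol] removes the pole at 0, so the bound is uniform on a whole
    fundamental cell. The restriction on Im z keeps the arguments of the two series of modulus at
    most exp (- pi Im tau). *)
Lemma zet_sd_bound tau : H tau -> exists A : R, exists2 dl : R, 0 < dl & 0 <= A /\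
  forall z a, `|complex.Re z| <= 1 / 2 -> `|complex.Im z| <= complex.Im tau / 2 ->
    nm a <= dl -> off tau z -> off tau (z + a) -> off tau (z - a) ->
    nm (sd (zet tau) z a + sd pol z a) <= A * nm a ^+ 2.
Proof.
move=> Ht; have Y0 : 0 < complex.Im tau by exact: Ht.
have Y2 : 0 < complex.Im tau / 2 by lra.
have q0 := qexp_neq0 tau; have q1 := nm_qexp_lt1 Ht.
pose rho : R := expR (- (pi * complex.Im tau)).
have r01 : 0 < rho < 1.
  by rewrite expR_gt0/= -[ltRHS]expR0 ltr_expR oppr_lt0 mulr_gt0 ?pi_gt0.
have [A1 [d1 d10 [A10 H1]]] := kap_sd_bound Y2.
have [A2 [d2 d20 [A20 H2]]] := Lam_sd_bound q0 q1 r01.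
exists (A1 + (A2 + A2)); exists (Num.min d1 d2); first by rewrite lt_min d10.
split; first by rewrite !addr_ge0.
move=> z a zr zi; rewrite le_min => /andP[a1 a2] o1 o2 o3.
set q := qexp tau in q0 q1 H2.
have rb w : `|complex.Im w| <= complex.Im tau / 2 -> nm (q * qexp w) <= rho.
  rewrite ler_norml => /andP[w1 w2]; rewrite /q -qexpD nm_qexp ler_expR lerN2 cImD.
  have := pi_ge0 R; nra.
have b1 := H2 (q * qexp z) a (rb z zi) a2.
have b2 := H2 (q * qexp (- z)) a; rewrite rb ?cImN ?normrN// in b2; have {}b2 := b2 isT a2.
have b0 := H1 z a zr zi a1 (off_qexp1 o1) (off_qexp1 o2) (off_qexp1 o3).
have -> : sd (zet tau) z a + sd pol z a = sd (@kap R) z a +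
  ((Lam q (q * qexp z * qexp a) + Lam q (q * qexp z / qexp a) - 2 * Lam q (q * qexp z))
  - (Lam q (q * qexp (- z) * qexp a) + Lam q (q * qexp (- z) / qexp a) - 2 * Lam q (q * qexp (- z)))).
  rewrite /sd !zet_split// /regzet -/q.
  have e1 : q * qexp (z + a) = q * qexp z * qexp a by rewrite qexpD mulrA.
  have e2 : q * qexp (z - a) = q * qexp z / qexp a by rewrite qexpB mulrA.
  have e3 : q * qexp (- (z + a)) = q * qexp (- z) / qexp a by rewrite opprD qexpB mulrA.
  have e4 : q * qexp (- (z - a)) = q * qexp (- z) * qexp a by rewrite opprB addrC qexpD mulrA.
  by rewrite e1 e2 e3 e4; field.
rewrite (mulrDl A1) (mulrDl A2); apply: le_trans (nmD _ _) _; rewrite lerD//.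
by apply: le_trans (nmB _ _) _; rewrite lerD.
Qed.

Lemma lattice_rep tau z : H tau -> exists c d : int,
  `|complex.Re (z + (c%:~R + d%:~R * tau))| <= 1 / 2 /\
  `|complex.Im (z + (c%:~R + d%:~R * tau))| <= complex.Im tau / 2.
Proof.
move=> Ht; have Y0 : 0 < complex.Im tau by exact: Ht.
have [d Hd] := round_Re (realC (complex.Im z / complex.Im tau) : C).
have [c Hc] := round_Re (z + d%:~R * tau).
have E : z + (c%:~R + d%:~R * tau) = z + d%:~R * tau + c%:~R by ring.
exists c, d; rewrite E; split => //.
rewrite ImDint cImD -(realC_int R d) cImM /= mul0r addr0.
move: Hd; rewrite cReD -(realC_int R d) /= => Hd.
have -> : complex.Im z + d%:~R * complex.Im tau =
  (complex.Im z / complex.Im tau + d%:~R) * complex.Im tau by field; rewrite gt_eqF.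
by rewrite normrM (gtr0_norm Y0); have := ler_wpM2r (ltW Y0) Hd; lra.
Qed.

Lemma zet_sd_shift tau z a (c d : int) : H tau -> off tau z -> off tau (z + a) -> off tau (z - a) ->
  sd (zet tau) (z + (c%:~R + d%:~R * tau)) a = sd (zet tau) z a.
Proof.
move=> Ht o1 o2 o3; rewrite /sd.
have e1 : z + (c%:~R + d%:~R * tau) + a = z + a + (c%:~R + d%:~R * tau) by ring.
have e2 : z + (c%:~R + d%:~R * tau) - a = z - a + (c%:~R + d%:~R * tau) by ring.
by rewrite e1 e2 !zet_shift//; ring.
Qed.

Lemma pol_sd_bound (rho : R) : 0 < rho -> exists2 A : R, 0 <= A &
  forall z a, rho <= nm z -> nm a <= rho / 2 -> nm (sd pol z a) <= A * nm a ^+ 2.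
Proof.
move=> r0; have t0 := twopii_neq0 R.
exists (nm (twopii R)^-1 * 2 / (rho * (rho / 2) * (rho / 2))).
  by rewrite !mulr_ge0 ?nm_ge0 ?invr_ge0 ?mulr_ge0 ?(ltW r0)//; lra.
move=> z a zr ar.
have h1 : rho / 2 <= nm (z + a) by have := nm_sub z (- a); rewrite opprK nmN; lra.
have h2 : rho / 2 <= nm (z - a) by have := nm_sub z a; lra.
have nz x : rho / 2 <= nm x -> x != 0 by rewrite -nm_gt0; lra.
have z1 : z != 0 by apply: nz; lra.
have z2 := nz _ h1; have z3 := nz _ h2.
have -> : sd pol z a = (twopii R)^-1 * 2 / (z * (z + a) * (z - a)) * a ^+ 2.
  by rewrite /sd /pol; field; rewrite z1 z2 z3 t0.
have -> : nm ((twopii R)^-1 * 2 / (z * (z + a) * (z - a)) * a ^+ 2) =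
    nm (twopii R)^-1 * 2 / (nm z * nm (z + a) * nm (z - a)) * nm a ^+ 2.
  by rewrite nmM nmX nmf_div !nmM (nm_nat _ 2).
rewrite ler_wpM2r ?exprn_ge0 ?nm_ge0//.
have rp : 0 < rho / 2 by lra.
have p1 : 0 < rho * (rho / 2) * (rho / 2) by rewrite !mulr_gt0.
have p2 : 0 < nm z * nm (z + a) * nm (z - a) by rewrite !mulr_gt0 ?nm_gt0.
rewrite ler_wpM2l ?mulr_ge0 ?nm_ge0// lef_pV2 ?posrE//.
apply: ler_pM; rewrite ?mulr_ge0 ?(ltW r0) ?(ltW rp)//.
by apply: ler_pM; rewrite ?(ltW r0) ?(ltW rp).
Qed.

(** Second differences are lattice-periodic, so z may be moved to the fundamental cell; at distance
    rho from the lattice the pole term itself is of order a^2. *)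
Lemma zet_sd_far tau (rho : R) : H tau -> 0 < rho -> exists A : R, exists2 dl : R, 0 < dl & 0 <= A /\
  forall z a, (forall c d : int, rho <= nm (z + (c%:~R + d%:~R * tau))) ->
    nm a <= dl -> off tau z -> off tau (z + a) -> off tau (z - a) ->
    nm (sd (zet tau) z a) <= A * nm a ^+ 2.
Proof.
move=> Ht r0; have [A1 [d1 d10 [A10 H1]]] := zet_sd_bound Ht.
have [A2 A20 H2] := pol_sd_bound r0.
exists (A1 + A2); exists (Num.min d1 (rho / 2)); first by rewrite lt_min d10 divr_gt0.
split; first by rewrite addr_ge0.
move=> z a far; rewrite le_min => /andP[a1 a2] o1 o2 o3.
have [c [d [zr zi]]] := lattice_rep z Ht.
rewrite -(zet_sd_shift c d Ht o1 o2 o3).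
have e1 : z + (c%:~R + d%:~R * tau) + a = z + a + (c%:~R + d%:~R * tau) by ring.
have e2 : z + (c%:~R + d%:~R * tau) - a = z - a + (c%:~R + d%:~R * tau) by ring.
have := H1 _ a zr zi a1 (off_shift c d o1).
rewrite e1 e2 => /(_ (off_shift c d o2) (off_shift c d o3)).
have := H2 _ a (far c d) a2.
move: (sd (zet tau) _ a) (sd pol _ a) => x y hy hxy.
rewrite -[x](addrK y); apply: le_trans (nmB _ _) _.
by rewrite mulrDl lerD.
Qed.

Section Defect.
Variable tau : C.
Hypothesis Ht : H tau.
Let tau' := - tau^-1.
Let Ht' : H tau' := H_inv Ht.
Let t0 : tau != 0 := H_neq0 Ht.

(* zet is quasimodular-periodic with period pair (1, tau) and increments (0, 1);
   the linear term makes the difference of the two rescalings doubly periodic. *)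
Definition defect z : C := tau^-1 * zet tau' (z / tau) - zet tau z + z / tau.

Lemma off_inv z : off tau z -> off tau' (z / tau).
Proof.
move=> o c d; apply: contra (o (- d) c) => /eqP E; apply/eqP.
rewrite -[z](divfK t0) E /tau' mulrNz mulrDl mulrN mulNr -mulrA mulVf//; ring.
Qed.

(** Division by tau exchanges the periods: tau becomes 1, and 1 becomes - tau'. The increment of
    either [zet] is then compensated by the linear term. *)
Lemma defect_shift z (c d : int) : off tau z -> defect (z + (c%:~R + d%:~R * tau)) = defect z.
Proof.
move=> o; rewrite /defect zet_shift//.
have -> : (z + (c%:~R + d%:~R * tau)) / tau = z / tau + (d%:~R + (- c)%:~R * tau').
  by rewrite /tau' mulrNz; field.
rewrite zet_shift//; last exact: off_inv.
by rewrite mulrNz /tau'; field.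
Qed.

Lemma defectN z : off tau z -> defect (- z) = - defect z.
Proof.
move=> o; rewrite /defect zetN// mulNr zetN//; last exact: off_inv.
ring.
Qed.

(** The points (z + 1) / 2 and (z + 1 + tau) / 2 land on half-points of the lattice of tau' only
    after a shift by - tau'. The increments of these shifts, the constants 1 of [zet_dup] and the
    linear terms cancel. *)
Lemma defect_dup z : off tau z ->
  defect (z / 2) + defect ((z + 1) / 2) + (defect ((z + tau) / 2) + defect ((z + 1 + tau) / 2))
  = 2 * defect z.
Proof.
move=> o; have o' := off_inv o.
have D := zet_dup Ht o; have D' := zet_dup Ht' o'.
rewrite /defect.
set w := z / tau in o' D'.
have e0 : z / 2 / tau = w / 2 by rewrite /w; ring.
have e1 : (z + 1) / 2 / tau = (w + tau') / 2 + (0%:~R + (-1)%:~R * tau').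
  by rewrite /w /tau'; field.
have e2 : (z + tau) / 2 / tau = (w + 1) / 2 by rewrite /w; field.
have e3 : (z + 1 + tau) / 2 / tau = (w + 1 + tau') / 2 + (0%:~R + (-1)%:~R * tau').
  by rewrite /w /tau'; field.
have oa : off tau' ((w + tau') / 2) by have := off_half 0 1 o'; rewrite add0r mul1r.
have ob : off tau' ((w + 1 + tau') / 2) by have := off_half 1 1 o'; rewrite mul1r addrA.
rewrite e0 e1 e2 e3 !zet_shift//.
move: D D'.
move: (zet tau (z / 2)) (zet tau ((z + 1) / 2)) (zet tau ((z + tau) / 2)) (zet tau ((z + 1 + tau) / 2)) (zet tau z) => x1 x2 x3 x4 x5.
move: (zet tau' (w / 2)) (zet tau' ((w + 1) / 2)) (zet tau' ((w + tau') / 2)) (zet tau' ((w + 1 + tau') / 2)) (zet tau' w) => y1 y2 y3 y4 y5 h1 h2.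
have -> : x1 = 2 * x5 + 1 - (x2 + (x3 + x4)) by rewrite -h1; ring.
have -> : y1 = 2 * y5 + 1 - (y2 + (y3 + y4)) by rewrite -h2; ring.
by rewrite /w /tau'; field.
Qed.

Lemma defect_sd z a : sd defect z a = tau^-1 * sd (zet tau') (z / tau) (a / tau) - sd (zet tau) z a.
Proof. by rewrite /sd /defect mulrDl mulrBl; ring. Qed.

Lemma defect_sd_shift z a (c d : int) : off tau z -> off tau (z + a) -> off tau (z - a) ->
  sd defect (z + (c%:~R + d%:~R * tau)) a = sd defect z a.
Proof.
move=> o1 o2 o3; rewrite /sd.
have e1 : z + (c%:~R + d%:~R * tau) + a = z + a + (c%:~R + d%:~R * tau) by ring.
have e2 : z + (c%:~R + d%:~R * tau) - a = z - a + (c%:~R + d%:~R * tau) by ring.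
by rewrite e1 e2 !defect_shift.
Qed.

(** The bound holds right up to the lattice because the two rescalings have the same polar part,
    tau^-1 * pol (z / tau) = pol z. Away from the lattice each [zet] is estimated alone. *)
Lemma defect_sd_bound : exists A : R, exists2 dl : R, 0 < dl & 0 <= A /\
  forall z a, nm a <= dl -> off tau z -> off tau (z + a) -> off tau (z - a) ->
    nm (sd defect z a) <= A * nm a ^+ 2.
Proof.
have Y0 : 0 < complex.Im tau by exact: Ht.
have Y0' : 0 < complex.Im tau' by exact: Ht'.
have T0 : 0 < nm tau by rewrite nm_gt0.
(* Small enough that |y| < rho puts y in the fundamental cell of tau and y / tau in that of tau'. *)
pose rho := Num.min (Num.min (1 / 2) (complex.Im tau / 2)) (Num.min (1 / 2) (complex.Im tau' / 2) * nm tau).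
have r0 : 0 < rho.
  rewrite !lt_min; apply/andP; split; first by apply/andP; split; lra.
  by rewrite mulr_gt0// lt_min; apply/andP; split; lra.
have rP x : x < rho -> [/\ x <= 1 / 2, x <= complex.Im tau / 2, x / nm tau <= 1 / 2 & x / nm tau <= complex.Im tau' / 2].
  rewrite !lt_min => /andP[/andP[/ltW -> /ltW ->]].
  by rewrite -ltr_pdivrMr// lt_min => /andP[/ltW -> /ltW ->].
clearbody rho.
have [A1 [d1 d10 [A10 H1]]] := zet_sd_bound Ht.
have [A2 [d2 d20 [A20 H2]]] := zet_sd_bound Ht'.
have [A3 [d3 d30 [A30 H3]]] := zet_sd_far Ht r0.
have [A4 [d4 d40 [A40 H4]]] := zet_sd_far Ht' (divr_gt0 r0 T0).
pose S := nm tau ^- 3.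
have S0 : 0 <= S by rewrite invr_ge0 exprn_ge0 ?nm_ge0.
exists (S * A2 + A1 + (S * A4 + A3)).
exists (Num.min (Num.min d1 (d2 * nm tau)) (Num.min d3 (d4 * nm tau))).
  by rewrite !lt_min d10 d30 !mulr_gt0.
split; first by rewrite !addr_ge0 ?mulr_ge0.
move=> z a ha o1 o2 o3.
move: ha; rewrite !le_min => /andP[/andP[a1 a2] /andP[a3 a4]].
rewrite -ler_pdivrMr// -nmf_div in a2; rewrite -ler_pdivrMr// -nmf_div in a4.
have sS (A : R) x : nm x <= A * nm (a / tau) ^+ 2 -> nm (tau^-1 * x) <= S * A * nm a ^+ 2.
  move=> h; rewrite nmM nmV; apply: le_trans (ler_wpM2l _ h) _; first by rewrite invr_ge0 nm_ge0.
  by rewrite nmf_div /S le_eqVlt; apply/orP; left; apply/eqP; field; rewrite gt_eqF.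
have a20 : 0 <= nm a ^+ 2 by rewrite exprn_ge0 ?nm_ge0.
have [[c [d near]]|far] := pselect (exists c d : int, nm (z + (c%:~R + d%:~R * tau)) < rho).
  rewrite -(defect_sd_shift c d o1 o2 o3) defect_sd.
  have e1 : z + (c%:~R + d%:~R * tau) + a = z + a + (c%:~R + d%:~R * tau) by ring.
  have e2 : z + (c%:~R + d%:~R * tau) - a = z - a + (c%:~R + d%:~R * tau) by ring.
  have s1 := off_shift c d o1; have s2 := off_shift c d o2; have s3 := off_shift c d o3.
  rewrite -e1 in s2; rewrite -e2 in s3.
  move: (z + _) near s1 s2 s3 => y /rP [y1 y2 y3 y4] s1 s2 s3.
  have b1 := H1 y a (le_trans (nm_Re _) y1) (le_trans (nm_Im _) y2) a1 s1 s2 s3.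
  have := H2 (y / tau) (a / tau); rewrite -nmf_div in y3 y4.
  rewrite -mulrDl -mulrBl => /(_ (le_trans (nm_Re _) y3) (le_trans (nm_Im _) y4) a2 (off_inv s1) (off_inv s2) (off_inv s3)) /sS b2.
  have E : tau^-1 * sd pol (y / tau) (a / tau) = sd pol y a.
    have pE w : tau^-1 * pol (w / tau) = pol w.
      by rewrite /pol !invfM invrK mulrCA [tau^-1 * _]mulrCA mulVf// mulr1.
    by rewrite /sd -mulrDl -mulrBl mulrBr mulrDr !pE mulrCA pE.
  rewrite mulrDr E in b2.
  move: (sd pol y a) b1 b2 => p b1 b2.
  have -> : tau^-1 * sd (zet tau') (y / tau) (a / tau) - sd (zet tau) y a =
    (tau^-1 * sd (zet tau') (y / tau) (a / tau) + p) - (sd (zet tau) y a + p) by ring.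
  apply: le_trans (nmB _ _) _; apply: le_trans (lerD b2 b1) _.
  by rewrite -mulrDl ler_wpM2r// lerDl addr_ge0 ?mulr_ge0.
have far1 (c d : int) : rho <= nm (z + (c%:~R + d%:~R * tau)).
  by rewrite leNgt; apply/negP => h; apply: far; exists c, d.
rewrite defect_sd; apply: le_trans (nmB _ _) _.
have b3 := H3 z a far1 a3 o1 o2 o3.
have := H4 (z / tau) (a / tau); rewrite -mulrDl -mulrBl.
move=> /(_ _ a4 (off_inv o1) (off_inv o2) (off_inv o3)) b4.
have {}b4 := sS _ _ (b4 _).
apply: le_trans (lerD (b4 _) b3) _.
  move=> c d; have -> : z / tau + (c%:~R + d%:~R * tau') = (z + ((- d)%:~R + c%:~R * tau)) / tau.
    by rewrite mulrNz /tau'; field.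
  by rewrite nmf_div ler_wpM2r ?invr_ge0 ?nm_ge0.
by rewrite -mulrDl ler_wpM2r// lerDr addr_ge0 ?mulr_ge0.
Qed.

Lemma defect_sd0 : exists2 dl : R, 0 < dl & forall z a, nm a <= dl ->
  off tau z -> off tau (z + a) -> off tau (z - a) -> sd defect z a = 0.
Proof.
have [A [dl dl0 [A0 HA]]] := defect_sd_bound.
exists dl => // z a ad o1 o2 o3.
have key n : forall z a, nm a <= dl -> off tau z -> off tau (z + a) -> off tau (z - a) ->
    nm (sd defect z a) <= A * nm a ^+ 2 / 2 ^+ n.
  elim: n => [|n ih] {}z {}a {}ad {}o1 {}o2 {}o3; first by rewrite expr0 divr1 HA.
  have a2 : nm (a / 2) = nm a / 2 by rewrite nmf_div (nm_nat _ 2).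
  have ad2 : nm (a / 2) <= dl by rewrite a2; have := nm_ge0 a; lra.
  (* Each of the four half-points has a bound four times smaller, by (a / 2)^2, and duplication
     takes half of their sum: the bound is halved. *)
  have B (c d : int) : nm (sd defect ((z + (c%:~R + d%:~R * tau)) / 2) (a / 2)) <= A * nm a ^+ 2 / 2 ^+ n / 4.
    have := ih ((z + (c%:~R + d%:~R * tau)) / 2) (a / 2) ad2 (off_half c d o1).
    rewrite -mulrDl -mulrBl.
    have e1 : z + (c%:~R + d%:~R * tau) + a = z + a + (c%:~R + d%:~R * tau) by ring.
    have e2 : z + (c%:~R + d%:~R * tau) - a = z - a + (c%:~R + d%:~R * tau) by ring.
    rewrite e1 e2 => /(_ (off_half c d o2) (off_half c d o3)) h; apply: (le_trans h).
    rewrite a2 le_eqVlt; apply/orP; left; apply/eqP; field.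
    by rewrite expf_neq0// pnatr_eq0.
  have B0 := B 0 0; have B1 := B 1 0; have B2 := B 0 1; have B3 := B 1 1.
  rewrite mul0r addr0 in B0; rewrite mul0r addr0 in B1.
  rewrite mul1r add0r in B2; rewrite mul1r in B3.
  have S w : sd defect ((z + w) / 2) (a / 2) =
      defect ((z + a + w) / 2) + defect ((z - a + w) / 2) - 2 * defect ((z + w) / 2).
    by rewrite /sd -mulrDl -mulrBl (addrAC z w a) (addrAC z w (- a)).
  have dup x : off tau x -> defect ((x + 0) / 2) + defect ((x + 1) / 2) +
      (defect ((x + tau) / 2) + defect ((x + (1 + tau)) / 2)) = 2 * defect x.
    by move=> ox; rewrite addr0 (addrA x 1 tau) defect_dup.
  have -> : sd defect z a = 2^-1 * (sd defect ((z + 0) / 2) (a / 2) + sd defect ((z + 1) / 2) (a / 2)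
    + (sd defect ((z + tau) / 2) (a / 2) + sd defect ((z + (1 + tau)) / 2) (a / 2))).
    rewrite !S; move: (dup _ o1) (dup _ o2) (dup _ o3); rewrite /sd.
    move: (defect ((z + 0) / 2)) (defect ((z + 1) / 2)) (defect ((z + tau) / 2)) (defect ((z + (1 + tau)) / 2)) (defect z) => x1 x2 x3 x4 x.
    move: (defect ((z + a + 0) / 2)) (defect ((z + a + 1) / 2)) (defect ((z + a + tau) / 2)) (defect ((z + a + (1 + tau)) / 2)) (defect (z + a)) => y1 y2 y3 y4 y.
    move: (defect ((z - a + 0) / 2)) (defect ((z - a + 1) / 2)) (defect ((z - a + tau) / 2)) (defect ((z - a + (1 + tau)) / 2)) (defect (z - a)) => u1 u2 u3 u4 u.
    move=> h1 h2 h3.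
    apply: (@mulfI _ 2); first by rewrite pnatr_eq0.
    rewrite mulrBr mulrDr -h1 -h2 -h3; by field.
  rewrite nmM nmV (nm_nat _ 2).
  apply: (@le_trans _ _ (2^-1 * ((A * nm a ^+ 2 / 2 ^+ n / 4) *+ 4))).
    rewrite ler_wpM2l ?invr_ge0// (le_trans (nmD _ _))//.
    rewrite (le_trans (lerD (nmD _ _) (nmD _ _)))//.
    by move: B0 B1 B2 B3; lra.
  rewrite le_eqVlt; apply/orP; left; apply/eqP; rewrite (exprS (2 : R) n); field.
  by rewrite expf_neq0// pnatr_eq0.
apply: nm0_eq0; apply/eqP; rewrite eq_le nm_ge0 andbT; apply/ler_addgt0Pr => e e0; rewrite add0r.
have h01 : 0 <= (2^-1 : R) < 1 by lra.
have [|N HN] := small_pow h01 (c := A * nm a ^+ 2 / e).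
  by rewrite divr_ge0 ?(ltW e0)// mulr_ge0// exprn_ge0 ?nm_ge0.
apply: le_trans (key N z a ad o1 o2 o3) _.
have := HN N (leqnn _); rewrite mulrA ler_pdivrMr// exprVn mulrC; lra.
Qed.

(** A lattice point on the real axis is an integer, and an odd number is not a multiple of 2N. *)
Lemma off_odd (N j : nat) : (0 < N)%N -> off tau ((j.*2.+1)%:R / (N.*2)%:R).
Proof.
move=> N0 c d; apply/eqP => E.
have NN : ((N.*2)%:R : R) != 0 by rewrite pnatr_eq0 double_eq0 -lt0n.
have NC : ((N.*2)%:R : C) != 0 by rewrite pnatr_eq0 double_eq0 -lt0n.
have Y0 : complex.Im tau != 0 by rewrite gt_eqF//; exact: Ht.
have : complex.Im (j.*2.+1%:R / (N.*2)%:R : C) = complex.Im (c%:~R + d%:~R * tau) by rewrite E.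
rewrite -(realC_nat R) -(realC_nat R) -realCV -realCM -(realC_int R c) -(realC_int R d).
rewrite cImD cImM /= mul0r addr0 add0r => /esym/eqP; rewrite mulf_eq0 (negbTE Y0) orbF intr_eq0 => /eqP d0.
move: E; rewrite d0 mul0r addr0 => /(congr1 (fun x => x * (N.*2)%:R)); rewrite divfK//.
move=> /eqP; rewrite -[(N.*2)%:R]/((N.*2)%:Z%:~R) -[(j.*2.+1)%:R]/((j.*2.+1)%:Z%:~R) -intrM eqr_int.
by move/eqP; lia.
Qed.

(** Along p_j = (2j + 1) / (2N), which avoids the lattice, vanishing second differences make the
    defect an arithmetic progression; the period p_N = p_0 + 1 forces slope 0. The neighbour of p_0
    on the left is - p_0, so oddness turns the second difference at p_0 into -2 times the value
    there. *)
Lemma defect_small : exists N0 : nat, forall N, (N0 <= N)%N -> (0 < N)%N ->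
  defect ((N.*2)%:R)^-1 = 0.
Proof.
have [dl dl0 Hd] := defect_sd0.
exists (Num.Def.archi_bound dl^-1) => N NN N0.
have Np : 0 < (N%:R : R) by rewrite ltr0n.
have NC : (N%:R : C) != 0 by rewrite pnatr_eq0 -lt0n.
have DC : ((N.*2)%:R : C) = 2 * N%:R by rewrite -mul2n natrM.
pose p (j : nat) : C := (j.*2.+1)%:R / (N.*2)%:R.
pose a : C := N%:R^-1.
have ad : nm a <= dl.
  rewrite /a nmV nm_nat -[dl]invrK lef_pV2 ?posrE ?invr_gt0//.
  have : dl^-1 < (Num.Def.archi_bound dl^-1)%:R by apply: archi_boundP; rewrite invr_ge0 ltW.
  move=> /ltW h; apply: (le_trans h); by rewrite ler_nat.
have pS j : p j.+1 = p j + a.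
  by rewrite /p /a DC -!addnn !addSn !addnS -!natr1 natrD; field; rewrite NC.
have op j : off tau (p j) by exact: off_odd.
have p0 : p 0%N = ((N.*2)%:R)^-1 by rewrite /p mul1r.
have pm : p 0%N - a = - p 0%N by rewrite p0 /a DC; field; rewrite NC.
have step j : defect (p j.+2) - defect (p j.+1) = defect (p j.+1) - defect (p j).
  have pB : p j.+1 - a = p j by rewrite pS addrK.
  have := Hd (p j.+1) a ad (op _); rewrite -pS pB => /(_ (op _) (op _)).
  rewrite /sd -pS pB => E; apply/eqP; rewrite -subr_eq0 -E; apply/eqP; ring.
have lin j : defect (p j) = defect (p 0%N) + j%:R * (defect (p 1%N) - defect (p 0%N)).
  have dj i : defect (p i.+1) - defect (p i) = defect (p 1%N) - defect (p 0%N).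
    by elim: i => // i ih; rewrite step.
  elim: j => [|j ih]; first by rewrite mul0r addr0.
  by rewrite -[defect (p j.+1)](subrK (defect (p j))) dj ih -natr1; ring.
have per : defect (p N) = defect (p 0%N).
  have -> : p N = p 0%N + (1%:~R + 0%:~R * tau).
    by rewrite mul0r addr0 p0 /p -natr1 DC; field; rewrite NC.
  exact: defect_shift.
have d0 : defect (p 1%N) = defect (p 0%N).
  apply/eqP; rewrite -subr_eq0; apply/eqP; apply: (mulfI NC); rewrite mulr0.
  by apply: (addrI (defect (p 0%N))); rewrite -lin addr0.
have := Hd (p 0%N) a ad (op _); rewrite -pS pm => /(_ (op _) (offN (op _))).
rewrite /sd -pS pm d0 defectN// -p0 subrr sub0r => /eqP; rewrite oppr_eq0 mulf_eq0 pnatr_eq0/= => /eqP.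
exact.
Qed.

End Defect.
End ZetaDefect.

(** * First-order expansion at 0 and the law of E2 under tau to -1/tau *)

Section SLaw.
Variable R : realType.
Local Notation C := (cplx R).
Implicit Types (z w tau v q a b : C).
Local Notation H := (@upper_half R).

(** The point 0 is excluded: [kap] takes the value 0 there by the convention on inverses, not its
    limit -1/2. *)
Definition small_o (f : C -> C) := forall e : R, 0 < e -> exists2 dl : R, 0 < dl &
  forall z, z != 0 -> nm z < dl -> nm (f z) <= e * nm z.

Lemma small_oD f g : small_o f -> small_o g -> small_o (fun z => f z + g z).
Proof.
move=> of_ og e e0; have e2 : 0 < e / 2 by lra.
have [d1 d10 H1] := of_ _ e2; have [d2 d20 H2] := og _ e2.
exists (Num.min d1 d2); first by rewrite lt_min d10.
move=> z z0; rewrite lt_min => /andP[z1 z2].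
by apply: le_trans (nmD _ _) _; have := H1 z z0 z1; have := H2 z z0 z2; lra.
Qed.

Lemma small_oZ k f : small_o f -> small_o (fun z => k * f z).
Proof.
move=> of_ e e0; have k0 : 0 < nm k + 1 by rewrite ltr_wpDl ?nm_ge0.
have [d d0 Hd] := of_ _ (divr_gt0 e0 k0); exists d => // z z0 zd.
rewrite nmM; apply: le_trans (ler_wpM2l (nm_ge0 k) (Hd z z0 zd)) _.
rewrite mulrA ler_wpM2r ?nm_ge0// mulrCA ler_piMr ?(ltW e0)//.
by rewrite ler_pdivrMr// mul1r lerDl.
Qed.

Lemma small_o_scale k f : k != 0 -> small_o f -> small_o (fun z => f (z * k)).
Proof.
move=> k0 of_ e e0; have kp : 0 < nm k by rewrite nm_gt0.
have [d d0 Hd] := of_ _ (divr_gt0 e0 kp); exists (d / nm k); first by rewrite divr_gt0.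
move=> z z0; rewrite ltr_pdivlMr// -nmM => zd.
have := Hd (z * k) (mulf_neq0 z0 k0) zd; rewrite nmM => h; apply: (le_trans h).
by rewrite le_eqVlt; apply/orP; left; apply/eqP; field; rewrite gt_eqF.
Qed.

Lemma small_o_sq (f : C -> C) (K d : R) : 0 < d -> (forall z, nm z <= d -> nm (f z) <= K * nm z ^+ 2) -> small_o f.
Proof.
move=> d0 Hf e e0; have K1 : 0 < `|K| + 1 by rewrite ltr_wpDl.
exists (Num.min d (e / (`|K| + 1))); first by rewrite lt_min d0 divr_gt0.
move=> z z0; rewrite lt_min ltr_pdivlMr// => /andP[z1 z2].
apply: le_trans (Hf z (ltW z1)) _; rewrite expr2 mulrA ler_wpM2r ?nm_ge0//.
apply: le_trans (_ : nm z * (`|K| + 1) <= e); last exact: ltW.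
rewrite mulrC ler_wpM2l ?nm_ge0// (le_trans (ler_norm K))// lerDl//.
Qed.

Lemma qexp_small : small_o (fun z => qexp z - (qexp z)^-1 - 2 * twopii R * z).
Proof.
have t0 : 0 < nm (twopii R) by rewrite nm_gt0 twopii_neq0.
move=> e e0; have e2 : 0 < e / (2 * nm (twopii R)) by rewrite divr_gt0 ?mulr_gt0.
have [d d0 Hd] := cexp_eps e2; exists (d / nm (twopii R)); first by rewrite divr_gt0.
move=> z _; rewrite ltr_pdivlMr// mulrC -nmM => zd.
have h1 := Hd _ zd; have := Hd (- (twopii R * z)); rewrite nmN => /(_ zd) h2.
have -> : qexp z - (qexp z)^-1 - 2 * twopii R * z =
  (cexp (twopii R * z) - 1 - twopii R * z) - (cexp (- (twopii R * z)) - 1 - - (twopii R * z)).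
  by rewrite -qexpN /qexp mulrN; ring.
apply: le_trans (nmB _ _) _; apply: le_trans (lerD h1 h2) _.
by rewrite nmM le_eqVlt; apply/orP; left; apply/eqP; field; rewrite gt_eqF.
Qed.

Lemma lamN_small : small_o (fun z => lam (- qexp z) + 2^-1 + twopii R / 4 * z).
Proof.
have E : (qexp z - 1) / z * - (2 * (1 + qexp z))^-1 + twopii R / 4 @[z --> (0 : C)^'] -->
    twopii R * - (2 * (1 + 1))^-1 + twopii R / 4.
  apply: cvgD; last exact: cvg_cst.
  apply: cvgM; first exact: qexp_quot.
  apply: cvgN; apply: cvgV; first by rewrite mulf_neq0// ?pnatr_eq0// -[1 + 1]/(2%:R) pnatr_eq0.
  apply: cvgM; first exact: cvg_cst.
  apply: cvgD; [exact: cvg_cst|exact: qexp_cvg1].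
have E0 : twopii R * - (2 * (1 + 1))^-1 + twopii R / 4 = 0 by field.
rewrite E0 in E.
have /cvgCP/(_ _ ltr01)/near0CP[d1 d10 H1] := @qexp_cvg1 R.
move=> e e0; have /cvgCP/(_ _ e0)/near0CP[d d0 Hd] := E.
exists (Num.min d d1); first by rewrite lt_min d0.
move=> z z0; rewrite lt_min => /andP[zd zd1].
have q1 : 1 + qexp z != 0.
  rewrite -nm_gt0; have := nm_sub 2 (1 - qexp z).
  have -> : 2 - (1 - qexp z) = 1 + qexp z by ring.
  by rewrite (nm_nat _ 2) nmBC; have := H1 z z0 zd1; lra.
have := Hd z z0 zd; rewrite subr0 -(ltr_pM2r (x := nm z)) ?nm_gt0// -nmM => /ltW.
suff -> : ((qexp z - 1) / z * - (2 * (1 + qexp z))^-1 + twopii R / 4) * z =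
  lam (- qexp z) + 2^-1 + twopii R / 4 * z by [].
by rewrite /lam opprK; field; rewrite z0 q1.
Qed.

Lemma qexp_neq1_small z : z != 0 -> nm z < 1 -> qexp z != 1.
Proof.
move=> z0 z1; apply/eqP => /qexp_eq1 [n E]; move: z0 z1; rewrite E intr_eq0 => n0.
rewrite -realC_int nm_realC -intr_norm; move: n0; rewrite -normr_gt0 => n0.
by rewrite -[ltRHS]/(1%:~R) ltr_int ltNge -gtz0_ge1 n0.
Qed.

(** Origin of the constant 12: if kap has linear term s (2 pi i) z, then [kap_half] and [lamN_small]
    give s = s/4 - 1/16, hence s = -1/12. *)
Lemma kap_small_o : small_o (fun z => kap z + 2^-1 + twopii R / 12%:R * z).
Proof.
move=> e e0; have [d d0 Hd] := lamN_small e0.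
exists (Num.min d 1); first by rewrite lt_min d0 ltr01.
move=> z z0; rewrite lt_min => /andP[zd z1].
have zq := qexp_neq1_small z0 z1.
have p2C n : (2 ^+ n : C) != 0 by rewrite expf_neq0// pnatr_eq0.
have p2 n : 0 < 2 ^+ n :> R by rewrite exprn_gt0.
have n2 n : nm (2 ^+ n : C) = 2 ^+ n by rewrite nmX (nm_nat _ 2).
have zn n : nm (z / 2 ^+ n) <= nm z.
  rewrite nmf_div n2 ler_pdivrMr// ler_peMr ?nm_ge0// exprn_ege1//; lra.
have zn0 n : z / 2 ^+ n != 0 by rewrite mulf_neq0// invr_neq0.
have S n : z / 2 ^+ n.+1 = z / 2 ^+ n / 2 by rewrite exprSr invfM mulrA.
pose x n := kap (z / 2 ^+ n) + 2^-1 + twopii R / 12%:R * (z / 2 ^+ n).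
pose g n := lam (- qexp (z / 2 ^+ n.+1)) + 2^-1 + twopii R / 4 * (z / 2 ^+ n.+1).
have -> : kap z + 2^-1 + twopii R / 12%:R * z = x 0%N by rewrite /x expr0 divr1.
apply: (halving_bound (g := g)).
- move=> n; rewrite /x /g !S.
  have kq : qexp (z / 2 ^+ n) != 1.
    by apply: qexp_neq1_small => //; apply: le_lt_trans (zn n) _.
  by rewrite [kap (z / 2 ^+ n)](kap_half kq); field.
- move=> n; apply: le_trans (Hd _ (zn0 _) _) _; first exact: le_lt_trans (zn _) zd.
  by rewrite ler_wpM2l ?zn// ltW.
move=> e' e'0; have e'2 : 0 < e' / 2 by lra.
have [N1 H1] := kap_dyadic z0 e'2.
pose K := nm (2^-1 : C) + nm (twopii R / 12%:R * z).
have K0 : 0 <= K by rewrite addr_ge0 ?nm_ge0.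
have h01 : 0 <= (2^-1 : R) < 1 by lra.
have [N2 H2] := small_pow h01 (divr_ge0 K0 (ltW e'0)).
exists (maxn N1 N2); set N := maxn _ _.
have h1 := H1 N (leq_maxl _ _); have := H2 N (leq_maxr _ _).
rewrite mulrA ler_pdivrMr// => h2.
have : nm (x N) <= nm (kap (z / 2 ^+ N)) + K.
  rewrite /x -addrA; apply: le_trans (nmD _ _) _; rewrite lerD2l.
  apply: le_trans (nmD _ _) _; rewrite lerD2l !nmM ler_wpM2l ?mulr_ge0 ?nm_ge0//.
  by rewrite -nmM zn.
move=> h3; have i2 : 0 <= (2 ^- N : R) by rewrite invr_ge0 ltW.
have := ler_wpM2r i2 h3; rewrite mulrDl => h4; apply: (le_trans h4).
have -> : K * 2 ^- N = 2^-1 ^+ N * K by rewrite exprVn mulrC.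
lra.
Qed.

(** The derivative of [lam] along v d/dv, and the sum of n v^n. *)
Definition pp v : C := v / (1 - v) ^+ 2.

Lemma lam_diff v u : u != 0 -> 1 - v * u != 0 -> 1 - v / u != 0 -> 1 - v != 0 ->
  lam (v * u) - lam (v / u) - (u - u^-1) * pp v =
  (u - u^-1) * (v ^+ 2 * ((u - 1) ^+ 2 / u)) / ((1 - v * u) * (1 - v / u) * ((1 - v) * (1 - v))).
Proof.
move=> u0 h1 h2 h3; have h4 : u - v != 0.
  have -> : u - v = u * (1 - v / u) by field.
  by rewrite mulf_neq0.
by rewrite /lam /pp; field; rewrite u0 h1 h4 h3.
Qed.

(** With u = [qexp z] and v = q^(m+1), each term is (u - 1/u) [pp v] up to an error of order z^2
    that is summable in m, and u - 1/u is 2 (2 pi i) z to first order. *)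
Lemma regzet_small tau P : H tau -> csum (fun m => pp (qexp tau ^+ m.+1)) P ->
  small_o (fun z => regzet tau z - 2 * twopii R * P * z).
Proof.
move=> Ht HP; have q0 := qexp_neq0 tau; have q1 := nm_qexp_lt1 Ht.
rewrite /regzet; set q := qexp tau in q0 q1 HP *.
have q01 := nmq01 q1.
pose eta := (1 - nm q) / 2.
have eta0 : 0 < eta by rewrite /eta; lra.
have eta1 : eta <= 1 / 2 by rewrite /eta; have := nm_ge0 q; lra.
have [c [dl dl0 [c0 Hc]]] := qexp_near1 eta0.
have A : small_o (fun z => Lam q (q * qexp z) - Lam q (q * qexp (- z)) - (qexp z - (qexp z)^-1) * P).
  apply: (@small_o_sq _ (2 * c ^+ 2 / eta ^+ 4 / (1 - nm q)) dl) => // z zd.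
  have [h1 h2 h3 h4] := Hc z zd.
  have S := csumB (csumB (Lam_csum (q * qexp z) q0 q1) (Lam_csum (q * qexp (- z)) q0 q1)) (csumZ (qexp z - (qexp z)^-1) HP).
  have K0 : 0 <= 2 * c ^+ 2 / eta ^+ 4 * nm z ^+ 2.
    by rewrite !mulr_ge0 ?invr_ge0 ?exprn_ge0 ?nm_ge0 ?(ltW c0) ?(ltW eta0).
  apply: (csum_nm (b := fun m => (2 * c ^+ 2 / eta ^+ 4 * nm z ^+ 2) * nm q ^+ m)) S; last first.
    by move=> n; rewrite [leRHS]mulrAC; exact: geo_series_le.
  move=> m; rewrite qexpN (mulrA (q ^+ m)) (mulrA (q ^+ m) q (qexp z)^-1) -exprSr.
  have u0 := qexp_neq0 z.
  have vq : nm (q ^+ m.+1) <= nm q.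
    by rewrite nmX exprS ler_piMr ?nm_ge0// exprn_ile1 ?nm_ge0// ltW.
  have D w : nm (w - 1) <= eta -> eta <= nm (1 - q ^+ m.+1 * w).
    move=> we; have -> : 1 - q ^+ m.+1 * w = (1 - q ^+ m.+1) - q ^+ m.+1 * (w - 1) by ring.
    apply: le_trans (nm_sub _ _); rewrite nmM.
    have := nm_sub 1 (q ^+ m.+1); rewrite nm1.
    have : nm (q ^+ m.+1) * nm (w - 1) <= 1 * eta.
      by apply: ler_pM; rewrite ?nm_ge0//; lra.
    rewrite /eta in we *; lra.
  have D1 : eta <= nm (1 - q ^+ m.+1).
    by have := D 1; rewrite subrr nm0 mulr1; apply; rewrite ltW.
  have nz x : eta <= nm x -> x != 0 by rewrite -nm_gt0; exact: lt_le_trans.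
  have d1 := D _ h2; have d2 := D _ h3.
  rewrite (lam_diff u0 (nz _ d1) (nz _ d2) (nz _ D1)).
  have uu : nm (qexp z - (qexp z)^-1) <= 1.
    have -> : qexp z - (qexp z)^-1 = (qexp z - 1) - ((qexp z)^-1 - 1) by ring.
    by apply: le_trans (nmB _ _) _; lra.
  have v2 : nm (q ^+ m.+1) <= nm q ^+ m.
    by rewrite nmX exprSr ler_piMr ?exprn_ge0 ?nm_ge0// ltW.
  have v1 : nm (q ^+ m.+1) <= 1 by lra.
  move: (q ^+ m.+1) (qexp z) v1 v2 d1 d2 D1 uu h1 h4 {nz D h2 h3 u0 vq} => v u v1 v2 d1 d2 D1 uu h1 h4.
  rewrite nmf_div; set X := nm (_ * _); set Y := nm (_ * _).
  have XE : X = nm (u - u^-1) * (nm v * nm v * (nm (u - 1) ^+ 2 * nm u^-1)).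
    by rewrite /X !nmM !expr2.
  have YE : Y = nm (1 - v * u) * nm (1 - v / u) * (nm (1 - v) * nm (1 - v)).
    by rewrite /Y !nmM.
  have XB : X <= 2 * c ^+ 2 * nm z ^+ 2 * nm q ^+ m.
    have x1 : nm (u - 1) ^+ 2 * nm u^-1 <= (c * nm z) ^+ 2 * 2.
      apply: ler_pM; rewrite ?exprn_ge0 ?nm_ge0// lerXn2r ?nnegrE ?nm_ge0//.
      by rewrite mulr_ge0 ?nm_ge0// ltW.
    have x2 : nm v * nm v <= 1 * nm q ^+ m by apply: ler_pM; rewrite ?nm_ge0.
    have x3 : nm v * nm v * (nm (u - 1) ^+ 2 * nm u^-1) <= 1 * nm q ^+ m * ((c * nm z) ^+ 2 * 2).
      by apply: ler_pM; rewrite ?mulr_ge0 ?exprn_ge0 ?nm_ge0.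
    have x4 : X <= 1 * (1 * nm q ^+ m * ((c * nm z) ^+ 2 * 2)).
      by rewrite XE; apply: ler_pM; rewrite ?mulr_ge0 ?exprn_ge0 ?nm_ge0.
    by apply: (le_trans x4); rewrite le_eqVlt; apply/orP; left; apply/eqP; ring.
  have YB : eta ^+ 4 <= Y.
    have -> : eta ^+ 4 = eta * eta * (eta * eta) by ring.
    have e0 := ltW eta0.
    have y1 : eta * eta <= nm (1 - v * u) * nm (1 - v / u) by apply: ler_pM.
    have y2 : eta * eta <= nm (1 - v) * nm (1 - v) by apply: ler_pM.
    by rewrite YE; apply: ler_pM => //; rewrite mulr_ge0.
  have e4 : 0 < eta ^+ 4 by rewrite exprn_gt0.
  have X0 : 0 <= X by rewrite nm_ge0.
  rewrite ler_pdivrMr; last exact: lt_le_trans YB.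
  apply: (le_trans XB).
  have -> : 2 * c ^+ 2 / eta ^+ 4 * nm z ^+ 2 * nm q ^+ m * Y =
    (2 * c ^+ 2 * nm z ^+ 2 * nm q ^+ m) * (Y / eta ^+ 4) by ring.
  rewrite ler_peMr//; first by rewrite !mulr_ge0 ?exprn_ge0 ?nm_ge0 ?(ltW c0).
  by rewrite ler_pdivlMr// mul1r.
have := small_oD A (small_oZ P qexp_small) => B e /B [d d0 Hd].
exists d => // z z0 zd; have := Hd z z0 zd.
by congr (nm _ <= _); ring.
Qed.

(** In the defect at y = 1 / (2N) the poles and the constants cancel, leaving L y plus errors small
    compared with y. As the defect vanishes there for all large N, L is 0. *)
Lemma lambert_S tau P P' : H tau -> csum (fun m => pp (qexp tau ^+ m.+1)) P ->
  csum (fun m => pp (qexp (- tau^-1) ^+ m.+1)) P' ->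
  tau ^- 2 * (1 - 24%:R * P') - (1 - 24%:R * P) = 12%:R / (twopii R * tau).
Proof.
move=> Ht HP HP'; have t0 := H_neq0 Ht; have i0 := twopii_neq0 R.
pose L := tau ^- 2 * (- (twopii R / 12%:R) + 2 * twopii R * P')
  - (- (twopii R / 12%:R) + 2 * twopii R * P) + tau^-1.
suff L0 : L = 0.
  apply/eqP; rewrite -subr_eq0; apply/eqP.
  apply: (mulfI (x := - (twopii R / 12%:R))); first by rewrite oppr_eq0 mulf_neq0// invr_neq0// pnatr_eq0.
  by rewrite mulr0 -L0 /L; field; rewrite i0 t0.
pose ek z := kap z + 2^-1 + twopii R / 12%:R * z.
pose et z := regzet tau z - 2 * twopii R * P * z.
pose et' z := regzet (- tau^-1) z - 2 * twopii R * P' * z.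
have O : small_o (fun z => tau^-1 * (ek (z * tau^-1) + et' (z * tau^-1)) + (-1) * (ek z + et z)).
  have ti0 : tau^-1 != 0 by rewrite invr_neq0.
  apply: small_oD; apply: small_oZ.
    apply: (small_o_scale (f := fun z => ek z + et' z)) => //.
    exact: small_oD kap_small_o (regzet_small (H_inv Ht) HP').
  exact: small_oD kap_small_o (regzet_small Ht HP).
apply: nm0_eq0; apply/eqP; rewrite eq_le nm_ge0 andbT; apply/ler_addgt0Pr => e e0; rewrite add0r.
have [d d0 Hd] := O e e0.
have [N0 HN0] := defect_small Ht.
pose N := maxn N0 (Num.Def.archi_bound d^-1).+1.
have N1 : (0 < N)%N by rewrite leq_max orbT.
have D0 := HN0 N (leq_maxl _ _) N1.
pose y : C := ((N.*2)%:R)^-1.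
have Np : 0 < ((N.*2)%:R : R) by rewrite ltr0n double_gt0.
have y0 : y != 0 by rewrite invr_neq0// pnatr_eq0 double_eq0 -lt0n.
have yd : nm y < d.
  rewrite nmV nm_nat -[d]invrK ltf_pV2 ?posrE ?invr_gt0//.
  have : d^-1 < (Num.Def.archi_bound d^-1)%:R by apply: archi_boundP; rewrite invr_ge0 ltW.
  move=> h; apply: (lt_le_trans h); rewrite ler_nat -addnn.
  by rewrite (leq_trans _ (leq_addr _ _))// leq_max leqnSn orbT.
have := Hd y y0 yd.
suff -> : tau^-1 * (ek (y * tau^-1) + et' (y * tau^-1)) + (-1) * (ek y + et y) = - (L * y).
  by rewrite nmN nmM ler_pM2r// nm_gt0.
have Ht' := H_inv Ht; move: D0; rewrite /defect !zet_split// -/y.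
have -> : pol (y / tau) = tau * pol y by rewrite /pol; field; rewrite t0 i0 y0.
rewrite /ek /et /et' /L.
move: (kap (y / tau)) (kap y) (pol y) (regzet tau y) (regzet _ _) => k1 k2 p r2 r1 E.
have -> : k1 = (tau * (0 - y / tau + (2^-1 + k2 - p + r2))) - 2^-1 + tau * p - r1 by rewrite -E; field.
by field.
Qed.

End SLaw.

(** * The q-expansion of E2 and its law under SL_2(Z) *)

Section EisensteinTwo.
Variable R : realType.
Local Notation C := (cplx R).
Implicit Types (z w tau v q : C).
Local Notation H := (@upper_half R).

(** Exchange of summations for a triangular array. Cutting the first N rows at column N costs at
    most N times a tail of [b], hence a tail of the series of k b_k, which is why that weighted
    series is bounded here. *)
Lemma csum_rows (u : nat -> nat -> C) (b : nat -> R) (B : R) (r : nat -> C) (S : C) :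
  (forall m k, (k < m)%N -> u m k = 0) -> (forall m k, nm (u m k) <= b k) ->
  (forall n, series (fun k => k%:R * b k) n <= B) -> (forall m, csum (u m) (r m)) ->
  csum (fun k => \sum_(m < k.+1) u m k) S -> csum r S.
Proof.
move=> u0 ub bB ur; set col := fun k => _ => cS.
have b0 k : 0 <= b k by apply: le_trans (ub 0%N k); exact: nm_ge0.
have kb0 k : 0 <= k%:R * b k by rewrite mulr_ge0.
pose bs := series (fun k => k%:R * b k).
have nbs : nondecreasing_seq bs by apply: nondecreasing_series => k _ _; exact: kb0.
have cbs : cvgn bs by apply: nondecreasing_is_cvgn => //; exists B => _ [k _ <-].
apply/csumE/seq_cvgCP => e e0; have e2 : 0 < e / 2 by rewrite divr_gt0.
have /cvgrPdist_lt/(_ _ e2)[N1 _ HN1] := cbs.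
move/csumE/seq_cvgCP : cS => /(_ _ e2)[N2 HN2].
exists (maxn N1 N2) => N; rewrite geq_max => /andP[NN1 NN2].
have := HN1 N NN1; set l := lim _ => Hl.
have sl m : bs m <= l by exact: nondecreasing_cvgn_le.
have tail m : N%:R * nm (r m - series (u m) N) <= l - bs N.
  have [->|N0] := posnP N; first by rewrite mul0r subr_ge0.
  rewrite -ler_pdivlMl ?ltr0n//.
  apply: (csum_nm (b := fun k => b (k + N)%N) _ _ (csum_tail N (ur m))) => [k|k]; first exact: ub.
  rewrite ler_pdivlMl ?ltr0n//; apply: (@le_trans _ _ (bs (k + N)%N - bs N)); last by rewrite lerD2r.
  rewrite -(series_tail (fun k => k%:R * b k)) /series /= big_distrr /=.
  by apply: ler_sum => i _; rewrite ler_wpM2r// ler_nat leq_addl.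
have colE : series col N = \sum_(0 <= m < N) series (u m) N.
  rewrite /series /= exchange_big /=; apply: eq_big_nat => k /andP[_ kN].
  rewrite /col -(big_mkord xpredT (fun m => u m k)).
  rewrite [RHS](big_cat_nat (n := k.+1))//= [X in _ + X]big_nat_cond [X in _ + X]big1 ?addr0//.
  by move=> i /andP[/andP[ki _] _]; rewrite u0.
have -> : series r N - S = \sum_(0 <= m < N) (r m - series (u m) N) + (series col N - S).
  by rewrite sumrB -colE /series /=; ring.
apply: le_lt_trans (nmD _ _) _; rewrite (splitr e); apply: ler_ltD; last exact: HN2.
apply: le_trans (nm_sum _ _ _) _; apply: le_trans (ltW Hl).
apply: le_trans (ler_norm _).
have [N0|N0] := posnP N; first by rewrite N0 big_geq// subr_ge0 -N0.
apply: (@le_trans _ _ (\sum_(0 <= m < N) (l - bs N) / N%:R)).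
  by apply: ler_sum => m _; rewrite ler_pdivlMr ?ltr0n// mulrC.
by rewrite sumr_const_nat subn0 -(mulr_natr (_ / _) N) divfK// pnatr_eq0 -lt0n.
Qed.

Lemma csum_sparse m (F : nat -> C) (l : C) : (0 < m)%N -> csum (fun n => F n.+1) l ->
  csum (fun k => if (m %| k)%N && (0 < k)%N then F (k %/ m)%N else 0) l.
Proof.
move=> m0 /csumE/seq_cvgCP H.
pose u k : C := if (m %| k)%N && (0 < k)%N then F (k %/ m)%N else 0.
change (csum u l).
have E K : series u K.+1 = series (fun n => F n.+1) (K %/ m)%N.
  elim: K => [|K ih].
    by rewrite div0n /series /= big_nat1 big_geq// /u andbF.
  rewrite divnS//; have -> : series u K.+2 = series u K.+1 + u K.+1.
    by rewrite /series /= big_nat_recr.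
  rewrite ih /u andbT divnS//; case: (m %| K.+1)%N; last by rewrite addr0 add0n.
  by rewrite /series /= add1n big_nat_recr.
apply/csumE/seq_cvgCP => e /H[N HN]; exists (N * m).+1 => -[//|K]; rewrite ltnS => NK.
by rewrite E HN// leq_divRL.
Qed.

Lemma tame1 : tame (fun=> 1 : C).
Proof.
move=> r /andP[r0 r1]; exists 1 => n; rewrite nm1 mul1r.
by rewrite exprn_ile1// ltW.
Qed.

Lemma csum_geo v : nm v < 1 -> csum (fun n => v ^+ n.+1) (v / (1 - v)).
Proof.
move=> v1; have S := ps_csum tame1 v1.
set g := ps _ _ in S; have S1 : csum (fun n => v ^+ n) g by apply: csum_ext S => n; rewrite mul1r.
have S2 : csum (fun n => v ^+ n.+1) (v * g) by apply: csum_ext (csumZ v S1) => n; rewrite exprS.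
have := csum_unique S1 (proj1 (csum_shift (fun n => v ^+ n) _) S2); rewrite expr0 => gE.
suff -> : v / (1 - v) = v * g by [].
have d0 : 1 - v != 0 by rewrite subr_eq0; apply: contraTneq v1 => <-; rewrite nm1 ltxx.
have -> : g = (1 - v)^-1 by apply: (mulfI d0); rewrite mulfV// mulrBl mul1r {1}gE; ring.
by [].
Qed.

Lemma csum_pp v : nm v < 1 -> csum (fun n => n.+1%:R * v ^+ n.+1) (pp v).
Proof.
move=> v1; have S := ps_csum (tameMn tame1) v1.
set g := ps _ _ in S.
have S0 : csum (fun n => n%:R * v ^+ n) g by apply: csum_ext S => n; rewrite mulr1.
have S1 : csum (fun n => n.+1%:R * v ^+ n.+1) g.
  by apply: (proj2 (csum_shift (fun n => n%:R * v ^+ n) g)); rewrite mul0r add0r.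
suff -> : pp v = g by [].
have S2 : csum (fun n => n%:R * v ^+ n.+1) (v * g).
  by apply: csum_ext (csumZ v S0) => n; rewrite exprS; ring.
have := csumB S1 S2 => S3.
have S4 : csum (fun n => v ^+ n.+1) (g - v * g).
  by apply: csum_ext S3 => n; rewrite -natr1; ring.
have := csum_unique S4 (csum_geo v1) => gE.
have d0 : 1 - v != 0 by rewrite subr_eq0; apply: contraTneq v1 => <-; rewrite nm1 ltxx.
have {}gE : g * (1 - v) = v / (1 - v) by rewrite -gE; ring.
by apply: (mulIf d0); rewrite gE /pp; field.
Qed.

(** The sum-of-divisors function, extended by 0 at 0. *)
Definition divsum (k : nat) : nat := \sum_(m < k.+1 | (m %| k)%N && (0 < k)%N) m.

Lemma divsum_dual k : divsum k = (\sum_(m < k.+1 | (m %| k) && (0 < k)) k %/ m)%N.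
Proof.
rewrite /divsum; case: (posnP k) => [->|k0]; first by rewrite !big_pred0// => i; rewrite andbF.
have h (i : 'I_k.+1) : (i %| k)%N -> (k %/ i <= k)%N by move=> _; exact: leq_div.
rewrite (reindex_onto (fun i : 'I_k.+1 => inord (k %/ i)) (fun i : 'I_k.+1 => inord (k %/ i))) /=.
  apply: eq_big => [i|i _]; last by rewrite inordK// ltnS leq_div.
  rewrite !andbT inordK ?ltnS ?leq_div//; apply/andP/idP => [[d1 /eqP E]|d].
    have := congr1 val E; rewrite /= inordK ?ltnS ?leq_div// => <-.
    apply/dvdnP; exists (k %/ i)%N; rewrite mulnC divnK//.
  split; first by apply/dvdnP; exists (nat_of_ord i); rewrite mulnC divnK.
  by apply/eqP/val_inj; rewrite /= inordK ?ltnS ?leq_div// divnA// mulKn.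
move=> i /andP[d _]; apply/val_inj; rewrite /= !inordK ?ltnS ?leq_div//.
by rewrite divnA// mulKn.
Qed.

Lemma divsum_le k : (divsum k <= k * k + k)%N.
Proof.
rewrite /divsum; apply: (@leq_trans (\sum_(m < k.+1) k)).
  by rewrite big_mkcond; apply: leq_sum => i _; case: ifP => // _; rewrite -ltnS.
by rewrite sum_nat_const card_ord mulSn addnC.
Qed.

Lemma tame_divsum : tame (fun k => (divsum k)%:R : C).
Proof.
have t1 := tameMn tame1; have t2 := tameD (tameMn t1) t1.
move=> r r01; have [M HM] := t2 r r01; exists M => n; apply: le_trans (HM n).
rewrite ler_wpM2r ?exprn_ge0//; first by case/andP : r01 => /ltW.
have -> : (n%:R * (n%:R * 1) + n%:R * 1 : C) = (n * n + n)%:R.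
  by rewrite natrD natrM; ring.
by rewrite !nm_nat ler_nat divsum_le.
Qed.

Lemma divsum_bound q : nm q < 1 -> exists B : R, forall n,
  series (fun k => k%:R * (k%:R * nm q ^+ k)) n <= B.
Proof.
move=> q1; have [S _ HS] := tame_sum (tameMn (tameMn tame1)) (nmq01 q1).
exists S => n; apply: le_trans (HS n); apply: ler_sum => k _.
by rewrite !nmM nm_nat nm1 mulr1 mulrA.
Qed.

(** The first series defines [E2], the second comes out of [zet]. Expanding both as sums of m q^(mn)
    and n q^(mn) and collecting powers of q gives the divisor sums; the second needs the symmetry
    [divsum_dual]. *)
Lemma lambert_csum q : nm q < 1 ->
  csum (fun m => m.+1%:R * q ^+ m.+1 / (1 - q ^+ m.+1)) (ps (fun k => (divsum k)%:R) q) /\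
  csum (fun m => pp (q ^+ m.+1)) (ps (fun k => (divsum k)%:R) q).
Proof.
move=> q1; have S := ps_csum tame_divsum q1; set S0 := ps _ _ in S *.
have [B HB] := divsum_bound q1.
have qm m : nm (q ^+ m.+1) < 1.
  by rewrite nmX exprn_ilt1 ?nm_ge0.
pose u1 m k : C := if (m %| k)%N && (0 < k)%N then m%:R * q ^+ k else 0.
pose u2 m k : C := if (m %| k)%N && (0 < k)%N then (k %/ m)%:R * q ^+ k else 0.
have bnd (c : nat -> nat -> nat) : (forall m k, (m %| k)%N -> (0 < k)%N -> (c m k <= k)%N) ->
    forall m k, nm (if (m %| k)%N && (0 < k)%N then (c m k)%:R * q ^+ k else 0) <= k%:R * nm q ^+ k.
  move=> hc m k; case: ifPn => [/andP[d k0]|_]; last by rewrite nm0 mulr_ge0 ?exprn_ge0 ?nm_ge0.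
  by rewrite nmM nm_nat nmX ler_wpM2r ?exprn_ge0 ?nm_ge0// ler_nat hc.
have zero (c : nat -> nat -> nat) m k : (k < m)%N ->
    (if (m %| k)%N && (0 < k)%N then (c m k)%:R * q ^+ k else 0) = 0.
  by move=> km; case: ifP => // /andP[d k0]; move: (dvdn_leq k0 d); rewrite leqNgt km.
have rows (x : nat -> C) (r : nat -> C) m : csum (fun n => x n.+1 * (q ^+ m.+1) ^+ n.+1) (r m) ->
    csum (fun k => if (m.+1 %| k)%N && (0 < k)%N then x (k %/ m.+1)%N * q ^+ k else 0) (r m).
  move=> hr; apply: csum_ext (csum_sparse (F := fun n => x n * (q ^+ m.+1) ^+ n) (ltn0Sn m) hr) => k.
  by case: ifP => // /andP[d _]; rewrite -exprM [(m.+1 * _)%N]mulnC divnK.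
have row0 (x : nat -> C) : csum (fun k => if (0 %| k)%N && (0 < k)%N then x k * q ^+ k else 0) 0.
  by apply: csum_ext (csum0 R) => -[|k]; rewrite ?andbF// dvd0n.
have cols (c : nat -> nat -> nat) : (forall k, (\sum_(m < k.+1 | (m %| k) && (0 < k)) c m k)%N = divsum k) ->
    csum (fun k => \sum_(m < k.+1) (if (m %| k)%N && (0 < k)%N then (c m k)%:R * q ^+ k else 0)) S0.
  move=> hc; apply: csum_ext S => k; rewrite -hc natr_sum big_distrl /= -big_mkcond/=.
  by apply: eq_bigr.
split.
  have H0 := @csum_rows u1 (fun k => k%:R * nm q ^+ k) B (fun m => m%:R * (q ^+ m / (1 - q ^+ m))) S0.
  have : csum (fun m => m%:R * (q ^+ m / (1 - q ^+ m))) S0.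
    apply: H0 => //.
    - exact: (zero (fun m _ => m)).
    - by apply: (bnd (fun m _ => m)) => m k d k0; exact: dvdn_leq.
    - move=> [|m]; first by rewrite mul0r; exact: (row0 (fun _ => 0%:R)).
      apply: (rows (fun=> m.+1%:R) (fun m => m.+1%:R * (q ^+ m.+1 / (1 - q ^+ m.+1)))).
      exact: csumZ (csum_geo (qm m)).
    exact: (cols (fun m _ => m)).
  move=> S1; have := proj2 (csum_shift (fun m => m%:R * (q ^+ m / (1 - q ^+ m))) S0).
  rewrite mul0r add0r => /(_ S1); apply: csum_ext => n; by rewrite mulrA.
have H0 := @csum_rows u2 (fun k => k%:R * nm q ^+ k) B (fun m => if m is m'.+1 then pp (q ^+ m) else 0) S0.
have : csum (fun m => if m is m'.+1 then pp (q ^+ m) else 0) S0.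
  apply: H0 => //.
  - exact: (zero (fun m k => k %/ m)%N).
  - by apply: (bnd (fun m k => k %/ m)%N) => m k d k0; exact: leq_div.
  - move=> [|m]; first exact: (row0 (fun k => (k %/ 0)%:R)).
    apply: (rows (fun n => n%:R) (fun m => pp (q ^+ m.+1))).
    exact: csum_pp.
  by apply: (cols (fun m k => k %/ m)%N) => k; rewrite divsum_dual.
move=> S1; have := proj2 (csum_shift (fun m => if m is m'.+1 then pp (q ^+ m) else 0) S0).
by rewrite add0r => /(_ S1).
Qed.

Lemma E2E tau : H tau -> E2 tau = 1 - 24%:R * ps (fun k => (divsum k)%:R) (qexp tau).
Proof.
move=> Ht; have [/csumE h _] := lambert_csum (nm_qexp_lt1 Ht).
by rewrite /E2 (cvg_lim _ h).
Qed.

Lemma isq_E2 : exists a, isq (@E2 R) a.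
Proof.
have fs : isq (fun tau => ps (fun k => (divsum k)%:R) (qexp tau)) (fun k => (divsum k)%:R).
  by split => //; exact: tame_divsum.
eexists; apply: (isq_eq (isqD (isq_cst 1) (isqZ (- 24%:R) fs))) => tau Ht.
by rewrite E2E// mulNr.
Qed.

Lemma E2_per tau (n : int) : H tau -> E2 (tau + n%:~R) = E2 tau.
Proof. by move=> Ht; have [a Ha] := isq_E2; exact: isq_per Ha Ht. Qed.

Lemma E2_pp tau : H tau -> exists2 P, csum (fun m => pp (qexp tau ^+ m.+1)) P & E2 tau = 1 - 24%:R * P.
Proof.
move=> Ht; exists (ps (fun k => (divsum k)%:R) (qexp tau)); last exact: E2E.
by have [] := lambert_csum (nm_qexp_lt1 Ht).
Qed.

Lemma E2_S tau : H tau -> E2 (- tau^-1) = tau ^+ 2 * E2 tau + 12%:R / twopii R * tau.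
Proof.
move=> Ht; have Ht' := H_inv Ht; have t0 := H_neq0 Ht; have i0 := twopii_neq0 R.
have [P h e] := E2_pp Ht; have [P' h' e'] := E2_pp Ht'.
have := lambert_S Ht h h'; rewrite -e -e' => E.
move: (E2 (- tau^-1)) (E2 tau) E => x y E.
have -> : x = tau ^+ 2 * (tau ^- 2 * x - y) + tau ^+ 2 * y by field.
by rewrite E; field; rewrite t0 i0.
Qed.

Lemma den_neq0 (c d : R) tau : H tau -> (c, d) != (0, 0) -> realC c * tau + realC d != 0.
Proof.
move=> Ht; apply: contra => /eqP E.
have := congr1 (@complex.Im R) E; rewrite cImD cImM /= mul0r !addr0 => /eqP.
have Y0 : complex.Im tau != 0 by rewrite gt_eqF//; exact: Ht.
rewrite mulf_eq0 (negbTE Y0) orbF => /eqP c0.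
have := congr1 (@complex.Re R) E; rewrite cReD cReM c0 /= !mul0r subr0 add0r => ->.
by [].
Qed.

Lemma den_int_neq0 (a b c d : int) tau : H tau -> a * d - b * c = 1 ->
  (c%:~R * tau + d%:~R : C) != 0.
Proof.
move=> Ht E; rewrite -!realC_int; apply: den_neq0 => //.
by apply/eqP => -[/eqP]; rewrite intr_eq0 => /eqP c0 /eqP; rewrite intr_eq0 => /eqP d0; move: E; rewrite c0 d0 !mulr0.
Qed.

Lemma E2_law (a b c d : int) tau : H tau -> a * d - b * c = 1 ->
  E2 ((a%:~R * tau + b%:~R) / (c%:~R * tau + d%:~R)) =
  (c%:~R * tau + d%:~R) ^+ 2 * E2 tau + 12%:R / twopii R * c%:~R * (c%:~R * tau + d%:~R).
Proof.
have [N] : exists N : nat, (absz c < N)%N by exists (absz c).+1.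
elim: N a b c d tau => // N ih a b c d tau cN Ht dt.
have i0 := twopii_neq0 R.
(* End of the Euclidean descent on |c|: here a = d = 1 or -1, and the matrix acts as the translation
   by b d. *)
have [c0|c0] := eqVneq c 0.
  have [dd ab] : d * d = 1 /\ a = d.
    move: dt; rewrite c0 mulr0 subr0 => dt; have := congr1 absz dt.
    rewrite abszM => /eqP; rewrite muln_eq1 => /andP[/eqP a1 _].
    have [a1'|a1'] : a = 1 \/ a = -1 by lia.
      by move: dt; rewrite a1' mul1r => ->.
    by move: dt; rewrite a1' mulN1r => /eqP; rewrite eqr_oppLR => /eqP ->.
  have d0 : (d%:~R : C) != 0 by rewrite intr_eq0; apply: contraPneq dd => ->.
  have d2 : (d%:~R : C) * d%:~R = 1 by rewrite -intrM dd.
  rewrite c0 !mul0r !add0r mulr0 mul0r addr0 ab expr2 d2 mul1r.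
  have -> : (d%:~R * tau + b%:~R) / d%:~R = tau + (b * d)%:~R.
    by apply: (mulIf d0); rewrite divfK// intrM mulrDl -mulrA d2; ring.
  exact: E2_per.
(* Euclidean division makes c n + d the remainder of d by c. With s = tau - n, the matrix with lower
   row (c n + d, - c) acts on -1/s as the original one acts on tau. *)
pose n : int := (- (d %/ c)%Z)%R.
have r1 : (absz (c * n + d)%R < absz c)%N.
  have -> : c * n + d = (d %% c)%Z by rewrite /n {2}(divz_eq d c); ring.
  have := modz_ge0 d c0; have := ltz_mod d c0.
  move: (d %% c)%Z => x; lia.
have dt' : (a * n + b) * (- c) - (- a) * (c * n + d) = 1 by rewrite -dt; ring.
pose s := tau + (- n)%:~R.
have Hs : H s by exact: HDint.
have s0 := H_neq0 Hs.
have Hi := H_inv Hs.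
have cN' : (absz (c * n + d)%R < N)%N by exact: leq_trans r1 _.
have := ih (a * n + b) (- a) (c * n + d) (- c) (- s^-1) cN' Hi dt'.
have den := den_int_neq0 Ht dt; have den' := den_int_neq0 Hi dt'.
have tE : tau = s + n%:~R by rewrite /s mulrNz subrK.
have E1 : (c * n + d)%:~R * (- s^-1) + (- c)%:~R = - (c%:~R * tau + d%:~R) / s.
  by rewrite tE intrD intrM mulrNz; field.
have E2' : (a * n + b)%:~R * (- s^-1) + (- a)%:~R = - (a%:~R * tau + b%:~R) / s.
  by rewrite tE intrD intrM mulrNz; field.
have -> : ((a * n + b)%:~R * (- s^-1) + (- a)%:~R) / ((c * n + d)%:~R * (- s^-1) + (- c)%:~R) =
  (a%:~R * tau + b%:~R) / (c%:~R * tau + d%:~R).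
  by rewrite E1 E2'; field; rewrite s0 den.
rewrite E1 => ->; rewrite (E2_S Hs).
have -> : E2 s = E2 tau by exact: E2_per.
rewrite tE in den *; move: (E2 _) => x; rewrite intrD intrM.
by field; rewrite s0 i0.
Qed.

End EisensteinTwo.

(** * Transformation laws of derivatives and of coefficients *)

Section DerivativeAlgebra.
Variable R : realType.
Local Notation C := (cplx R).
Implicit Types (f u v : C -> C) (t tau : C).
Local Notation H := (@upper_half R).

(** Unlike the equation [D f tau = d], this also carries differentiability, as the rules for sums,
    products and compositions require. *)
Definition isD f tau (d : C) := is_derive tau 1 f (twopii R * d).

Lemma isD_val f tau d : isD f tau d -> D f tau = d. Proof. exact: D_val. Qed.
Lemma isD_unique f tau d e : isD f tau d -> isD f tau e -> d = e.
Proof. by move=> /isD_val <- /isD_val <-. Qed.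
Lemma isD_eqH f h tau d : H tau -> (forall w, H w -> f w = h w) -> isD f tau d -> isD h tau d.
Proof. exact: is_derive_eqH. Qed.
Lemma isD_ext f h tau d : (forall w, f w = h w) -> isD f tau d -> isD h tau d.
Proof. by move=> /funext ->. Qed.
Lemma isD_cst (k : C) tau : isD (fun=> k) tau 0.
Proof. by rewrite /isD mulr0; exact: is_derive_cst. Qed.
Lemma isD_add u v tau du dv : isD u tau du -> isD v tau dv -> isD (fun t => u t + v t) tau (du + dv).
Proof. by rewrite /isD mulrDr => hu hv; exact: (is_deriveD hu hv). Qed.
Lemma isD_mul u v tau du dv : isD u tau du -> isD v tau dv ->
  isD (fun t => u t * v t) tau (u tau * dv + v tau * du).
Proof.
rewrite /isD => hu hv; apply: (is_derive_eq (is_deriveM hu hv)).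
change (u tau * (twopii R * dv) + v tau * (twopii R * du) = twopii R * (u tau * dv + v tau * du)); ring.
Qed.
Lemma isD_Z (k : C) u tau du : isD u tau du -> isD (fun t => k * u t) tau (k * du).
Proof.
move=> hu; have := isD_mul (isD_cst k tau) hu.
by rewrite mulr0 addr0.
Qed.
Lemma isD_sum n (u : 'I_n -> C -> C) (du : 'I_n -> C) tau : (forall i, isD (u i) tau (du i)) ->
  isD (fun t => \sum_(i < n) u i t) tau (\sum_(i < n) du i).
Proof.
elim: n u du => [|n ih] u du hu.
  rewrite big_ord0; apply: isD_ext (isD_cst 0 tau) => w; by rewrite big_ord0.
rewrite big_ord_recl; apply: isD_ext (isD_add (hu ord0) (ih _ _ (fun i => hu (lift ord0 i)))) => w.
by rewrite big_ord_recl.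
Qed.
Lemma isD_exp u tau n du : isD u tau du -> isD (fun t => u t ^+ n) tau (n%:R * u tau ^+ n.-1 * du).
Proof.
move=> hu; elim: n => [|n ih].
  rewrite !mul0r; apply: isD_ext (isD_cst 1 tau) => w; by rewrite expr0.
have := isD_mul hu ih.
have -> : u tau * (n%:R * u tau ^+ n.-1 * du) + u tau ^+ n * du = n.+1%:R * u tau ^+ n.+1.-1 * du.
  case: n {ih} => [|n] /=; first by rewrite expr0; ring.
  by rewrite -!natr1 !exprS; ring.
by apply: isD_ext => w; rewrite exprS.
Qed.
Lemma isD_comp f h tau (d e : C) : isD f (h tau) d -> is_derive tau 1 h e -> isD (fun t => f (h t)) tau (e * d).
Proof.
move=> hf hh; have := is_derive_compC hf hh; rewrite /isD.
by have -> : twopii R * d * e = twopii R * (e * d) by ring.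
Qed.

Lemma is_derive_affine (c d : C) tau : is_derive tau 1 (fun t => c * t + d) c.
Proof.
have h1 : is_derive tau (1 : C) (fun t : C => c * t) c.
  have := is_deriveZ c (is_derive_id tau (1 : C)).
  by rewrite [_ *: 1]mulr1.
have h2 : is_derive tau (1 : C) (fun=> d) 0 by exact: is_derive_cst.
by have := is_deriveD h1 h2; rewrite addr0.
Qed.

Definition smoothH f := forall n tau, H tau -> isD (iter n (@D R) f) tau (iter n.+1 (@D R) f tau).

Lemma smooth_isq f a : isq f a -> smoothH f.
Proof. by move=> fa n tau Ht; have [b hb] := isq_iterD n fa; exact: isq_D_derive hb Ht. Qed.

Section Mobius.
Variable g : 'M[int]_2.
Hypothesis dg : \det g = 1.
Local Notation a := (g 0 0). Local Notation b := (g 0 1).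
Local Notation c := (g 1 0). Local Notation d := (g 1 1).

Lemma det2 : a * d - b * c = 1.
Proof.
rewrite -dg (expand_det_row _ ord0) !big_ord_recl big_ord0 /cofactor !det_mx11 !mxE /=.
have e1 : lift ord0 ord0 = 1 :> 'I_2 by exact/val_inj.
have e2 : lift (lift ord0 ord0) ord0 = 0 :> 'I_2 by exact/val_inj.
have e0 : ord0 = 0 :> 'I_2 by exact/val_inj.
rewrite ?e2 ?e1 ?e0 /=; ring.
Qed.

Definition J tau : C := c%:~R * tau + d%:~R.
Definition M tau : C := (a%:~R * tau + b%:~R) / J tau.
(* Normalised so that [D X = X^2] and [D (J^s) = - s X J^s]. *)
Definition X tau : C := - (c%:~R / (twopii R * J tau)).

Lemma denomE tau : denomSL2 (map_mx intr g) tau = J tau.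
Proof. by rewrite /denomSL2 /J !mxE !realC_int. Qed.
Lemma moebiusE tau : moebius (map_mx intr g) tau = M tau.
Proof. by rewrite /moebius denomE !mxE !realC_int. Qed.

Lemma J_neq0 tau : H tau -> J tau != 0.
Proof. by move=> Ht; exact: den_int_neq0 Ht det2. Qed.

Lemma Im_J tau : complex.Im (J tau) = c%:~R * complex.Im tau.
Proof. by rewrite /J -!realC_int cImD cImM /= mul0r !addr0. Qed.

Lemma H_M tau : H tau -> H (M tau).
Proof.
move=> Ht; have J0 := J_neq0 Ht; have Y0 : 0 < complex.Im tau by exact: Ht.
have dt : (a%:~R * d%:~R - b%:~R * c%:~R : C) = 1 by rewrite -!intrM -intrB det2.
have [c0|c0] := eqVneq c 0.
  have d0 : (d%:~R : C) != 0 by move: J0; rewrite /J c0 mul0r add0r.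
  have ad : (a%:~R * d%:~R : C) = 1 by move: dt; rewrite c0 mulr0 subr0.
  have -> : M tau = a%:~R * a%:~R * tau + (a * b)%:~R.
    rewrite /M /J c0 mul0r add0r; apply: (mulIf d0); rewrite divfK// intrM.
    transitivity ((a%:~R * d%:~R) * (a%:~R * tau + b%:~R) : C); first by rewrite ad mul1r.
    ring.
  have a0 : (a%:~R : R) != 0.
    by rewrite intr_eq0; apply: contra_eq_neq ad => ->; rewrite mul0r eq_sym oner_neq0.
  rewrite /upper_half /= cImD -!realC_int -realCM cImM /= mul0r !addr0.
  by rewrite mulr_gt0// -expr2 exprn_even_gt0.
have cC : (c%:~R : C) != 0 by rewrite intr_eq0.
have -> : M tau = - (c%:~R * J tau)^-1 + a%:~R / c%:~R.
  rewrite /M; have -> : (b%:~R : C) = (a%:~R * d%:~R - 1) / c%:~R.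
    by apply: (mulIf cC); rewrite divfK//; apply/eqP; rewrite eq_sym subr_eq addrC -subr_eq; apply/eqP.
  by move: J0; rewrite /J => J0; field; rewrite J0 cC.
have ac : complex.Im (a%:~R / c%:~R : C) = 0 by rewrite -!realC_int -realCV -realCM.
rewrite /upper_half /= cImD ac addr0 Im_inv.
rewrite divr_gt0 ?exprn_gt0 ?nm_gt0 ?mulf_neq0//.
rewrite -(realC_int R c) cImM Im_J /= mul0r addr0 mulrA mulr_gt0// -expr2 exprn_even_gt0//=.
by rewrite intr_eq0.
Qed.

Lemma is_derive_J tau : is_derive tau 1 J c%:~R. Proof. exact: is_derive_affine. Qed.

Lemma isD_cpowJ (s : R) tau : H tau ->
  isD (fun t => cpow (J t) s) tau (- (realC s * X tau * cpow (J tau) s)).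
Proof.
move=> Ht; have J0 := J_neq0 Ht; have i0 := twopii_neq0 R.
(* If c = 0 then J is a real constant, possibly negative and so on the cut of the logarithm, but its
   power is constant. *)
have [c0|c0] := eqVneq c 0.
  have -> : X tau = 0 by rewrite /X c0 mul0r oppr0.
  rewrite mulr0 mul0r oppr0.
  by apply: isD_ext (isD_cst (cpow (d%:~R : C) s) tau) => w; rewrite /J c0 mul0r add0r.
have IJ : complex.Im (J tau) != 0.
  by rewrite Im_J mulf_neq0 ?intr_eq0// gt_eqF//; exact: Ht.
have h := is_derive_compC (is_derive_cpow s IJ) (is_derive_J tau).
rewrite /isD; apply: (is_derive_eq h).
by rewrite /X; move: (cpow _ _) => x; field; rewrite i0 J0.
Qed.

Lemma isD_X tau : H tau -> isD X tau (X tau ^+ 2).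
Proof.
move=> Ht; have J0 := J_neq0 Ht; have i0 := twopii_neq0 R.
have h : isD (fun t => - (c%:~R / twopii R) * cpow (J t) (-1)) tau (X tau ^+ 2).
  have := isD_Z (- (c%:~R / twopii R)) (isD_cpowJ (-1) Ht).
  have -> : cpow (J tau) (-1) = (J tau)^-1 by rewrite cpowN (cpow_nat 1 J0) expr1.
  suff -> : - (c%:~R / twopii R) * - (realC (-1) * X tau * (J tau)^-1) = X tau ^+ 2 by [].
  by rewrite realCN realC1 /X; field; rewrite i0 J0.
apply: (isD_eqH Ht) h => w Hw; have Jw := J_neq0 Hw.
by rewrite cpowN (cpow_nat 1 Jw) expr1 /X; field; rewrite i0 Jw.
Qed.

Lemma isD_M f tau (e : C) : H tau -> isD f (M tau) e -> isD (fun t => f (M t)) tau (cpow (J tau) (-2) * e).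
Proof.
move=> Ht hf; have J0 := J_neq0 Ht; apply: isD_comp => //.
have dt : (a%:~R * d%:~R - b%:~R * c%:~R : C) = 1 by rewrite -!intrM -intrB det2.
rewrite cpowN (cpow_nat 2 J0).
have hJ := is_derive_J tau.
have hV : is_derive tau 1 (fun t => (J t)^-1) (- (J tau ^- 2) * c%:~R).
  split; first by apply: derivableV => //; case: hJ.
  by case: hJ => hJ1 hJ2; rewrite deriveV// hJ2.
apply: (is_derive_eq (is_deriveM (is_derive_affine a%:~R b%:~R tau) hV)).
change ((a%:~R * tau + b%:~R) * (- J tau ^- 2 * c%:~R) + (J tau)^-1 * a%:~R = J tau ^- 2).
transitivity ((a%:~R * d%:~R - b%:~R * c%:~R) * J tau ^- 2 : C); last by rewrite dt mul1r.
by move: J0; rewrite /J => J0; field.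
Qed.

End Mobius.
End DerivativeAlgebra.

(** * Iterated derivatives under a Moebius map, and the law of MLDO coefficients *)

Section Laws.
Variable R : realType.
Local Notation C := (cplx R).
Implicit Types (f phi : C -> C) (t tau : C).
Local Notation H := (@upper_half R).

Definition poch (x : R) m : R := \prod_(t < m) (x + t%:R).

Lemma poch0 x : poch x 0 = 1. Proof. by rewrite /poch big_ord0. Qed.
Lemma pochSr x m : poch x m.+1 = poch x m * (x + m%:R).
Proof. by rewrite /poch big_ord_recr. Qed.
Lemma pochSl x m : poch x m.+1 = x * poch (x + 1) m.
Proof.
rewrite /poch big_ord_recl addr0; congr (_ * _); apply: eq_bigr => i _.
by rewrite lift0 -natr1; ring.
Qed.
Lemma pochD x m n : poch x (m + n) = poch x m * poch (x + m%:R) n.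
Proof.
elim: n => [|n ih]; first by rewrite addn0 poch0 mulr1.
by rewrite addnS !pochSr ih natrD -mulrA addrA.
Qed.

(* [coef k r i] is the coefficient of [X^(r-i) D^i f] in [D^r (f|_k g)]. *)
Definition coef (k : R) (r i : nat) : R := 'C(r, i)%:R * poch (k + i%:R) (r - i).

Lemma coef_gt k r i : (r < i)%N -> coef k r i = 0.
Proof. by move=> ri; rewrite /coef bin_small// mul0r. Qed.
Lemma coef_diag k r : coef k r r = 1.
Proof. by rewrite /coef binn subnn poch0 mulr1. Qed.

Lemma coefS0 k r : coef k r.+1 0 = (r%:R + 0%:R + k) * coef k r 0.
Proof. by rewrite /coef !bin0 !subn0 pochSr; ring. Qed.
Lemma coefSS k r i : (i <= r)%N ->
  coef k r.+1 i.+1 = (r%:R + i.+1%:R + k) * coef k r i.+1 + coef k r i.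
Proof.
rewrite leq_eqVlt => /orP[/eqP ->|ir].
  by rewrite !coef_diag coef_gt// mulr0 add0r.
have rE : (r - i = (r - i.+1).+1)%N by lia.
rewrite /coef subSS rE pochSr pochSl binS natrD.
have kE : k + i.+1%:R = k + i%:R + 1 by rewrite -natr1; ring.
rewrite kE; set P := poch _ _.
have mE : (r - i.+1)%:R = r%:R - i%:R - 1 :> R by rewrite natrB// -natr1; ring.
rewrite mE.
have h : (i%:R + 1) * 'C(r, i.+1)%:R = (r%:R - i%:R) * 'C(r, i)%:R :> R.
  by rewrite natr1 -natrM mul_bin_left natrM natrB// ltnW.
rewrite -natr1.
move: ('C(r, i)%:R) ('C(r, i.+1)%:R) (i%:R) (r%:R) h => x y i' r' h.
have h' : (r' - i') * x * P - (i' + 1) * y * P = 0 by rewrite h subrr.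
apply/eqP; rewrite -subr_eq0 -h'; apply/eqP; ring.
Qed.

(** One differentiation, collected by powers of Y. It serves twice: with Y = X for a slashed
    function and with Y = - X for a quasimodular one. *)
Lemma coef_step (k : R) r (Y : C) (t : nat -> C) :
  \sum_(i < r.+1) realC (coef k r i) * (realC (r%:R + i%:R + k) * (Y ^+ (r - i).+1 * t i) + Y ^+ (r - i) * t i.+1)
  = \sum_(i < r.+2) realC (coef k r.+1 i) * (Y ^+ (r.+1 - i) * t i).
Proof.
rewrite [RHS]big_ord_recl subn0 coefS0.
under [in RHS]eq_bigr => i _ do rewrite lift0 subSS coefSS -1?ltnS// realCD mulrDl realCM.
rewrite big_split /= [X in _ = _ + (X + _)]big_ord_recr /= (coef_gt k (ltnSn r)) realC0 mulr0 mul0r addr0 addrA.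
under [LHS]eq_bigr => i _ do rewrite mulrDr.
rewrite big_split /=; congr (_ + _).
rewrite big_ord_recl subn0 realCM addr0; congr (_ + _); first by rewrite /= ?addr0; ring.
rewrite ?addr0; apply: eq_bigr => i _; rewrite lift0 /=.
have -> : (r - i.+1).+1 = (r - i)%N by have := ltn_ord i; lia.
by ring.
Qed.

Section Mobius.
Variable g : 'M[int]_2.
Hypothesis dg : \det g = 1.
Local Notation J := (@J R g).
Local Notation M := (@M R g).
Local Notation X := (@X R g).
Local Notation G := (map_mx intr g : 'M[R]_2).

(** In the induction, X^(r - i) contributes r - i and J^(-(k + 2i)) contributes k + 2i; their sum is
    the factor r + i + k of [coef_step]. *)
Lemma slash_iterD (k : R) f : smoothH f -> forall r tau, H tau ->
  iter r (@D R) (slash k f G) tau =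
  \sum_(i < r.+1) realC (coef k r i) *
    (X tau ^+ (r - i) * (cpow (J tau) (- (k + 2 * i%:R)) * iter i (@D R) f (M tau))).
Proof.
move=> sf; elim=> [|r ih] tau Ht.
  rewrite big_ord_recl big_ord0 addr0 coef_diag realC1 expr0 !mul1r mulr0 addr0 /=.
  by rewrite /slash denomE moebiusE.
rewrite iterS (D_eqH ih Ht).
pose t i := cpow (J tau) (- (k + 2 * i%:R)) * iter i (@D R) f (M tau).
rewrite -(coef_step k r (X tau) t); apply: isD_val.
apply: isD_sum => i; apply: isD_Z.
have h1 := isD_exp (r - i) (isD_X dg Ht).
have h2 := isD_cpowJ dg (- (k + 2 * i%:R)) Ht.
have h3 := isD_M dg Ht (sf i _ (H_M dg Ht)).
have h4 := isD_mul h1 (isD_mul h2 h3).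
apply: (is_derive_eq h4); congr (_ * _); rewrite /t.
have -> : cpow (J tau) (- (k + 2 * i.+1%:R)) = cpow (J tau) (- (k + 2 * i%:R)) * cpow (J tau) (-2).
  by rewrite -cpowD; congr cpow; rewrite -natr1; ring.
have iE : (i <= r)%N by rewrite -ltnS.
have -> : realC (r%:R + i%:R + k) = (r - i)%:R + realC (k + 2 * i%:R).
  by rewrite -(realC_nat R) -realCD natrB//; congr realC; ring.
rewrite realCN.
move: (cpow _ _) (cpow _ _) (iter i _ _ _) (iter i.+1 _ _ _) (realC _) (X tau) => p1 p2 f1 f2 w x.
case: (r - i)%N => [|s]; first by rewrite /= !expr0 expr1; ring.
by rewrite /= !exprS; ring.
Qed.

(** The induction differentiates both sides of the law. On the inhomogeneous term, J^(l + 2m)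
    contributes l + 2m and (- X)^(m + 1) contributes -(m + 1), whence the factors l - 1 + m of
    [poch (l - 1)]. *)
Lemma iterD_law (l : R) (e : C) phi : smoothH phi ->
  (forall tau, H tau -> phi (M tau) = cpow (J tau) l * (phi tau + e * - X tau)) ->
  forall m tau, H tau -> iter m (@D R) phi (M tau) =
    cpow (J tau) (l + 2 * m%:R) *
    (\sum_(i < m.+1) realC (coef l m i) * ((- X tau) ^+ (m - i) * iter i (@D R) phi tau)
     + e * realC (poch (l - 1) m) * (- X tau) ^+ m.+1).
Proof.
move=> sphi law; elim=> [|m ih] tau Ht.
  rewrite big_ord_recl big_ord0 addr0 coef_diag realC1 expr0 !mul1r mulr0 addr0 /= poch0 realC1 mulr1 expr1.
  exact: law.
have hX := isD_X dg Ht.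
have hY : isD (fun t => - X t) tau (- (X tau ^+ 2)).
  by have := isD_Z (-1) hX; rewrite mulN1r; apply: isD_ext => w; rewrite mulN1r.
have hJ := isD_cpowJ dg (l + 2 * m%:R) Ht.
have h1 := isD_M dg Ht (sphi m _ (H_M dg Ht)).
have h2 := isD_eqH Ht ih h1.
have h3 := isD_mul hJ (isD_add
  (isD_sum (fun i : 'I_m.+1 => isD_Z (realC (coef l m i)) (isD_mul (isD_exp (m - i) hY) (sphi i _ Ht))))
  (isD_Z (e * realC (poch (l - 1) m)) (isD_exp m.+1 hY))).
have := isD_unique h2 h3.
have -> : cpow (J tau) (l + 2 * m.+1%:R) = cpow (J tau) (l + 2 * m%:R) * cpow (J tau) 2.
  by rewrite -cpowD; congr cpow; rewrite -natr1; ring.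
rewrite -(coef_step l m (- X tau) (fun i => iter i (@D R) phi tau)).
rewrite pochSr realCM.
set S := \sum_(i < m.+1) realC (coef l m i) * ((- X tau) ^+ (m - i) * iter i (@D R) phi tau).
set S1 := \sum_(i < m.+1) _; set S2 := \sum_(i < m.+1) _ => E.
have S12 : S2 = S1 + realC (l + 2 * m%:R) * - X tau * S.
  rewrite /S /S1 /S2 big_distrr -big_split /=; apply: eq_bigr => i _.
  have iE : (i <= m)%N by rewrite -ltnS.
  have -> : realC (m%:R + i%:R + l) = realC (l + 2 * m%:R) - (m - i)%:R.
    by rewrite -(realC_nat R) -realCN -realCD natrB//; congr realC; ring.
  move: (D _ _) (iter i _ _ _) (realC _) (realC _) (X tau) => f2 f1 w z x.
  case: (m - i)%N => [|s]; first by rewrite /= !expr0 expr1; ring.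
  by rewrite /= !exprS; ring.
have j2 : cpow (J tau) 2 * cpow (J tau) (-2) = 1 by rewrite -cpowD subrr cpow0.
rewrite -[iter m.+1 _ _ _]mul1r -j2 -mulrA E S12.
have -> : realC (l - 1 + m%:R) = realC (l + 2 * m%:R) - m.+1%:R.
  by rewrite -(realC_nat R) -realCN -realCD -natr1; congr realC; ring.
rewrite /= !exprS; clear E S12 S2; clearbody S S1; clear - S S1.
move: (realC (l + _)) (cpow _ (l + _)) (cpow _ _) (realC (poch _ _)) (X tau) (m.+1%:R : C) => w p1 p2 z x m1.
ring.
Qed.

Definition monom (w0 : C) j : C -> C := fun z => twopii R ^+ j / (j`!)%:R * (z - w0) ^+ j.

Lemma isD_monomS w0 j z : isD (monom w0 j.+1) z (monom w0 j z).
Proof.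
have i0 := twopii_neq0 R.
have h0 : isD (fun z => z - w0) z (twopii R)^-1.
  rewrite /isD mulfV//; have h1 := is_derive_id z (1 : C).
  by have := is_deriveB h1 (is_derive_cst w0 z (1 : C)); rewrite subr0.
have := isD_Z (twopii R ^+ j.+1 / (j.+1)`!%:R) (isD_exp j.+1 h0).
have -> : twopii R ^+ j.+1 / (j.+1)`!%:R * (j.+1%:R * (z - w0) ^+ j.+1.-1 / twopii R) = monom w0 j z.
  have j0 : (j.+1%:R : C) != 0 by rewrite pnatr_eq0.
  have f0 : (j`!%:R : C) != 0 by rewrite pnatr_eq0 -lt0n fact_gt0.
  rewrite /monom factS natrM exprS /=; move: (j.+1%:R : C) (j`!%:R : C) j0 f0 => x y x0 y0.
  by field; rewrite i0 x0 y0.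
exact.
Qed.
Lemma isD_monom0 w0 z : isD (monom w0 0) z 0.
Proof.
apply: isD_ext (isD_cst 1 z) => w.
by rewrite /monom !expr0 fact0 divr1 mulr1.
Qed.

Lemma D_monom w0 j : D (monom w0 j) = if j is j'.+1 then monom w0 j' else fun=> 0.
Proof.
apply/funext => z; case: j => [|j]; first exact: isD_val (isD_monom0 w0 z).
exact: isD_val (isD_monomS w0 j z).
Qed.

Lemma iterD_monom w0 i j : iter i (@D R) (monom w0 j) = if (i <= j)%N then monom w0 (j - i) else fun=> 0.
Proof.
elim: i => [|i ih]; first by rewrite subn0.
rewrite iterS ih; case: (ltngtP i j) => [ij|ij|->].
- have -> : (j - i = (j - i.+1).+1)%N by lia.
  by rewrite D_monom.
- by apply/funext => z; exact: isD_val (isD_cst 0 z).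
by rewrite subnn D_monom.
Qed.

Lemma monom_center w0 j : monom w0 j w0 = (j == 0%N)%:R.
Proof.
rewrite /monom subrr expr0n; case: j => [|j]; last by rewrite mulr0.
by rewrite expr0 fact0 divr1 mulr1.
Qed.

Lemma iterD_monom_center w0 i j : iter i (@D R) (monom w0 j) w0 = (i == j)%:R.
Proof.
rewrite iterD_monom; case: ifP => [ij|ij]; last by case: eqP ij => // ->; rewrite leqnn.
by rewrite monom_center subn_eq0 eqn_leq ij.
Qed.

Lemma smooth_monom w0 j : smoothH (monom w0 j).
Proof.
move=> n tau _; rewrite iterS iterD_monom; case: ifP => nj.
  rewrite D_monom; case: (j - n)%N => [|m]; [exact: isD_monom0|exact: isD_monomS].
by have := isD_cst 0 tau; rewrite /isD => h; rewrite (isD_val h).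
Qed.

(** The test function is centred at the image point [M tau], where every iterated derivative
    occurring on either side is evaluated; only the j-th survives. *)
Lemma mldo_law (k : R) (K : int) (L : diffop R) : is_MLDO k K L ->
  forall tau j, H tau -> (j < size L)%N ->
  dcoef L j (M tau) = cpow (J tau) (K%:~R - 2 * j%:R) *
    \sum_(r < size L) realC (coef k r j) * (X tau ^+ (r - j) * dcoef L r tau).
Proof.
move=> [_ HL] tau j Ht jL.
have sf := smooth_monom (M tau) j.
have hf : holomorphicH (monom (M tau) j) by move=> w Hw; have [] := sf 0%N w Hw.
have G1 : Gamma1 G by exists g.
have := HL _ _ tau hf G1 Ht.
rewrite /slash denomE moebiusE -/(slash k (monom (M tau) j) G) /dapply.
have -> : \sum_(r < size L) dcoef L r (M tau) * iter r (@D R) (monom (M tau) j) (M tau) = dcoef L j (M tau).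
  rewrite (bigD1 (Ordinal jL))//= iterD_monom_center eqxx mulr1 big1 ?addr0// => r rj.
  rewrite iterD_monom_center; case: eqP => [rj'|_]; last by rewrite mulr0.
  by case/eqP: rj; exact/val_inj.
have -> : \sum_(r < size L) dcoef L r tau * iter r (@D R) (slash k (monom (M tau) j) G) tau =
   cpow (J tau) (- (k + 2 * j%:R)) * \sum_(r < size L) realC (coef k r j) * (X tau ^+ (r - j) * dcoef L r tau).
  rewrite big_distrr /=; apply: eq_bigr => r _; rewrite (slash_iterD k sf)//.
  have [rj|jr] := ltnP r j.
    rewrite coef_gt// realC0 mul0r mulr0 big1 ?mulr0// => i _.
    rewrite iterD_monom_center; case: eqP => [ij|_]; last by rewrite !mulr0.
    by move: (ltn_ord i); rewrite ij ltnS leqNgt rj.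
  have jr' : (j < r.+1)%N by [].
  rewrite (bigD1 (Ordinal jr'))//= iterD_monom_center eqxx big1 => [|i ij].
    by rewrite addr0 mulr1; ring.
  rewrite iterD_monom_center; case: eqP => [ij'|_]; last by rewrite !mulr0.
  by case/eqP: ij; exact/val_inj.
move=> E.
have c0 := cpow_neq0 (J tau) (- (k + K%:~R)).
apply: (mulfI c0); rewrite -E mulrA -cpowD; congr (cpow _ _ * _); ring.
Qed.

End Mobius.
End Laws.

(** * Rankin-Cohen brackets and the Kaneko-Koike operator *)

Section Structure.
Variable R : realType.
Local Notation C := (cplx R).
Implicit Types (f phi : C -> C) (t tau : C) (k l : R) (A : nat -> C -> C).
Local Notation H := (@upper_half R).

Lemma gbinom_poch k n m : (m <= n)%N -> gbinom (n%:R + k - 1) m = poch (k + (n - m)%:R) m / (m`!)%:R.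
Proof.
move=> mn; rewrite /gbinom /poch (reindex_inj rev_ord_inj) /=; congr (_ / _).
apply: eq_bigr => i _; have im := ltn_ord i.
have -> : n%:R = (n - m)%:R + (m - i.+1)%:R + i%:R + 1 :> R by rewrite -!natrD natr1; congr (_%:R); lia.
ring.
Qed.

Definition rc_coef k l n phi j : C -> C := fun tau =>
  (-1) ^+ j * realC (gbinom (n%:R + k - 1) (n - j) * gbinom (n%:R + l - 1) j) * iter (n - j) (@D R) phi tau.

Lemma RC_coefE k l n f phi tau : RC k l n f phi tau = \sum_(r < n.+1) rc_coef k l n phi r tau * iter r (@D R) f tau.
Proof. by apply: eq_bigr => i _; rewrite /rc_coef mulrAC. Qed.

(** With p = n - i - j and every Pochhammer symbol split at p by [pochD], both sides consist of the
    same four symbols over p! i! j!. *)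
Lemma rc_coef_scalar k l n i j : (i + j <= n)%N ->
  gbinom (n%:R + k - 1) (n - j) * gbinom (n%:R + l - 1) j * coef l (n - j) i =
  coef k (n - i) j * (gbinom (n%:R + k - 1) i * gbinom (n%:R + l - 1) (n - i)).
Proof.
move=> ijn; pose p := (n - i - j)%N.
have e1 : (n - j = p + i)%N by rewrite /p; lia.
have e2 : (n - i = p + j)%N by rewrite /p; lia.
rewrite !gbinom_poch ?leq_subr//; try lia.
rewrite /coef !subKn; try lia.
rewrite e1 e2 !addnK !pochD.
have bE (a b : nat) : 'C(a + b, b)%:R = (a + b)`!%:R / (b`!%:R * a`!%:R) :> R.
  have h := bin_fact (leq_addl a b); rewrite addnK in h.
  by rewrite -h -natrM natrM mulfK// pnatr_eq0 -lt0n muln_gt0 !fact_gt0.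
rewrite !bE.
have fE (a : nat) : (a`!%:R : R) != 0 by rewrite pnatr_eq0 -lt0n fact_gt0.
have -> : k + (p + j)%:R = k + j%:R + p%:R by rewrite natrD; ring.
have -> : l + (p + i)%:R = l + i%:R + p%:R by rewrite natrD; ring.
move: (fE p) (fE i) (fE j) (fE (p + i)%N) (fE (p + j)%N).
move: (poch _ _) (poch _ _) (poch _ _) (poch _ _) (p`!%:R : R) (i`!%:R : R) (j`!%:R : R) ((p + i)`!%:R : R) ((p + j)`!%:R : R).
by move=> u1 u2 u3 u4 x1 x2 x3 x4 x5 y1 y2 y3 y4 y5; field; rewrite y1 y2 y3 y4 y5.
Qed.

(** Covers modular forms (e = 0) and E2 (l = 2, e = 12) at once, so that the brackets with both are
    transformed by one computation. *)
Definition quasimodular l (e : C) phi := forall g : 'M[int]_2, \det g = 1 -> forall tau, H tau ->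
  phi (M g tau) = cpow (J g tau) l * (phi tau + e * - X g tau).

(** For e = 0 this is the law of an intertwining operator. For E2 the last term is the obstruction,
    to be compensated by D^n in the Kaneko-Koike operator. *)
Lemma rc_coef_transform k l n phi e g tau j : smoothH phi -> quasimodular l e phi -> \det g = 1 -> H tau -> (j <= n)%N ->
  rc_coef k l n phi j (M g tau) = cpow (J g tau) (l + 2 * (n - j)%:R) *
    (\sum_(r < n.+1) realC (coef k r j) * (X g tau ^+ (r - j) * rc_coef k l n phi r tau)
     + (-1) ^+ j * realC (gbinom (n%:R + k - 1) (n - j) * gbinom (n%:R + l - 1) j)
       * (e * realC (poch (l - 1) (n - j)) * (- X g tau) ^+ (n - j).+1)).
Proof.
move=> sphi q dg Ht jn; rewrite [in LHS]/rc_coef (iterD_law dg sphi (q g dg))//.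
rewrite mulrCA mulrDr; congr (_ * (_ + _)).
rewrite [RHS](reindex_inj rev_ord_inj) /=.
have E : \sum_(i < (n - j).+1) realC (coef l (n - j) i) * ((- X g tau) ^+ (n - j - i) * iter i (@D R) phi tau)
   = \sum_(i < n.+1) realC (coef l (n - j) i) * ((- X g tau) ^+ (n - j - i) * iter i (@D R) phi tau).
  have nE : n.+1 = ((n - j).+1 + j)%N by lia.
  rewrite [in RHS]nE big_split_ord /= [Y in _ = _ + Y]big1 ?addr0// => i _.
  by rewrite coef_gt ?realC0 ?mul0r//; lia.
rewrite E big_distrr; apply: eq_bigr => -[i ilt] _ /=; rewrite subSS.
have [ijn|ijn] := leqP (i + j) n; last first.
  by rewrite [in LHS]coef_gt ?[in RHS]coef_gt; [rewrite realC0 !(mul0r, mulr0)|lia|lia].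
have iln : (i <= n)%N by [].
rewrite /rc_coef (subKn iln).
have -> : (n - j - i = n - i - j)%N by lia.
have sE : (-1) ^+ (n - i) = (-1) ^+ j * (-1) ^+ (n - i - j) :> C by rewrite -exprD; congr (_ ^+ _); lia.
rewrite sE (exprNn (X g tau)); have := rc_coef_scalar k l ijn.
move: (gbinom _ _) (gbinom _ _) (gbinom _ _) (gbinom _ _) (coef _ _ _) (coef _ _ _) => x1 x2 x3 x4 x5 x6 /(congr1 (@realC R)).
rewrite !realCM.
move: (X g tau ^+ _) (iter _ _ _ _) => xx d hE.
transitivity ((-1) ^+ j * (-1) ^+ (n - i - j) * xx * d * (realC x4 * realC x3 * realC x6)); first by ring.
by rewrite hE; ring.
Qed.

(* The law obeyed by the coefficients of an operator intertwining the weights [k] and [k + K]. *)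
Definition law k (K : int) N A := forall g : 'M[int]_2, \det g = 1 -> forall tau j, H tau -> (j < N)%N ->
  A j (M g tau) = cpow (J g tau) (K%:~R - 2 * j%:R) *
    \sum_(r < N) realC (coef k r j) * (X g tau ^+ (r - j) * A r tau).

Lemma lawB k K N A B (c : C) : law k K N A -> law k K N B -> law k K N (fun j tau => A j tau - c * B j tau).
Proof.
move=> hA hB g dg tau j Ht jN; rewrite (hA g dg)// (hB g dg)//.
rewrite mulrCA -mulrBr big_distrr -sumrB /=; congr (_ * _); apply: eq_bigr => r _.
by ring.
Qed.

Lemma law_drop k K N A : law k K N.+1 A -> (forall tau, H tau -> A N tau = 0) -> law k K N A.
Proof.
move=> hA A0 g dg tau j Ht jN; rewrite (hA g dg)//; last exact: ltnW.
by rewrite big_ord_recr /= A0// !mulr0 addr0.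
Qed.

Lemma law_trunc k K n N A : (n <= N)%N -> law k K N A ->
  (forall r tau, (n <= r)%N -> H tau -> A r tau = 0) -> law k K n A.
Proof.
move=> nN; rewrite -(subnK nN); elim: (N - n)%N => // m ih hA A0.
by apply: ih => //; apply: law_drop => // tau Ht; apply: A0 => //; exact: leq_addl.
Qed.

Lemma law_rc_coef k (K : int) n phi : smoothH phi -> quasimodular (K - 2 * n%:Z)%:~R 0 phi ->
  law k K n.+1 (rc_coef k (K - 2 * n%:Z)%:~R n phi).
Proof.
move=> sphi q g dg tau j Ht jn; rewrite (rc_coef_transform k sphi q dg Ht)// !mul0r mulr0 addr0.
congr (cpow _ _ * _); rewrite intrB intrM natrB//; ring.
Qed.

Lemma quasimodular_E2 : quasimodular 2 12%:R (@E2 R).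
Proof.
move=> g dg tau Ht; have J0 := J_neq0 dg Ht; have i0 := twopii_neq0 R.
rewrite (E2_law Ht (det2 dg)) -/(J g tau) (cpow_nat 2 J0) /X.
by move: (E2 tau) (J g tau) J0 => x y y0; field; rewrite i0 y0.
Qed.

(** The bracket is rewritten with f in its first slot, so that [rc_coef] applies; the exchange of
    arguments costs the sign (-1)^(n-1). *)
Definition kk_coef k n j : C -> C := fun tau =>
  if j == n then 1 else - realC ((k + n%:R - 1) / 12%:R) * ((-1) ^+ n.-1 * rc_coef k 2 n.-1 (@E2 R) j tau).

Lemma poch1 m : poch (1 : R) m = m`!%:R.
Proof.
elim: m => [|m ih]; first by rewrite poch0.
by rewrite pochSr ih factS mulnC natrM addrC natr1.
Qed.

(** For l = 2 the symbol [poch (l - 1)] is a factorial, and the obstruction left by E2 becomes the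
    coefficient that D^(m+1) contributes. This fixes the constant k + n - 1, with n = m + 1. *)
Lemma kk_coef_scalar k m j : (j <= m)%N ->
  (k + m%:R) * (gbinom (m%:R + k - 1) (m - j) * gbinom (m%:R + 2 - 1) j) * poch 1 (m - j) = coef k m.+1 j.
Proof.
move=> jm; rewrite !gbinom_poch ?leq_subr// poch1 subKn// /coef subSn// pochSr.
have -> : k + j%:R + (m - j)%:R = k + m%:R by rewrite natrB//; ring.
have -> : poch (2 + (m - j)%:R) j / j`!%:R = 'C(m.+1, j)%:R :> R.
  have h := bin_fact (leqW jm).
  have p : poch (1 : R) (m.+1 - j) * poch (2 + (m - j)%:R) j = m.+1`!%:R.
    rewrite -poch1 -[in RHS](subnK (leqW jm)) pochD; congr (_ * poch _ _).
    by rewrite subSn// -natr1; ring.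
  rewrite poch1 -h !natrM in p.
  have f1 : (j`!%:R : R) != 0 by rewrite pnatr_eq0 -lt0n fact_gt0.
  have f2 : ((m.+1 - j)`!%:R : R) != 0 by rewrite pnatr_eq0 -lt0n fact_gt0.
  by apply: (mulfI f2); rewrite mulrA p; field.
have f3 : ((m - j)`!%:R : R) != 0 by rewrite pnatr_eq0 -lt0n fact_gt0.
by move: (poch _ _) ('C(_, _)%:R) => x y; field.
Qed.

Lemma kk_coef_top k n tau : kk_coef k n n tau = 1. Proof. by rewrite /kk_coef eqxx. Qed.
Lemma kk_coef_lt k m j tau : (j < m.+1)%N ->
  kk_coef k m.+1 j tau = - realC ((k + m%:R) / 12%:R) * ((-1) ^+ m * rc_coef k 2 m (@E2 R) j tau).
Proof.
move=> jm; rewrite /kk_coef ltn_eqF//=; congr (- realC (_ / _) * _).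
by rewrite -natr1; ring.
Qed.

(** At j = n only the leading 1 remains. For j < n the inhomogeneous term of E2 equals the
    contribution of D^n by [kk_coef_scalar], the 12 of E2 cancelling the denominator. *)
Lemma law_kk_coef k n : law k (2 * n%:Z) n.+1 (kk_coef k n).
Proof.
move=> g dg tau j Ht; rewrite ltnS leq_eqVlt => /orP[/eqP ->|jn].
  rewrite big_ord_recr /= !kk_coef_top coef_diag realC1 subnn expr0 !mul1r.
  rewrite big1 ?add0r; last by move=> i _; rewrite coef_gt ?realC0 ?mul0r.
  by rewrite mulr1 intrM subrr cpow0.
case: n jn => // m jm; rewrite (kk_coef_lt _ _ jm).
have -> : (2 * m.+1%:Z)%:~R - 2 * j%:R = 2 + 2 * (m - j)%:R :> R.
  by rewrite natrB// intrM -[m.+1%:~R]/(m.+1%:R) -natr1; ring.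
have [a ha] := isq_E2 R.
rewrite (rc_coef_transform k (smooth_isq ha) quasimodular_E2 dg Ht)//.
rewrite [in RHS]big_ord_recr /= kk_coef_top mulr1.
under [in RHS]eq_bigr => i _ do rewrite (kk_coef_lt _ _ (ltn_ord i)).
have -> : \sum_(i < m.+1) realC (coef k i j) * (X g tau ^+ (i - j) *
     (- realC ((k + m%:R) / 12) * ((-1) ^+ m * rc_coef k 2 m (@E2 R) i tau))) =
  - realC ((k + m%:R) / 12) * (-1) ^+ m * \sum_(i < m.+1) realC (coef k i j) * (X g tau ^+ (i - j) *
     rc_coef k 2 m (@E2 R) i tau).
  by rewrite big_distrr; apply: eq_bigr => i _ /=; ring.
set S := \sum_(i < m.+1) realC _ * _.
have -> : 2 - 1 = 1 :> R by ring.
have pE : (m = (m - j) + j)%N by lia.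
have -> : (-1) ^+ m = (-1) ^+ (m - j) * (-1) ^+ j :> C by rewrite -exprD -pE.
rewrite (subSn (n := m))// (exprNn (X g tau)).
have := @kk_coef_scalar k m j jm.
move: (gbinom _ _ * gbinom _ _) (poch _ _) (coef _ _ _) => x1 x2 x3 /(congr1 (@realC R)).
rewrite !realCM realCV (realC_nat R 12) => hE; rewrite -hE.
have s1 : (-1) ^+ (m - j) * (-1) ^+ (m - j) = 1 :> C by rewrite -expr2 sqrr_sign.
have s2 : (-1) ^+ j * (-1) ^+ j = 1 :> C by rewrite -expr2 sqrr_sign.
rewrite [(-1) ^+ (m - j).+1]exprS.
move: (X g tau ^+ _) S ((-1) ^+ (m - j) : C) ((-1) ^+ j : C) s1 s2 => xx S u v s1 s2.
have e12 : 12%:R^-1 * 12%:R = 1 :> C by rewrite mulVf// pnatr_eq0.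
move: (12%:R : C) e12 (realC (k + _)) (realC x1) (realC x2) => z e12 y1 y2 y3.
transitivity (cpow (J g tau) (2 + 2 * (m - j)%:R) *
  (- (y1 / z) * (u * v) * S + (u * u) * (v * v) * (z^-1 * z) * (y1 * y2 * y3 * xx))).
  ring.
by rewrite s1 s2 e12 !mul1r.
Qed.

End Structure.

(** * The structure theorem *)

Section Main.
Variable R : realType.
Local Notation C := (cplx R).
Implicit Types (f phi : C -> C) (t tau : C) (k l : R) (A : nat -> C -> C).
Local Notation H := (@upper_half R).

Definition automorphic (l : int) phi := forall g : 'M[int]_2, \det g = 1 -> forall tau, H tau ->
  phi (M g tau) = cpow (J g tau) l%:~R * phi tau.

Lemma automorphic_quasimodular (l : int) phi : automorphic l phi -> quasimodular l%:~R 0 phi.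
Proof. by move=> h g dg tau Ht; rewrite h// mul0r addr0. Qed.

Lemma automorphic_modular (l : int) phi a : isq phi a -> automorphic l phi -> modular_form l phi.
Proof.
move=> ha hl; split; [exact: isq_holo ha| |by apply/cuspP; exists a].
move=> _ tau [g dg <-] Ht.
by rewrite /slash denomE moebiusE (hl g)// mulrA -cpowD addNr cpow0 mul1r.
Qed.

Definition S_mx : 'M[int]_2 := \matrix_(i, j) if i == j then 0 else if i == 0 then -1 else 1.

Lemma det_S_mx : \det S_mx = 1.
Proof.
rewrite (expand_det_row _ ord0) !big_ord_recl big_ord0 /cofactor !det_mx11 !mxE /=.
ring.
Qed.

Lemma M_S_mx tau : H tau -> M S_mx tau = - tau^-1.
Proof. by move=> _; rewrite /M /J !mxE /= mul0r add0r mul1r addr0 mulN1r. Qed.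
Lemma J_S_mx tau : J S_mx tau = tau.
Proof. by rewrite /J !mxE /= mul1r addr0. Qed.

Lemma automorphic_neg (l : int) phi a : isq phi a -> automorphic l phi -> l < 0 -> forall tau, H tau -> phi tau = 0.
Proof.
move=> ha hl l0; pose p := `|l|%N.
have lE : l = - p%:Z by rewrite /p; lia.
apply: (negative_weight (p := p) ha) => [tau Ht|]; last by rewrite /p; lia.
have := hl _ det_S_mx tau Ht; rewrite M_S_mx// J_S_mx => ->.
by rewrite lE intrN cpowN (cpow_nat p (H_neq0 Ht)) mulVKf// expf_neq0// H_neq0.
Qed.

Lemma automorphic0 phi a : isq phi a -> automorphic 0 phi -> forall tau, H tau -> phi tau = a 0%N.
Proof.
move=> ha hl; apply: (weight0_cst ha) => tau Ht.
by have := hl _ det_S_mx tau Ht; rewrite M_S_mx// J_S_mx cpow0 mul1r.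
Qed.

(** The law is triangular: [coef k r N] vanishes for r < N, so at the top index only the diagonal
    term is left. *)
Lemma law_top k K N A : law k K N.+1 A -> automorphic (K - 2 * N%:Z) (A N).
Proof.
move=> hA g dg tau Ht; rewrite (hA g dg)// big_ord_recr /= coef_diag realC1 subnn expr0 !mul1r.
rewrite big1 ?add0r; last by move=> i _; rewrite coef_gt ?realC0 ?mul0r.
by congr (cpow _ _ * _); rewrite intrB intrM.
Qed.

Definition isqs N A := forall r, (r < N)%N -> exists a, isq (A r) a.

Lemma isq_rc_coef k l n phi a j : isq phi a -> exists b, isq (rc_coef k l n phi j) b.
Proof. by move=> /(isq_iterD (n - j))[b hb]; eexists; exact: isqZ hb. Qed.

Lemma isq_kk_coef k n j : exists b, isq (kk_coef k n j) b.
Proof.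
rewrite /kk_coef; case: eqP => _; first by eexists; exact: isq_cst.
have [a ha] := isq_E2 R; have [b hb] := isq_rc_coef k 2 n.-1 j ha.
by eexists; exact: (isqZ _ (isqZ _ hb)).
Qed.

Lemma isqB_Z f h a b (c : C) : isq f a -> isq h b -> exists d, isq (fun t => f t - c * h t) d.
Proof.
move=> hf hh; eexists; apply: isq_eq (isqD hf (isqZ (- c) hh)) _ => t _ /=.
by rewrite mulNr.
Qed.

Lemma poch_gt0 (x : R) m : 0 < x -> 0 < poch x m.
Proof. by move=> x0; apply: prodr_gt0 => i _; rewrite ltr_wpDr ?ler0n. Qed.

(** The constant is [poch l n] / n! up to sign, a product of positive factors since l > 0. *)
Lemma rc_coef_top k l n phi : 0 < l -> exists2 c : C, c != 0 & forall tau, rc_coef k l n phi n tau = c * phi tau.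
Proof.
move=> l0; eexists; last by move=> tau; rewrite /rc_coef subnn /=.
rewrite mulf_neq0 ?signr_eq0// gbinom_poch// gbinom_poch// poch0 fact0 divr1 mul1r subnn addr0.
apply: contraTneq isT => /(congr1 (@complex.Re R)) /= /eqP.
by rewrite mulf_eq0 invr_eq0 pnatr_eq0 gtn_eqF ?fact_gt0// orbF gt_eqF// poch_gt0.
Qed.

Lemma RC_of_law k K N A : isqs N A -> law k K N A -> (forall r, (r < N)%N -> 0 < K - 2 * r%:Z) ->
  RC_combination k K (fun f tau => \sum_(r < N) A r tau * iter r (@D R) f tau).
Proof.
elim: N A => [|N ih] A qA hA NK.
  exists 0%N, (fun=> 0), (fun=> 0%N), (fun _ _ => 0); split; first by case.
  by move=> f tau _ _; rewrite !big_ord0.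
have [a ha] := qA N (ltnSn N); have hN := law_top hA.
set l : int := K - 2 * N%:Z in hN; have l0 : 0 < l by exact: NK.
have lR : 0 < l%:~R :> R by rewrite ltr0z.
have [c c0 cE] := rc_coef_top k N (A N) lR.
have [||r rN|M0 [u [r [g [hg hT]]]]] := ih (fun r tau => A r tau - c^-1 * rc_coef k l%:~R N (A N) r tau).
- move=> r rN; have [b hb] := qA r (ltnW rN); have [b' hb'] := isq_rc_coef k l%:~R N r ha.
  exact: isqB_Z hb hb'.
- apply: law_drop; last by move=> tau _; rewrite cE mulKf// subrr.
  by apply: lawB => //; apply: law_rc_coef (smooth_isq ha) (automorphic_quasimodular hN).
- by apply: NK; exact: ltnW.
pose ext (T : Type) (x : T) (y : 'I_M0 -> T) (i : 'I_M0.+1) := if unlift ord0 i is Some j then y j else x.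
exists M0.+1, (ext _ c^-1 u), (ext _ N r), (ext _ (A N) g); split.
  move=> i; rewrite /ext; case: unliftP => [j _|_]; first exact: hg.
  by split=> //; apply: automorphic_modular ha hN.
move=> f tau hf Ht; rewrite [RHS]big_ord_recl /ext unlift_none.
under [in RHS]eq_bigr => i _ do rewrite liftK.
rewrite -hT// -/l RC_coefE.
rewrite !big_ord_recr /= cE mulrDr -[c * _ * _]mulrA mulKf//.
rewrite addrAC; congr (_ + _); rewrite big_distrr -big_split /=; apply: eq_bigr => i _.
by ring.
Qed.

(** Trailing coefficients that vanish on the half-plane are discarded one by one; if nothing
    survives, the operator is zero and has no order. *)
Lemma order_exists (L : diffop R) : (exists n, has_order L n) \/ forall r tau, H tau -> dcoef L r tau = 0.
Proof.
have : forall r tau, (size L <= r)%N -> H tau -> dcoef L r tau = 0.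
  by move=> r tau Lr _; rewrite /dcoef nth_default.
elim: (size L) => [|N ih] hN; first by right => r tau; exact: hN.
have [[tau [Ht h]]|h] := pselect (exists tau, H tau /\ dcoef L N tau <> 0).
  by left; exists N; split; [exists tau|exact: hN].
apply: ih => r tau; rewrite leq_eqVlt => /orP[/eqP <-|]; last exact: hN.
by move=> Ht; apply: contrapT => h'; apply: h; exists tau.
Qed.

Lemma dapply_trunc (L : diffop R) n f tau : (n <= size L)%N ->
  (forall r, (n <= r)%N -> dcoef L r tau = 0) ->
  dapply L f tau = \sum_(r < n) dcoef L r tau * iter r (@D R) f tau.
Proof.
move=> nL h0; rewrite /dapply -(subnKC nL) big_split_ord /= [Y in _ + Y]big1 ?addr0// => i _.
by rewrite h0 ?mul0r// leq_addr.
Qed.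

(** Reindexing i to m - i turns the bracket with E2 first into the one with f first, up to (-1)^m;
    this is the sign in [kk_coef]. *)
Lemma kaneko_koikeE k n f tau :
  kaneko_koike k n f tau = iter n (@D R) f tau + \sum_(r < n) kk_coef k n r tau * iter r (@D R) f tau.
Proof.
case: n => [|m]; first by rewrite big_ord0 addr0.
rewrite /kaneko_koike; congr (_ + _).
under eq_bigr => i _ do rewrite (kk_coef_lt k tau (ltn_ord i)).
rewrite -mulNr /RC big_distrr [RHS](reindex_inj rev_ord_inj) /=; apply: eq_bigr => -[i ilt] _ /=.
have im : (i <= m)%N by [].
have -> : k + m.+1%:R - 1 = k + m%:R by rewrite -natr1; ring.
rewrite subSS /rc_coef subKn//.
have -> : (-1) ^+ i = (-1) ^+ m * (-1) ^+ (m - i) :> C.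
  by rewrite -exprD; apply/eqP; rewrite -signr_odd -[eqbRHS]signr_odd; apply/eqP; congr (_ ^+ _); lia.
move: (gbinom _ _) (gbinom _ _) => x1 x2; rewrite !realCM.
move: (iter _ _ (@E2 R) _) (iter _ _ f _) => u v.
by ring.
Qed.

End Main.

Theorem theorem2 (R : realType) (k : R) (K : int) (L : diffop R)
    (hL : is_MLDO k K L) :
  [/\ (forall n : nat, has_order L n -> 2 * n%:Z <= K),
      ((forall n : nat, has_order L n -> 2 * n%:Z <> K) ->
         RC_combination k K (dapply L))
    & (forall n : nat, has_order L n -> 2 * n%:Z = K ->
         exists (c : cplx R) (T : (cplx R -> cplx R) -> cplx R -> cplx R),
           RC_combination k K T /\
           forall f tau, holomorphicH f -> upper_half tau ->
             dapply L f tau = T f tau + c * kaneko_koike k n f tau)].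
Proof.
have qL : isqs (size L) (dcoef L) by move=> r rL; have [/(_ r rL)[_ /cuspP]] := hL.
have law0 : law k K (size L) (dcoef L) by move=> g dg tau j Ht jL; exact: (mldo_law dg hL).
have lawn n : has_order L n -> (n < size L)%N /\ law k K n.+1 (dcoef L).
  move=> [[tau [Ht h]] h0]; suff nL : (n < size L)%N.
    by split=> //; apply: law_trunc law0 _ => // r t; exact: h0.
  by rewrite ltnNge; apply/negP => Ln; apply: h; rewrite /dcoef nth_default.
have part1 n : has_order L n -> 2 * n%:Z <= K.
  move=> hn; have [nL hlaw] := lawn n hn; rewrite leNgt; apply/negP => Kn.
  have [a ha] := qL n nL; have [[tau [Ht h]] _] := hn.
  by apply: h; apply: (automorphic_neg ha (law_top hlaw)) => //; lia.
have comb n : isqs n (dcoef L) -> law k K n (dcoef L) -> (forall r, (r < n)%N -> 0 < K - 2 * r%:Z) -> 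
   (n <= size L)%N -> (forall r tau, (n <= r)%N -> upper_half tau -> dcoef L r tau = 0) -> RC_combination k K (dapply L).
  move=> q1 l1 k1 nL z1; have [N [c [r [g [h1 h2]]]]] := RC_of_law q1 l1 k1.
  exists N, c, r, g; split=> // f tau hf Ht; rewrite -h2// (@dapply_trunc _ _ n)// => s ns.
  exact: z1.
split=> //.
  (* The zero operator is the empty combination. Otherwise 2n < K, so that K - 2r > 0 for every r <=
     n. *)
  move=> hK; have [[n hn]|z] := order_exists L; last first.
    by apply: (comb 0%N) => // r tau _; exact: z.
  have [nL hlaw] := lawn n hn; apply: (comb n.+1) => //.
  - by move=> r rn; apply: qL; lia.
  - by move=> r rn; have := hK n hn; have := part1 n hn; lia.
  - by case: hn.
move=> n hn nK; have [nL hlaw] := lawn n hn; have [a ha] := qL n nL.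
(* For K = 2n the leading coefficient has weight 0, hence is a constant c. Subtracting c times the
   Kaneko-Koike coefficients leaves the indices r < n, where K - 2r > 0. *)
have aut := law_top hlaw; rewrite nK subrr in aut.
have top := automorphic0 ha aut; set c := a 0%N in top.
pose B r tau := dcoef L r tau - c * kk_coef k n r tau.
exists c, (fun f tau => \sum_(r < n) B r tau * iter r (@D R) f tau); split.
  apply: RC_of_law => [r rn|r|r rn].
  - have [b hb] := qL r (ltn_trans rn nL); have [b' hb'] := isq_kk_coef k n r.
    exact: isqB_Z hb hb'.
  - apply: law_drop; last by move=> tau Ht; rewrite /B kk_coef_top mulr1 top// subrr.
    by apply: lawB => //; rewrite -nK; exact: law_kk_coef.
  - by rewrite -nK; lia.
move=> f tau hf Ht; have [_ z] := hn.
rewrite (@dapply_trunc _ _ n.+1)//; last by move=> r nr; exact: z.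
rewrite big_ord_recr /= top//.
rewrite kaneko_koikeE.
rewrite mulrDr addrCA [RHS]addrC; congr (_ + _).
rewrite big_distrr -big_split /=; apply: eq_bigr => r _; rewrite /B; ring.
Qed.
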